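(* For $W>0$ let $\Xi^{\text{right triangle}}(W)\subset\mathbb{R}^2$ be the (open) right triangle with vertices $(0,0)$, $(W,0)$, $(0,1)$. Write $\phi(\Omega)$ for the quantity $\phi$ associated with the domain $\Omega$ and $\sigma=\kappa=1$. Then $$\phi\big(\Xi^{\text{right triangle}}(W)\big)\sim\frac{2}{3}\,W^{-2}\quad\text{as }W\to0.$$ Moreover $$\phi\big(\Xi^{\text{right triangle}}(1)\big)=\frac43,$$ and, for an equilateral triangle $\Xi^{\text{equilateral triangle}}$, $$\phi\big(\Xi^{\text{equilateral triangle}}\big)=1.$$
   Context: Definition of $\phi$ (for $\sigma=\kappa=1$): for a bounded connected Lipschitz domain $\Omega\subset\mathbb{R}^2$ with area $|\Omega|$, perimeter $|\partial\Omega|$ and $\gamma=|\partial\Omega|/|\Omega|$, set $\phi(\Omega)=\int_\Omega|\nabla\psi'^{\,0}|^2$, where $\psi'^{\,0}\in H^1(\Omega)$ is the unique weak solution of $-\Delta\psi'^{\,0}=|\Omega|^{-1/2}\gamma$ in $\Omega$, $\partial_n\psi'^{\,0}=-|\Omega|^{-1/2}$ on $\partial\Omega$, $\int_\Omega\psi'^{\,0}=0$; that is, $\int_\Omega\nabla\psi'^{\,0}\cdot\nabla v=|\Omega|^{-1/2}\big(\gamma\int_\Omega v-\int_{\partial\Omega}v\big)$ for all $v\in H^1(\Omega)$. (The size of the equilateral triangle is immaterial, since $\phi$ is scale invariant.) The notation $f\sim g$ means $f/g\to1$. *)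

(* Defs.v *)
From HB Require Import structures.
From mathcomp Require Import all_boot all_order all_algebra.
From mathcomp Require Import all_classical all_reals all_analysis.

Set Implicit Arguments.
Unset Strict Implicit.
Unset Printing Implicit Defensive.

Import Order.TTheory GRing.Theory Num.Theory.
Import numFieldNormedType.Exports.

Local Open Scope classical_set_scope.
Local Open Scope ring_scope.

(* The plane is [R * R].  Its library norm is the max norm, which is used only
   through the topology it induces; all lengths below are Euclidean. *)

Definition dot2 {R : realType} (x y : R * R) : R := x.1 * y.1 + x.2 * y.2.

Definition enorm {R : realType} (x : R * R) : R := Num.sqrt (dot2 x x).

Definition area_measure {R : realType} :
    {measure set (measurableTypeR R * measurableTypeR R) -> \bar R} :=
  ((@lebesgue_measure R) \x (@lebesgue_measure R))%E.

(* [false] is the first coordinate direction, [true] the second one. *)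
Definition evec {R : realType} (i : bool) : R * R :=
  if i then (0, 1) else (1, 0).

Definition partial {R : realType} (i : bool) (f : R * R -> R) : R * R -> R :=
  fun x => 'D_(evec i) f x.

Definition grad {R : realType} (f : R * R -> R) : R * R -> R * R :=
  fun x => (partial false f x, partial true f x).

Definition C1 {R : realType} (f : R * R -> R) : Prop :=
  forall i, (forall x, derivable f x (evec i)) /\ continuous (partial i f).

Definition Cinfty {R : realType} (f : R * R -> R) : Prop :=
  forall s : seq bool, C1 (foldr partial f s).

Definition test_function {R : realType} (Omega : set (R * R))
    (f : R * R -> R) : Prop :=
  let supp := closure [set x | f x != 0] in
  [/\ Cinfty f, compact supp & supp `<=` Omega].

Definition L2 {R : realType} (Omega : set (R * R)) (u : R * R -> R) : Prop :=
  measurable_fun Omega u /\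
  (\int[area_measure]_(x in Omega) (u x ^+ 2)%:E < +oo)%E.

(* [H1 Omega u g]: u belongs to H^1(Omega) and g is its weak gradient (which is
   unique up to a null set).  Only the values on Omega matter. *)
Definition H1 {R : realType} (Omega : set (R * R))
    (u : R * R -> R) (g : R * R -> R * R) : Prop :=
  [/\ L2 Omega u, L2 Omega (fun x => (g x).1), L2 Omega (fun x => (g x).2) &
    forall f i, test_function Omega f ->
      \int[area_measure]_(x in Omega) (u x * partial i f x) =
      - (\int[area_measure]_(x in Omega)
           ((if i then (g x).2 else (g x).1) * f x))].

(* The boundary of a domain is presented by a finite list of Lipschitz arcs
   parametrized by [0, 1], covering it and overlapping only at end points; the
   surface measure is then arc length, |gamma'(s)| ds. *)

Definition arc_integral {R : realType} (Gamma : seq (R -> R * R))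
    (f : R * R -> R) : \bar R :=
  (\sum_(gamma <- Gamma) \int[@lebesgue_measure R]_(s in `[0%R, 1%R])
      (f (gamma s) * enorm (derive1 gamma s))%:E)%E.

Definition L2_boundary {R : realType} (Gamma : seq (R -> R * R))
    (t : R * R -> R) : Prop :=
  (forall k, (k < size Gamma)%N ->
     measurable_fun (`[0, 1] : set R) (t \o nth (cst 0) Gamma k)) /\
  (arc_integral Gamma (fun x => (t x ^+ 2)%R) < +oo)%E.

(* [t] is the boundary trace of the H^1 function [u] with weak gradient [g]:
   the trace operator is the extension by continuity, from H^1(Omega) to
   L^2(boundary), of the restriction to the boundary of functions that are C^1
   up to the boundary.  On a bounded Lipschitz domain, every H^1 function has a
   trace, unique up to a null set of the boundary. *)
Definition is_trace {R : realType} (Omega : set (R * R))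
    (Gamma : seq (R -> R * R)) (u : R * R -> R) (g : R * R -> R * R)
    (t : R * R -> R) : Prop :=
  L2_boundary Gamma t /\
  exists w : nat -> R * R -> R,
    [/\ forall n, C1 (w n),
        (\int[area_measure]_(x in Omega) ((w n x - u x) ^+ 2)%:E
           @[n --> \oo] --> 0)%E,
        (\int[area_measure]_(x in Omega)
           (enorm (grad (w n) x - g x) ^+ 2)%:E @[n --> \oo] --> 0)%E &
        (arc_integral Gamma (fun x => (w n x - t x) ^+ 2)%R
           @[n --> \oo] --> 0)%E].

Definition area {R : realType} (Omega : set (R * R)) : R :=
  fine (area_measure Omega).

Definition perimeter {R : realType} (Gamma : seq (R -> R * R)) : R :=
  fine (arc_integral Gamma (cst 1)).

Definition weak_solution {R : realType} (Omega : set (R * R))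
    (Gamma : seq (R -> R * R)) (psi : R * R -> R) (g : R * R -> R * R) : Prop :=
  [/\ H1 Omega psi g,
      \int[area_measure]_(x in Omega) psi x = 0 &
      forall v h t, H1 Omega v h -> is_trace Omega Gamma v h t ->
        \int[area_measure]_(x in Omega) dot2 (g x) (h x) =
        (Num.sqrt (area Omega))^-1 *
          (perimeter Gamma / area Omega *
             \int[area_measure]_(x in Omega) v x
           - fine (arc_integral Gamma t))].

(* The solution being unique, so is the energy selected by [get]. *)
Definition phi {R : realType} (Omega : set (R * R))
    (Gamma : seq (R -> R * R)) : R :=
  get [set e : R | exists psi g, weak_solution Omega Gamma psi g /\
    e = \int[area_measure]_(x in Omega) (enorm (g x) ^+ 2)].

(* For A, B, C not collinear. *)
Definition open_triangle {R : realType} (A B C : R * R) : set (R * R) :=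
  [set x | exists a b c : R,
     [/\ 0 < a, 0 < b, 0 < c, a + b + c = 1 &
         x = a *: A + b *: B + c *: C]].

Definition edge {R : realType} (A B : R * R) : R -> R * R :=
  fun s => (1 - s) *: A + s *: B.

Definition triangle_boundary {R : realType} (A B C : R * R) :
    seq (R -> R * R) :=
  [:: edge A B; edge B C; edge C A].

Definition phi_triangle {R : realType} (A B C : R * R) : R :=
  phi (open_triangle A B C) (triangle_boundary A B C).

Definition equilateral {R : realType} (A B C : R * R) : Prop :=
  [/\ 0 < enorm (B - A), enorm (C - B) = enorm (B - A) &
      enorm (A - C) = enorm (B - A)].

(* Main.v *)
Require Import Defs.
From HB Require Import structures.
From mathcomp Require Import all_boot all_order all_algebra.
From mathcomp Require Import all_classical all_reals all_analysis.
From mathcomp Require Import measurable_realfun ring lra.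

Set Implicit Arguments.
Unset Strict Implicit.
Unset Printing Implicit Defensive.

Import Order.TTheory GRing.Theory Num.Theory.
Import numFieldNormedType.Exports.

Local Open Scope classical_set_scope.
Local Open Scope ring_scope.

(* Let I be the incenter and r the inradius of the triangle.  Since
   (x - I).n = r on every side, psi = k - |Omega|^(-1/2) / (2 r) |x - I|^2 solves
   the Neumann problem, and the divergence theorem turns its energy into edge
   integrals of |x - I|^2, i.e. into an explicit function of A, B, C.
   Uniqueness of the energy: the difference G of two weak gradients is a weak
   gradient orthogonal to grad w for all w of class C^1.  Let T_n be homotheties
   of ratio tending to 1 that map Omega well inside itself, and
   rho_n(x, y) = eta_n(x - T_n y) with eta_n a mollifier.  As a function of x,
   rho_n is a test function on Omega, while grad_y rho_n is a multiple of
   grad_x rho_n; integrating by parts in x and using the orthogonality in y gives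
   that the double integral of G(x).G(y) rho_n(x, y) vanishes, and it tends to a
   positive multiple of the integral of |G|^2. *)

(** [phi] is selected by [get], so its value is accessible only once all weak solutions are known to
    have the same energy. Testing with the difference of two solutions is not immediate:
    [weak_solution] tests only functions with a trace in the sense of [is_trace], which carries an
    approximating sequence of C^1 functions, and for the difference this would require density of
    functions that are C^1 up to the boundary. A C^1 function is its own trace; hence orthogonality
    is available against C^1 gradients only, and the kernel is made smooth in y on the whole plane
    but compactly supported in Omega in x. The limit needs only weak L^2 convergence of the averages
    of G, which can be checked on indicators of quadrants.

    On the explicit side, the only fields needed are (x - D) w with D a point: the weights of the
    three sides are then the barycentric coordinates of D, and the incenter is the point making them
    proportional to the side lengths. *)

Lemma eq_cvg_to (T : Type) (U : topologicalType) (F : set_system T)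
  (f g : T -> U) (l : U) : f =1 g -> f @ F --> l -> g @ F --> l.
Proof. by move=> /funext->. Qed.

(** * Square-integrable functions *)

Section square_integrable.
Context d (T : measurableType d) (R : realType).
Variables (mu : {measure set T -> \bar R}) (D : set T) (mD : measurable D).
Implicit Types f g : T -> R.

(** [L2 Omega] is this notion for [area_measure]; an arbitrary measure is allowed because it also
    serves for traces, on the parameter interval of an edge. *)
Definition sqint f := measurable_fun D f /\
  (\int[mu]_(x in D) (f x ^+ 2)%:E < +oo)%E.

Lemma sqint_integrable f : sqint f ->
  mu.-integrable D (EFin \o (fun x => f x ^+ 2)).
Proof.
case=> mf fo; apply/integrableP; split.
  by apply/measurable_EFinP; exact: measurable_funX.
rewrite (le_lt_trans _ fo)// le_eqVlt; apply/orP; left; apply/eqP.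
by apply: eq_integral => x _ /=; rewrite ger0_norm// sqr_ge0.
Qed.

Lemma le_integrableR f g : measurable_fun D f ->
  (forall x, D x -> `|f x| <= g x) ->
  mu.-integrable D (EFin \o g) -> mu.-integrable D (EFin \o f).
Proof.
move=> mf fg; apply: le_integrable => //; first exact/measurable_EFinP.
by move=> x Dx; rewrite /= lee_fin (le_trans (fg _ Dx))// ler_norm.
Qed.

Lemma integrableRD f g : mu.-integrable D (EFin \o f) ->
  mu.-integrable D (EFin \o g) ->
  mu.-integrable D (EFin \o (fun x => f x + g x)).
Proof. exact: integrableD. Qed.

Lemma integrableRB f g : mu.-integrable D (EFin \o f) ->
  mu.-integrable D (EFin \o g) ->
  mu.-integrable D (EFin \o (fun x => f x - g x)).
Proof. exact: integrableB. Qed.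

Lemma integrableRZ a f : mu.-integrable D (EFin \o f) ->
  mu.-integrable D (EFin \o (fun x => a * f x)).
Proof. exact: integrableZl. Qed.

Lemma integrable_sqint f : measurable_fun D f ->
  mu.-integrable D (EFin \o (fun x => f x ^+ 2)) -> sqint f.
Proof.
move=> mf /integrableP[_ fo]; split => //.
rewrite (le_lt_trans _ fo)// le_eqVlt; apply/orP; left; apply/eqP.
by apply: eq_integral => x _ /=; rewrite ger0_norm// sqr_ge0.
Qed.

Lemma sqintM f g : sqint f -> sqint g ->
  mu.-integrable D (EFin \o (fun x => f x * g x)).
Proof.
move=> sf sg; have [[mf _] [mg _]] := (sf, sg).
apply: (@le_integrableR _ (fun x => f x ^+ 2 + g x ^+ 2)).
- exact: measurable_funM.
- move=> x _; rewrite ler_norml.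
  have := sqr_ge0 (f x + g x); have := sqr_ge0 (f x - g x).
  have := sqr_ge0 (f x); have := sqr_ge0 (g x).
  by rewrite !expr2 => *; apply/andP; split; nra.
- by apply: integrableRD; exact: sqint_integrable.
Qed.

Lemma sqintD f g : sqint f -> sqint g -> sqint (fun x => f x + g x).
Proof.
move=> sf sg; have [[mf _] [mg _]] := (sf, sg).
apply: integrable_sqint; first exact: measurable_funD.
apply: (@le_integrableR _ (fun x => 2 * f x ^+ 2 + 2 * g x ^+ 2)).
- by apply: measurable_funX; exact: measurable_funD.
- move=> x _; rewrite ger0_norm ?sqr_ge0//.
  by have := sqr_ge0 (f x - g x); rewrite !expr2; nra.
- by apply: integrableRD; apply: integrableRZ; exact: sqint_integrable.
Qed.

Lemma sqintZ a f : sqint f -> sqint (fun x => a * f x).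
Proof.
move=> sf; have [mf _] := sf.
apply: integrable_sqint; first exact: measurable_funM.
have := integrableRZ (a ^+ 2) (sqint_integrable sf).
by under eq_fun do rewrite -exprMn.
Qed.

Lemma sqintB f g : sqint f -> sqint g -> sqint (fun x => f x - g x).
Proof.
move=> sf sg; have := sqintD sf (sqintZ (-1) sg).
by under eq_fun do rewrite mulN1r.
Qed.

Lemma dominated_convergenceR (f_ : nat -> T -> R) f h :
  (forall n, measurable_fun D (f_ n)) -> measurable_fun D f ->
  {ae mu, forall x, D x -> f_ n x @[n --> \oo] --> f x} ->
  mu.-integrable D (EFin \o h) ->
  (forall n x, D x -> `|f_ n x| <= h x) ->
  \int[mu]_(x in D) f_ n x @[n --> \oo] --> \int[mu]_(x in D) f x.
Proof.
move=> mf_ mf ff ih fh.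
have [] := @dominated_convergence _ _ _ mu D mD (fun n => EFin \o f_ n)
  (EFin \o f) (EFin \o h).
- by move=> n; exact/measurable_EFinP.
- exact/measurable_EFinP.
- by apply: filterS ff => x fx Dx; apply: cvg_EFin; [exact: nearW|exact: fx].
- exact: ih.
- by apply: aeW => x n Dx; rewrite /= lee_fin fh.
move=> if_ _ cf; apply: fine_cvg.
rewrite /Rintegral fineK//; exact: integrable_fin_num.
Qed.

Hypothesis Doo : (mu D < +oo)%E.

Lemma integrable_cstR a : mu.-integrable D (EFin \o (fun=> a)).
Proof.
apply/integrableP; split; first exact: measurable_cst.
by rewrite /= integral_cst// lte_mul_pinfty.
Qed.

Lemma bounded_sqint f M : measurable_fun D f ->
  (forall x, D x -> `|f x| <= M) -> sqint f.
Proof.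
move=> mf fM; apply: integrable_sqint => //.
apply: (@le_integrableR _ (fun=> M ^+ 2)) => //; last exact: integrable_cstR.
- exact: measurable_funX.
- move=> x Dx; rewrite normrX lerXn2r// ?nnegrE//; last exact: fM.
  by rewrite (le_trans _ (fM _ Dx)).
Qed.

Lemma sqint_integrable1 f : sqint f -> mu.-integrable D (EFin \o f).
Proof.
move=> sf; have s1 : sqint (fun=> 1).
  by apply: (@bounded_sqint _ 1) => // x _; rewrite normr1.
by have := sqintM sf s1; under eq_fun do rewrite mulr1.
Qed.

(** Stands in for the Cauchy-Schwarz inequality: a choice of [th] adapted to the wanted precision
    makes both terms small, without square roots. It comes from |f g| <= 2 |f g| <= th^-1 f^2 + th
    g^2. *)
Lemma young_Rintegral f g (th : R) : 0 < th -> sqint f -> sqint g ->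
  `|\int[mu]_(x in D) (f x * g x)| <=
  th^-1 * \int[mu]_(x in D) (f x ^+ 2) + th * \int[mu]_(x in D) (g x ^+ 2).
Proof.
move=> th0 sf sg; have iM := sqintM sf sg.
have [if_ ig] := (sqint_integrable sf, sqint_integrable sg).
rewrite (le_trans (le_normr_Rintegral mD iM))//.
rewrite -!RintegralZl// -RintegralD//; [|exact: integrableRZ..].
apply: le_Rintegral => //.
- have [? ?] := integrableP _ _ _ iM; apply/integrableP; split.
    by apply/measurable_EFinP/measurableT_comp => //; exact/measurable_EFinP.
  by under eq_integral do rewrite /= normr_id.
- by apply: integrableRD; apply: integrableRZ.
- move=> x _; rewrite normrM.
  have := sqr_ge0 (th^-1 * `|f x| - `|g x|).
  rewrite -[f x ^+ 2]real_normK ?num_real// -[g x ^+ 2]real_normK ?num_real//.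
  have := normr_ge0 (f x); have := normr_ge0 (g x).
  move: (`|f x|) (`|g x|) => a b b0 a0.
  have -> : th^-1 * a ^+ 2 + th * b ^+ 2 =
     a * b + th * (th^-1 * a - b) ^+ 2 + a * b by field; rewrite gt_eqF.
  by move=> h; rewrite -addrA lerDl addr_ge0// mulr_ge0// ltW.
Qed.

End square_integrable.

Import HBNNSimple.

(** * Weak convergence in L^2 *)

Section weak_convergence.
Context d (T : measurableType d) (R : realType).
Variables (mu : {measure set T -> \bar R}) (D : set T) (mD : measurable D).
Hypothesis Doo : (mu D < +oo)%E.
Variables (K : nat -> T -> R) (M : R).
Hypothesis sK : forall n, sqint mu D (K n).
Hypothesis KM : forall n, \int[mu]_(x in D) (K n x ^+ 2) <= M.

Let V (g : T -> R) := sqint mu D g /\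
  \int[mu]_(x in D) (g x * K n x) @[n --> \oo] --> (0 : R).

(* V is a closed subspace of L^2; Dynkin's lemma for the pi-system G puts every
   indicator in it. *)
Let V_closed g : sqint mu D g ->
  (forall eta, 0 < eta -> exists2 g', V g' &
     \int[mu]_(x in D) ((g x - g' x) ^+ 2) <= eta) -> V g.
Proof.
move=> sg gg'; split => //; apply/cvgrPdist_le => e e0.
have M0 : 0 < `|M| + 1 by rewrite ltr_wpDl.
(* This gives th * (|M| + 1) = e / 4, which bounds the term in [K n]; the approximation error
   [th * (e / 4)] bounds the other term by e / 4 as well. Using |M| + 1 keeps the denominator
   positive. *)
pose th := e / (4 * (`|M| + 1)).
have th0 : 0 < th by rewrite divr_gt0// mulr_gt0.
have [|g' [sg' cg'] hg'] := gg' (th * (e / 4)); first by rewrite mulr_gt0// divr_gt0.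
move/cvgrPdist_le : cg' => /(_ (e / 2)); rewrite divr_gt0// => /(_ isT).
apply: filterS => n; rewrite !sub0r !normrN => h.
have -> : \int[mu]_(x in D) (g x * K n x) =
    \int[mu]_(x in D) ((g x - g' x) * K n x) + \int[mu]_(x in D) (g' x * K n x).
  rewrite -RintegralD//; [|exact: sqintM (sqintB _ _ _) _|exact: sqintM].
  by apply: eq_Rintegral => x _; rewrite mulrBl subrK.
rewrite (le_trans (ler_normD _ _))//.
have := young_Rintegral mD th0 (sqintB mD sg sg') (sK n).
have h1 : th^-1 * \int[mu]_(x in D) ((g x - g' x) ^+ 2) <= e / 4.
  by rewrite ler_pdivrMl.
have h2 : th * \int[mu]_(x in D) (K n x ^+ 2) <= e / 4.
  rewrite (@le_trans _ _ (th * (`|M| + 1)))//.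
    by rewrite ler_wpM2l ?(ltW th0)// (le_trans (KM n))// (le_trans (ler_norm M))// lerDl.
  rewrite /th invfM mulrA -!mulrA mulVf ?mulr1// gt_eqF//.
move=> h3; move: h1 h2 h3 h; move: (th^-1 * _) (th * _) `|_| `|_| => a b c d'; lra.
Qed.

Let V_D f g : V f -> V g -> V (fun x => f x + g x).
Proof.
move=> [sf cf] [sg cg]; split; first exact: sqintD.
rewrite -[X in _ --> X](addr0 (0 : R)).
apply: (eq_cvg_to _ (cvgD cf cg)) => n; rewrite fctE -RintegralD//; [|exact: sqintM..].
by apply: eq_Rintegral => x _; rewrite mulrDl.
Qed.

Let V_Z a f : V f -> V (fun x => a * f x).
Proof.
move=> [sf cf]; split; first exact: sqintZ.
rewrite -[X in _ --> X](mulr0 a).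
apply: (eq_cvg_to _ (cvgM (cvg_cst a) cf)) => n.
rewrite /= -RintegralZl//; last exact: sqintM.
by apply: eq_Rintegral => x _; rewrite mulrA.
Qed.

Let V0 : V (fun=> 0).
Proof.
split; first by apply: (@bounded_sqint _ _ _ _ _ _ _ _ 0) => // x _; rewrite normr0.
under eq_fun do under eq_Rintegral do rewrite mul0r.
by under eq_fun do rewrite Rintegral_cst// mul0r; exact: cvg_cst.
Qed.

Let V_sum (I : Type) (s : seq I) (f : I -> T -> R) :
  (forall i, V (f i)) -> V (fun x => \sum_(i <- s) f i x).
Proof.
move=> Vf; elim: s => [|i s IH].
  by under eq_fun do rewrite big_nil; exact: V0.
by under eq_fun do rewrite big_cons; exact: V_D.
Qed.

(** The dominating function is square integrable: h^2 dominates (g - g_ n)^2, so that g_ n tends to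
    g in L^2 and [V_closed] applies. *)
Let V_lim g_ g h : (forall n, V (g_ n)) -> sqint mu D g ->
  (forall x, D x -> g_ n x @[n --> \oo] --> g x) -> sqint mu D h ->
  (forall n x, D x -> `|g x - g_ n x| <= h x) -> V g.
Proof.
move=> Vg sg gg sh gh; apply: V_closed => // eta eta0.
have : \int[mu]_(x in D) ((g x - g_ n x) ^+ 2) @[n --> \oo] -->
    \int[mu]_(x in D) (0 : R).
  apply: (@dominated_convergenceR _ _ _ _ _ _ _ _ (fun x => h x ^+ 2)) => //.
  - move=> n; apply: measurable_funX; apply: measurable_funB; first by case: sg.
    by case: (Vg n) => -[].
  - apply: aeW => x Dx.
    have h0 : g x - g_ n x @[n --> \oo] --> (0 : R).
      by rewrite -[X in _ --> X](subrr (g x)); apply: cvgB (gg x Dx); exact: cvg_cst.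
    rewrite -[X in _ --> X](mulr0 (0 : R)).
    by apply: (eq_cvg_to _ (cvgM h0 h0)) => n; rewrite /= expr2.
  - exact: sqint_integrable.
  - move=> n x Dx; rewrite ger0_norm ?sqr_ge0// -[X in X ^+ 2 <= _]/(g x - g_ n x).
    rewrite -[leLHS]real_normK ?num_real//.
    by rewrite lerXn2r ?nnegrE ?gh// (le_trans _ (gh n x Dx)).
rewrite Rintegral_cst// mul0r => /cvgrPdist_le/(_ _ eta0) [n _ /(_ n (leqnn n))].
rewrite /= sub0r normrN => hn; exists (g_ n) => //.
by rewrite (le_trans _ hn)// ler_norm.
Qed.

Variable G : set (set T).
Hypothesis measG : @measurable _ T = <<s G >>.
Hypothesis GI : setI_closed G.
Hypothesis KG : forall A, G A ->
  \int[mu]_(x in D) (\1_A x * K n x) @[n --> \oo] --> (0 : R).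
(** The complement step of Dynkin's lemma needs the constant 1, and the whole space need not belong
    to [G]. *)
Hypothesis KD : \int[mu]_(x in D) (K n x) @[n --> \oo] --> (0 : R).

Let sqint_indic A : measurable A -> sqint mu D (\1_A).
Proof.
move=> mA; apply: (@bounded_sqint _ _ _ _ _ mD Doo _ 1).
  exact: measurable_indic.
by move=> x _; rewrite indicE ger0_norm// lern1; case: (_ \in _).
Qed.

Let V1 : V (fun=> 1).
Proof.
split; first by apply: (@bounded_sqint _ _ _ _ _ _ _ _ 1) => // x _; rewrite normr1.
by under eq_fun do under eq_Rintegral do rewrite mul1r.
Qed.

Let V_indic A : measurable A -> V (\1_A).
Proof.
have mG B : G B -> measurable B by rewrite measG; exact: sub_gen_smallest.
rewrite measG; move: A; apply: (@dynkin_induction _ _ G (fun A => V (\1_A)) measG GI).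
- by rewrite indicT.
- by move=> B GB; split; [exact/sqint_indic/mG|exact: KG].
- move=> B mB VB; have := V_D V1 (V_Z (-1) VB).
  congr V; apply/funext => x; rewrite !indicE in_setC.
  by case: (x \in B) => /=; rewrite ?mulr1 ?mulr0 ?subrr ?addr0.
- move=> F mF tF VF.
  (* The pieces are disjoint, so the indicators of the partial unions are finite sums; they converge
     pointwise to the indicator of the union, and the differences are dominated by 1. *)
  pose S n : set T := \big[setU/set0]_(k < n) F k.
  have VS n : V (\1_(S n)).
    rewrite /S; elim: n => [|n IH]; first by rewrite big_ord0 indic0.
    have := V_D IH (VF n); congr V; apply/funext => x.
    rewrite big_ord_recr /= !indicE in_setU.
    have [xFn|] := boolP (x \in F n); rewrite ?orbT ?orbF ?addr0//.
    suff /negbTE -> : x \notin \big[setU/set0]_(k < n) F k by rewrite add0r.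
    rewrite -bigcup_mkord notin_setE => -[k /= kn Fkx].
    have : n = k.
      by apply: (tF _ _ I I); exists x; split => //; exact: set_mem.
    by move=> nk; rewrite nk ltnn in kn.
  apply: (@V_lim (fun n => \1_(S n)) _ (fun=> 1)) => //.
  + by apply/sqint_indic/bigcup_measurable.
  + move=> x Dx; have [[k _ Fkx]|nF] := pselect ((\bigcup_k F k) x).
      rewrite [in X in _ --> X]indicE mem_set; last by exists k.
      apply: cvg_near_cst; exists k.+1 => // n /= kn.
      by rewrite indicE mem_set// /S -bigcup_mkord; exists k.
    rewrite [in X in _ --> X]indicE memNset//.
    apply: cvg_near_cst; apply: nearW => n.
    rewrite indicE memNset// /S -bigcup_mkord => -[k _ Fkx].
    by apply: nF; exists k.
  + by case: V1.
  + move=> n x Dx; rewrite !indicE.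
    by case: (_ \in _); case: (_ \in _); rewrite /= ?subrr ?subr0 ?sub0r ?normrN ?normr1 ?normr0.
Qed.

(** The simple approximations lie between 0 and [g], so [g] itself dominates the error. *)
Let V_ge0 g : sqint mu D g -> (forall x, 0 <= g x) -> V g.
Proof.
move=> sg g0; have mg : measurable_fun D (EFin \o g) by apply/measurable_EFinP; case: sg.
pose g_ := nnsfun_approx mD mg.
have g0E x : D x -> (0 <= (EFin \o g) x)%E by move=> _; rewrite lee_fin.
have cg x : D x -> g_ n x @[n --> \oo] --> g x.
  by move=> Dx; exact: fine_cvg (cvg_nnsfun_approx mD mg g0E Dx).
apply: (@V_lim g_ g g) => //.
- move=> n.
  have /funext -> := fimfunEord (g_ n).
  by apply: V_sum => i; apply: V_Z; exact: V_indic.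
- move=> n x Dx; have gn0 : 0 <= g_ n x by [].
  have gnx : g_ n x <= g x.
    by have := le_approx n g0E Dx; rewrite -(nnsfun_approxE mD mg) lee_fin.
  by rewrite ger0_norm ?subr_ge0// gerBl.
Qed.

(** [g] is the difference of max(g, 0) and max(-g, 0), two square-integrable nonnegative
    functions. *)
Lemma weak_convergence_sqint g : sqint mu D g ->
  \int[mu]_(x in D) (g x * K n x) @[n --> \oo] --> (0 : R).
Proof.
move=> sg; have [mg _] := sg.
have sp (f : T -> R) : sqint mu D f -> V (fun x => Num.max (f x) 0).
  move=> sf; apply: V_ge0 => [|x]; last by rewrite le_max lexx orbT.
  apply: integrable_sqint; first by apply: measurable_maxr => //; case: sf.
    apply: (le_integrableR mD _ _ (sqint_integrable sf)) => /=.
    by apply/measurable_funX/measurable_maxr => //; case: sf.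
  move=> x _; rewrite ger0_norm ?sqr_ge0//; have [_|_] := leP (f x) 0; last by [].
  by have := sqr_ge0 (f x); rewrite !expr2; nra.
have [_] := V_D (sp _ sg) (V_Z (-1) (sp _ (sqintZ mD (-1) sg))).
apply: eq_cvg_to => n; apply: eq_Rintegral => x _; congr (_ * _).
by have [] := leP (g x) 0; have [] := leP (-1 * g x) 0; lra.
Qed.

End weak_convergence.

(** * Derivatives, bump functions and affine substitutions *)

Section line_derivative.
Variables (R : numFieldType) (V W : normedModType R).

Lemma is_derive_lineP (f : V -> W) x v d :
  is_derive x v f d <-> is_derive (0 : R) 1 (fun h : R => f (h *: v + x)) d.
Proof.
have E : 'D_v f x = 'D_1 (fun h : R => f (h *: v + x)) 0.
  rewrite /derive; set g1 := fun h => h^-1 *: _; set g2 := fun h => h^-1 *: _.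
  suff -> : g1 = g2 by [].
  by apply/funext => h; rewrite /g1 /g2 /= addr0 scale0r add0r [_%:A]mulr1.
split=> -[df ed]; apply: DeriveDef.
- exact: (derivable1P f x v).1.
- by rewrite -E.
- exact: (derivable1P f x v).2.
- by rewrite E.
Qed.

End line_derivative.

Section bump.
Variable R : realType.
Implicit Types (p : {poly R}) (f g : R -> R).

Lemma is_derive_affine f (a c x d : R) : is_derive (a * x + c) 1 f d ->
  is_derive x 1 (fun t => f (a * t + c)) (a * d).
Proof.
move=> fd; have h : is_derive x 1 (fun t : R => a * t + c) a.
  rewrite (_ : (fun t : R => a * t + c) = a \*: (@id R) + cst c)//.
  by apply: is_derive_eq; rewrite addr0 [_%:A]mulr1.
by rewrite mulrC; exact: (is_derive1_comp (f := f)).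
Qed.

(** The flat function p(1/x) exp(-1/x), extended by 0. Keeping the polynomial as a parameter makes
    the family stable under differentiation: the derivative replaces p(t) by t^2 (p(t) - p'(t)),
    which is [dexpinv]. *)
Definition expinv p (x : R) : R :=
  if 0 < x then p.[x^-1] * expR (- x^-1) else 0.

Definition dexpinv p := 'X ^+ 2 * (p - p^`()).

(** With t = 1/x, each monomial satisfies t^(i+2) <= (i+2)! exp(t). The order 2 at the origin is
    what makes the difference quotient at 0 tend to 0. *)
Lemma expinv_bound p : exists C, forall x, `|expinv p x| <= C * x ^+ 2.
Proof.
pose C := \sum_(i < size p) `|p`_i| * (i.+2)`!%:R.
have C0 : 0 <= C by apply: sumr_ge0 => i _; rewrite mulr_ge0.
exists C => x; rewrite /expinv; case: ifPn => x0; last first.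
  by rewrite normr0 mulr_ge0// sqr_ge0.
have t0 : 0 < x^-1 by rewrite invr_gt0.
rewrite -[x in leRHS]invrK; move: (x^-1) t0 => t t0.
rewrite normrM (ger0_norm (expR_ge0 _)) expRN ler_pdivrMr ?expR_gt0//.
suff : `|p.[t]| * t ^+ 2 <= C * expR t.
  rewrite exprVn -ler_pdivlMr ?exprn_gt0// => /le_trans; apply.
  by rewrite mulrAC.
rewrite horner_coef (le_trans (ler_wpM2r _ (ler_norm_sum _ _ _)))//.
  by rewrite sqr_ge0.
rewrite !mulr_suml; apply: ler_sum => i _.
rewrite normrM -!mulrA ler_wpM2l// normrX (gtr0_norm t0) -exprD addn2.
rewrite mulrC -ler_pdivrMr ?ltr0n ?fact_gt0//.
by rewrite (le_trans _ (expR_ge1Dxn i.+1 (ltW t0)))// lerDr.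
Qed.

Lemma is_derive_expinv p (x : R) : is_derive x 1 (expinv p) (expinv (dexpinv p) x).
Proof.
have [x0|x0|->] := ltgtP x 0.
- apply: (@near_eq_is_derive _ _ _ (cst 0)).
    near=> y; rewrite /expinv ifF//; apply/negbTE; rewrite -leNgt ltW//.
    by near: y; exact: lt_nbhsl.
  by rewrite /expinv ifF; [exact: is_derive_cst|apply/negbTE; rewrite -leNgt ltW].
- apply: (@near_eq_is_derive R R R (fun y : R => p.[y^-1] * expR (- y^-1))).
    near=> y; rewrite /expinv ifT//.
    by near: y; exact: lt_nbhsr.
  have xn0 : x != 0 by rewrite gt_eqF.
  have dV : is_derive x 1 (fun y : R => y^-1) (- x ^- 2).
    have := @is_deriveV _ (@id R) x 1 1 xn0 _.
    by rewrite /= [_ *: _]mulr1; apply.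
  have dp : is_derive x 1 (fun y : R => p.[y^-1]) (p^`().[x^-1] * - x ^- 2).
    exact: (is_derive1_comp (f := horner p) (g := fun y => y^-1)).
  have de : is_derive x 1 (fun y : R => expR (- y^-1)) (expR (- x^-1) * x ^- 2).
    apply: (is_derive1_comp (f := expR) (g := fun y => - y^-1)).
    by have := is_deriveN dV; rewrite opprK.
  apply: (is_derive_eq (is_deriveM dp de)).
  rewrite /expinv x0 /dexpinv !hornerE [_ *: _]mulrA.
  by rewrite /GRing.scale /= exprVn; ring.
- have [C hC] := expinv_bound p.
  have e0 q : expinv q 0 = 0 by rewrite /expinv ltxx.
  rewrite e0; suff h : (fun h : R => h^-1 *: ((expinv p \o shift 0) (h *: 1) - expinv p 0)) @ 0^' --> (0 : R).
    by apply: DeriveDef; [apply/cvg_ex; exists 0|exact: cvg_lim h].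
  rewrite e0; apply: (@cvg_to_0_linear _ _ C 1) => // h /andP[h0 _].
  rewrite subr0 /= addr0 [_%:A]mulr1 normrM normfV ler_pdivrMl//.
  by rewrite (le_trans (hC h))// -[h ^+ 2]real_normK ?num_real// expr2 mulrCA.
Unshelve. all: by end_near. Qed.

(* A class of functions closed under differentiation, hence made of smooth
   functions. *)
Inductive smooth_gen : (R -> R) -> Prop :=
| smooth_expinv p a c : smooth_gen (fun x => expinv p (a * x + c))
| smooth_add f g : smooth_gen f -> smooth_gen g -> smooth_gen (fun x => f x + g x)
| smooth_mul f g : smooth_gen f -> smooth_gen g -> smooth_gen (fun x => f x * g x).

Lemma smooth_gen_derive f : smooth_gen f ->
  exists2 f', smooth_gen f' & forall x : R, is_derive x 1 f (f' x).
Proof.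
elim=> [p a c|{}f g _ [f' sf' df] _ [g' sg' dg]|{}f g sf [f' sf' df] sg [g' sg' dg]].
- exists (fun x => expinv (a *: dexpinv p) (a * x + c)); first exact: smooth_expinv.
  move=> x; apply: (is_derive_eq (is_derive_affine (is_derive_expinv p (a * x + c)))).
  rewrite /expinv; case: ifP => _; last by rewrite mulr0.
  by rewrite hornerZ mulrA.
- by exists (fun x => f' x + g' x); [exact: smooth_add|move=> x; exact: is_deriveD].
- exists (fun x => f x * g' x + g x * f' x) => [|x]; last exact: is_deriveM.
  by apply: smooth_add; apply: smooth_mul.
Qed.

Definition bump (x : R) := expinv 1 (x + 1) * expinv 1 (1 - x).

End bump.

Section affine_substitution1.
Context {R : realType}.
Local Notation mu := (@lebesgue_measure R).

Lemma measurable_affine (p q : R) :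
  measurable_fun setT (fun x : measurableTypeR R => p * x + q : measurableTypeR R).
Proof. by apply: measurable_funD => //; exact: measurable_funM. Qed.

(** The scaled pushforward under the affine map agrees with Lebesgue measure on the intervals []a,
    b]], which determine it. A negative [p] reverses the interval, so that its open and closed ends
    are exchanged. *)
Lemma lebesgue_measure_affine (p q : R) (A : set (measurableTypeR R)) :
  p != 0 -> measurable A ->
  mu A = (`|p|%:E * mu ((fun x => (p * x + q)%R) @^-1` A))%E.
Proof.
move=> p0 mA; pose phi (x : measurableTypeR R) : measurableTypeR R := p * x + q.
have mphi : measurable_fun setT phi by exact: measurable_affine.
pose m : {measure set (measurableTypeR R) -> \bar R} :=
  measure_function_pushforward__canonical__measure_function_Measure mu mphi.
apply: (@lebesgue_measure_unique _ (mscale (NngNum (normr_ge0 p)) m)) mA.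
move=> _ [[a b]] /= ab <-; rewrite /mscale /= /m /pushforward.
have [pgt0|plt0] : 0 < p \/ p < 0 by move: p0; rewrite neq_lt => /orP[]; [right|left].
- rewrite (_ : phi @^-1` _ = `](p^-1 * (a - q)), (p^-1 * (b - q))]%classic); last first.
    apply/seteqP; split => x /=; rewrite /phi !in_itv/=;
    by rewrite ltr_pdivrMl// ler_pdivlMl// ltrBlDr lerBrDr.
  rewrite !lebesgue_measure_itv/= !lte_fin ltr_pM2l ?invr_gt0// ltrD2r.
  case: ifPn => _; last by rewrite mule0.
  rewrite -!EFinB -EFinM gtr0_norm// -mulrBr mulrA divff// mul1r.
  by congr (_%:E); ring.
- rewrite (_ : phi @^-1` _ = `[(p^-1 * (b - q)), (p^-1 * (a - q))[%classic); last first.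
    apply/seteqP; split => x /=; rewrite /phi !in_itv/=;
    by rewrite ltr_ndivlMl// ler_ndivrMl// ltrBlDr lerBrDr andbC.
  rewrite !lebesgue_measure_itv/= !lte_fin ltr_nM2l ?invr_lt0// ltrD2r.
  case: ifPn => _; last by rewrite mule0.
  rewrite -!EFinB -EFinM ltr0_norm// -mulrBr mulNr mulrA divff// mul1r.
  by congr (_%:E); ring.
Qed.

Lemma ge0_integral_affine (p q : R) (f : R -> \bar R) : p != 0 ->
  measurable_fun [set: measurableTypeR R] f -> (forall x, 0 <= f x)%E ->
  (\int[mu]_x f x = `|p|%:E * \int[mu]_x f (p * x + q)%R)%E.
Proof.
move=> p0 mf f0; pose phi (x : measurableTypeR R) : measurableTypeR R := p * x + q.
have mphi : measurable_fun setT phi by exact: measurable_affine.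
have := @ge0_integral_pushforward _ _ _ _ _ _ mphi mu setT f measurableT mf.
rewrite preimage_setT => <- //.
pose m : {measure set (measurableTypeR R) -> \bar R} :=
  measure_function_pushforward__canonical__measure_function_Measure mu mphi.
rewrite -(@ge0_integral_mscale _ _ _ m _ _ (NngNum (normr_ge0 p)))//.
apply: eq_measure_integral => A mA _.
exact: lebesgue_measure_affine.
Qed.

End affine_substitution1.

Section affine_substitution2.
Context {R : realType}.
Local Notation mu := (@lebesgue_measure R).
Local Notation T := (measurableTypeR R).

Lemma measurable_affine2 (a p q : R) :
  measurable_fun setT (fun x : T * T => a + p * x.1 + q * x.2 : T).
Proof.
by apply: measurable_funD; [apply: measurable_funD|];
  rewrite //; apply: measurable_funM.
Qed.

Lemma measurable_affine_pair (a p q b r s : R) :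
  measurable_fun setT (fun x : T * T =>
    (a + p * x.1 + q * x.2, b + r * x.1 + s * x.2) : T * T).
Proof. by apply/measurable_fun_pair; exact: measurable_affine2. Qed.

Let ge0_shear (c b a : R) (f : T * T -> \bar R) : c != 0 ->
  measurable_fun setT f -> (forall x, 0 <= f x)%E ->
  (\int[area_measure]_x f x = `|c|%:E *
   \int[area_measure]_x f (x.1, (a + b * x.1 + c * x.2)%R))%E.
Proof.
move=> c0 mf f0.
have mg : measurable_fun setT (fun x : T * T => f (x.1, a + b * x.1 + c * x.2)).
  apply: measurableT_comp => //; apply/measurable_fun_pair => //.
  exact: measurable_affine2.
rewrite /area_measure !fubini_tonelli1// /fubini_F.
rewrite -ge0_integralZl//; last 2 first.
- exact: (measurable_fun_fubini_tonelli_F (m2 := mu) _ mg).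
- by move=> x _; exact: integral_ge0.
apply: eq_integral => t _ /=.
rewrite (ge0_integral_affine (a + b * t) c0)//; last first.
  by apply: measurableT_comp => //; exact: pair1_measurable.
by under eq_integral do rewrite addrC.
Qed.

Lemma ge0_integral_area_swap (f : T * T -> \bar R) :
  measurable_fun setT f -> (forall x, 0 <= f x)%E ->
  (\int[area_measure]_x f x = \int[area_measure]_x f (x.2, x.1))%E.
Proof.
move=> mf f0.
have mg : measurable_fun setT (fun x : T * T => f (x.2, x.1)).
  by apply: measurableT_comp => //; exact/measurable_fun_pair.
by rewrite /area_measure fubini_tonelli1// fubini_tonelli2.
Qed.

(** With p nonzero the matrix factors as ((1, 0), (r/p, d/p)) ((p, q), (0, 1)). Each factor changes
    a single coordinate and falls under [ge0_shear], the second one after exchanging the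
    coordinates. *)
Let ge0_affine_nz (a p q b r s : R) (f : T * T -> \bar R) :
  p * s - q * r != 0 -> p != 0 ->
  measurable_fun setT f -> (forall x, 0 <= f x)%E ->
  (\int[area_measure]_x f x = `|p * s - q * r|%:E *
    \int[area_measure]_x f (a + p * x.1 + q * x.2, b + r * x.1 + s * x.2)%R)%E.
Proof.
move=> d0 p0 mf f0; set d := p * s - q * r in d0 *.
have dp0 : d / p != 0 by rewrite mulf_neq0// invr_eq0.
have mL a' b' c' a'' b'' c'' : measurable_fun setT (fun x : T * T =>
    f (a' + b' * x.1 + c' * x.2, a'' + b'' * x.1 + c'' * x.2)).
  by apply: measurableT_comp => //; exact: measurable_affine_pair.
rewrite (ge0_shear (r / p) (b - r / p * a) dp0 mf f0).
rewrite ge0_integral_area_swap//=; last first.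
  apply: measurableT_comp => //; apply/measurable_fun_pair => //.
  exact: measurable_affine2.
rewrite (ge0_shear q a p0)//=; last first.
  apply: (eq_measurable_fun _ _ (mL 0 0 1 (b - r / p * a) (d / p) (r / p))).
  by move=> x _; congr (f (_, _)); ring.
rewrite muleA -EFinM -normrM divfK//; congr (_ * _)%E.
rewrite ge0_integral_area_swap//=; last first.
  apply: (eq_measurable_fun _ _ (mL a q p b s r)).
  by move=> x _; congr (f (_, _)); rewrite /d; field.
apply: eq_integral => x _; congr (f (_, _)); first by ring.
by rewrite /d; field.
Qed.

(** If p = 0, the determinant forces q to be nonzero, and exchanging the two integration variables
    exchanges the columns of the matrix. *)
Lemma ge0_integral_affine2 (a p q b r s : R) (f : T * T -> \bar R) :
  p * s - q * r != 0 -> measurable_fun setT f -> (forall x, 0 <= f x)%E ->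
  (\int[area_measure]_x f x = `|p * s - q * r|%:E *
    \int[area_measure]_x f (a + p * x.1 + q * x.2, b + r * x.1 + s * x.2)%R)%E.
Proof.
move=> d0 mf f0; have [p0|p0] := eqVneq p 0; last exact: ge0_affine_nz.
have q0 : q != 0 by apply: contraNneq d0 => ->; rewrite p0 !mul0r subrr.
rewrite (@ge0_affine_nz a q p b s r)//; last by rewrite -opprB oppr_eq0.
rewrite -normrN opprB; congr (_ * _)%E.
rewrite ge0_integral_area_swap//=; last first.
  by apply: measurableT_comp => //; exact: measurable_affine_pair.
by apply: eq_integral => x _; rewrite addrAC [b + _ + _]addrAC.
Qed.

Lemma Rintegral_affine2 (a p q b r s : R) (f : T * T -> R) :
  p * s - q * r != 0 -> measurable_fun setT f ->
  let fL x := f (a + p * x.1 + q * x.2, b + r * x.1 + s * x.2) in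
  (@area_measure R).-integrable setT (EFin \o fL) ->
  (@area_measure R).-integrable setT (EFin \o f) /\
  \int[area_measure]_x f x = `|p * s - q * r| * \int[area_measure]_x fL x.
Proof.
move=> d0 mf fL iL; have mF : measurable_fun setT (EFin \o f) by exact/measurable_EFinP.
have iF : (@area_measure R).-integrable setT (EFin \o f).
  apply/integrableP; split => //.
  rewrite (ge0_integral_affine2 a b d0)//; last exact: measurableT_comp.
  by move/integrableP : iL => [_ ?]; rewrite lte_mul_pinfty.
split => //; rewrite /Rintegral [in LHS]integralE [in RHS]integralE.
have -> : (\int[area_measure]_x (EFin \o f)^\+ x =
    `|p * s - q * r|%:E * \int[area_measure]_x (EFin \o fL)^\+ x)%E.
  have h := ge0_integral_affine2 a b d0 (measurable_funepos mF) (funepos_ge0 _).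
  by rewrite h; congr (_ * _)%E; apply: eq_integral => x _; rewrite !funeposE.
have -> : (\int[area_measure]_x (EFin \o f)^\- x =
    `|p * s - q * r|%:E * \int[area_measure]_x (EFin \o fL)^\- x)%E.
  have h := ge0_integral_affine2 a b d0 (measurable_funeneg mF) (funeneg_ge0 _).
  by rewrite h; congr (_ * _)%E; apply: eq_integral => x _; rewrite !funenegE.
have h1 := integrable_pos_fin_num measurableT iL.
have h2 := integrable_neg_fin_num measurableT iL.
by rewrite -(fineK h1) -(fineK h2) -!EFinM -!EFinB /= mulrBr.
Qed.

End affine_substitution2.

(** * Smooth and C^1 functions on the plane *)

Section plane_derivatives.
Context {R : realType}.
Implicit Types (w : R * R -> R) (x : R * R).

Lemma is_derive_partialF w x d :
  is_derive x (evec false) w d <-> is_derive x.1 1 (fun t => w (t, x.2)) d.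
Proof.
split=> /is_derive_lineP h; apply/is_derive_lineP; move: h; congr is_derive;
  apply/funext => h; congr w; apply/pair_equal_spec; split => /=;
  by rewrite ?scaler0 ?add0r.
Qed.

Lemma is_derive_partialT w x d :
  is_derive x (evec true) w d <-> is_derive x.2 1 (fun t => w (x.1, t)) d.
Proof.
split=> /is_derive_lineP h; apply/is_derive_lineP; move: h; congr is_derive;
  apply/funext => h; congr w; apply/pair_equal_spec; split => /=;
  by rewrite ?scaler0 ?add0r.
Qed.

Lemma C1_deriveF w x : C1 w ->
  is_derive x.1 1 (fun t => w (t, x.2)) (partial false w x).
Proof. by move=> /(_ false)[+ _] => /(_ x) /derivableP/is_derive_partialF. Qed.

Lemma C1_deriveT w x : C1 w ->
  is_derive x.2 1 (fun t => w (x.1, t)) (partial true w x).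
Proof. by move=> /(_ true)[+ _] => /(_ x) /derivableP/is_derive_partialT. Qed.

Definition tensor (f g : R -> R) (x : R * R) := f x.1 * g x.2.

Lemma is_derive_tensorF f g f' x : is_derive x.1 1 f (f' x.1) ->
  is_derive x (evec false) (tensor f g) (tensor f' g x).
Proof.
move=> df; apply/is_derive_partialF; rewrite /tensor /=.
have -> : (fun t => f t * g x.2) = g x.2 \*: f by apply/funext => t; rewrite mulrC.
by apply: (is_derive_eq (is_deriveZ _ df)); rewrite /tensor mulrC.
Qed.

Lemma is_derive_tensorT f g g' x : is_derive x.2 1 g (g' x.2) ->
  is_derive x (evec true) (tensor f g) (tensor f g' x).
Proof. by move=> dg; apply/is_derive_partialT; exact: (is_deriveZ (f x.1) dg). Qed.

Lemma smooth_gen_continuous (f : R -> R) : smooth_gen f -> continuous f.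
Proof.
move=> /smooth_gen_derive[f' _ df] x; apply: differentiable_continuous.
by apply/derivable1_diffP; case: (df x).
Qed.

Lemma tensor_continuous f g : continuous f -> continuous g -> continuous (tensor f g).
Proof.
move=> cf cg x; apply: cvgM.
  by apply: (@cvg_comp _ _ _ fst f) (cf _); exact: cvg_fst.
by apply: (@cvg_comp _ _ _ snd g) (cg _); exact: cvg_snd.
Qed.

(** Tensors of functions in [smooth_gen] are stable under both partial derivatives, so every
    iterated partial derivative is again such a tensor, hence continuous. *)
Lemma tensor_smooth f g : smooth_gen f -> smooth_gen g -> Cinfty (tensor f g).
Proof.
pose S w := exists f g, [/\ smooth_gen f, smooth_gen g & w = tensor f g].
have dS w i : S w -> (forall x, derivable w x (evec i)) /\ S (partial i w).
  move=> [{}f [{}g [sf sg ->]]].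
  have [f' sf' df] := smooth_gen_derive sf; have [g' sg' dg] := smooth_gen_derive sg.
  case: i.
    have h x := @is_derive_tensorT f g g' x (dg _).
    split=> [x|]; first by case: (h x).
    by exists f, g'; split => //; apply/funext => x; case: (h x).
  have h x := @is_derive_tensorF f g f' x (df _).
  split=> [x|]; first by case: (h x).
  by exists f', g; split => //; apply/funext => x; case: (h x).
move=> sf sg s; have Ss : S (foldr partial (tensor f g) s).
  elim: s => [|i s IH] /=; first by exists f, g.
  by have [] := dS _ i IH.
move=> i; have [ds Sps] := dS _ i Ss; split => //.
have [f1 [g1 [sf1 sg1 ->]]] := Sps.
by apply: tensor_continuous; exact: smooth_gen_continuous.
Qed.

End plane_derivatives.

Section plane_topology.
Context {R : realType}.
Implicit Types (w : R * R -> R) (x y : R * R).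

Lemma nbhs_box x (A : set (R * R)) : nbhs x A <->
  exists2 e, 0 < e & forall y, `|y.1 - x.1| < e -> `|y.2 - x.2| < e -> A y.
Proof.
split.
  move=> /nbhs_ballP[e e0 xA]; exists e => // y y1 y2; apply: xA.
  by split; rewrite /ball /= distrC.
move=> [e e0 xA]; apply/nbhs_ballP; exists e => // y [y1 y2].
by apply: xA; rewrite distrC.
Qed.

(** The plane carries the product sigma-algebra; an open set is the union of the countably many
    rational boxes that it contains. *)
Lemma open_box_measurable (A : set (measurableTypeR R * measurableTypeR R)) :
  (forall x, A x -> exists2 e, 0 < e &
    forall y, `|y.1 - x.1| < e -> `|y.2 - x.2| < e -> A y) ->
  measurable A.
Proof.
move=> oA.
pose box (q : rat * rat * (rat * rat)) : set (measurableTypeR R * measurableTypeR R) :=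
  `](ratr q.1.1 : R), ratr q.1.2[ `*` `](ratr q.2.1 : R), ratr q.2.2[.
have -> : A = \bigcup_q (if `[< box q `<=` A >] then box q else set0).
  apply/seteqP; split=> [x Ax|x [q _]]; last by case: asboolP => // + bx; exact.
  have [e e0 xA] := oA x Ax.
  have rat_lt (a b : R) : a < b -> exists q, a < ratr q < b.
    by move=> /rat_in_itvoo[q]; rewrite in_itv/=; exists q.
  have [|a1 /andP[? ?]] := rat_lt (x.1 - e) x.1; first by lra.
  have [|b1 /andP[? ?]] := rat_lt x.1 (x.1 + e); first by lra.
  have [|a2 /andP[? ?]] := rat_lt (x.2 - e) x.2; first by lra.
  have [|b2 /andP[? ?]] := rat_lt x.2 (x.2 + e); first by lra.
  exists (a1, b1, (a2, b2)) => //; case: asboolP => [_|].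
    by rewrite /box /=; split; rewrite /= in_itv/=; apply/andP.
  case; move=> y [/=]; rewrite !in_itv/= => /andP[? ?] /andP[? ?].
  by apply: xA; rewrite ltr_norml; apply/andP; split; lra.
apply: countable_bigcupT_measurable; first exact: countableP.
by move=> q; case: asboolP => // _; exact: measurableX.
Qed.

Lemma continuous_measurable2 w : continuous w ->
  measurable_fun [set: measurableTypeR R * measurableTypeR R] w.
Proof.
move=> cw; apply: (measurability _ (RGenOpens.measurableE R)).
move=> _ [_ [a [b ->] <-]]; rewrite setTI.
apply: open_box_measurable => x wx; apply/nbhs_box.
apply: (cw x); apply: open_nbhs_nbhs; split => //; exact: interval_open.
Qed.

(** The mean value theorem is applied along the vertical and the horizontal side of a path from [x]
    to [y]. The intermediate points stay close to [x], so continuity of the partial derivatives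
    turns this into the first-order expansion [C1_approx]. *)
Lemma C1_mean w x y : C1 w -> exists z1 z2,
  [/\ `|z1.1 - x.1| <= `|y.1 - x.1|, `|z1.2 - x.2| <= `|y.2 - x.2|,
      `|z2.1 - x.1| <= `|y.1 - x.1|, `|z2.2 - x.2| <= `|y.2 - x.2| &
      w y - w x = partial false w z1 * (y.1 - x.1) + partial true w z2 * (y.2 - x.2)].
Proof.
move=> cw.
have MVTs (f df : R -> R) (a b : R) : (forall t : R, is_derive t 1 f (df t)) ->
    exists2 c, `|c - a| <= `|b - a| & f b - f a = df c * (b - a).
  move=> fdf.
  have cf : continuous f.
    by move=> t; apply: differentiable_continuous; apply/derivable1_diffP; case: (fdf t).
  have [ab|/ltW ba] := leP a b.
    have [] := @MVT_segment _ f df a b ab (fun t _ => fdf t).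
      exact: continuous_subspaceT.
    move=> c; rewrite in_itv/= => /andP[ac cb] ->; exists c => //.
    by rewrite !ger0_norm ?subr_ge0// lerB.
  have [] := @MVT_segment _ f df b a ba (fun t _ => fdf t).
    exact: continuous_subspaceT.
  move=> c; rewrite in_itv/= => /andP[ac cb] E; exists c => //.
    by rewrite !ler0_norm ?subr_le0// lerN2 lerB.
  by rewrite -opprB E -mulrN opprB.
have [c1 h1 E1] := MVTs (fun t => w (t, y.2)) (fun t => partial false w (t, y.2)) x.1 y.1
  (fun t => C1_deriveF (t, y.2) cw).
have [c2 h2 E2] := MVTs (fun t => w (x.1, t)) (fun t => partial true w (x.1, t)) x.2 y.2
  (fun t => C1_deriveT (x.1, t) cw).
exists (c1, y.2), (x.1, c2); split => //=; rewrite ?subrr ?normr0//.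
by rewrite -E1 -E2 -!surjective_pairing addrA subrK.
Qed.

Lemma C1_approx w x e : C1 w -> 0 < e -> \forall y \near x,
  `|w y - w x - dot2 (grad w x) (y - x)| <= e * (`|y.1 - x.1| + `|y.2 - x.2|).
Proof.
move=> cw e0; have c i : {for x, continuous (partial i w)} by have [_ h] := cw i; exact: h.
have h i : \forall y \near x, `|partial i w x - partial i w y| <= e.
  by have /cvgrPdist_le/(_ _ e0) := c i.
have /nbhs_box[d d0 hd] : nbhs x [set y | `|partial false w x - partial false w y| <= e
    /\ `|partial true w x - partial true w y| <= e] by apply: filterI; exact: h.
apply/nbhs_box; exists d => // y y1 y2.
have [z1 [z2 [h1 h2 h3 h4 ->]]] := C1_mean x y cw.
have [/= p1 _] := hd z1 (le_lt_trans h1 y1) (le_lt_trans h2 y2).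
have [/= _ p2] := hd z2 (le_lt_trans h3 y1) (le_lt_trans h4 y2).
rewrite /dot2 /=.
rewrite [X in `|X|](_ : _ = - ((partial false w x - partial false w z1) * (y.1 - x.1) +
  (partial true w x - partial true w z2) * (y.2 - x.2))); last by ring.
rewrite normrN (le_trans (ler_normD _ _))// !normrM mulrDr.
by rewrite lerD// ler_wpM2r.
Qed.

Lemma C1_continuous w : C1 w -> continuous w.
Proof.
move=> cw x; apply/cvgrPdist_le => e e0.
have /nbhs_box[d d0 hd] := C1_approx x cw ltr01.
set p := partial false w x; set q := partial true w x.
have K0 : 0 < 1 + (`|p| + `|q|) by rewrite ltr_wpDr.
have eK : 0 < e / (1 + (`|p| + `|q|)) / 2 by rewrite !divr_gt0.
apply/nbhs_box; exists (Num.min d (e / (1 + (`|p| + `|q|)) / 2)).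
  by rewrite lt_min d0.
move=> y; rewrite !lt_min => /andP[y1 /ltW k1] /andP[y2 /ltW k2].
have := hd y y1 y2; rewrite /= mul1r => h.
rewrite distrC -[X in `|X|](subrK (dot2 (grad w x) (y - x))) (le_trans (ler_normD _ _))//.
set S := `|y.1 - x.1| + `|y.2 - x.2| in h.
have S0 : 0 <= S by rewrite addr_ge0.
have h2 : `|dot2 (grad w x) (y - x)| <= (`|p| + `|q|) * S.
  rewrite /dot2 /= (le_trans (ler_normD _ _))// !normrM mulrDl lerD// ler_wpM2l//.
    by rewrite /S lerDl.
  by rewrite /S lerDr.
rewrite (@le_trans _ _ ((1 + (`|p| + `|q|)) * S))//.
  by rewrite mulrDl mul1r lerD.
rewrite -ler_pdivlMl// mulrC.
by rewrite /S [leRHS]splitr lerD.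
Qed.

(** Directions other than the axes are needed for the pull-back by [tri_map], which differentiates
    along B - A and C - A. *)
Lemma is_derive_C1 w x d : C1 w -> is_derive x d w (dot2 (grad w x) d).
Proof.
move=> cw.
suff h : (fun h : R => h^-1 *: ((w \o shift x) (h *: d) - w x)) @ 0^' -->
    (dot2 (grad w x) d : R).
  by apply: DeriveDef; [apply/cvg_ex; eexists; exact: h|exact: cvg_lim h].
apply/cvgrPdist_le => e e0.
have K0 : 0 < `|d.1| + `|d.2| + 1 by rewrite ltr_wpDl// addr_ge0.
have eK : 0 < e / (`|d.1| + `|d.2| + 1) by rewrite divr_gt0.
have /nbhs_box[r r0 hr] := C1_approx x cw eK.
near=> h; have h0 : h != 0 by near: h; exact: nbhs_dnbhs_neq.
have hsmall : `|h| <= r / 2 / (`|d.1| + `|d.2| + 1).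
  by near: h; apply: dnbhs0_le; rewrite !divr_gt0.
have hd t : `|t| <= `|d.1| + `|d.2| -> `|h * t| < r.
  move=> tK; rewrite normrM (@le_lt_trans _ _ (`|h| * (`|d.1| + `|d.2| + 1)))//.
    by rewrite ler_wpM2l// (le_trans tK)// lerDl.
  by move: hsmall; rewrite ler_pdivlMr//; lra.
have H := hr (h *: d + x).
rewrite /= !addrK in H.
have {}H := H (hd _ _) (hd _ _).
rewrite lerDl lerDr in H; have {}H := H (normr_ge0 _) (normr_ge0 _).
rewrite -(@ler_pM2l _ `|h|) ?normr_gt0// -normrM.
rewrite /= [h^-1 *: _]/(h^-1 * _) mulrBr mulrA divff// mul1r -normrN opprB.
have E : dot2 (grad w x) (h *: d) = h * dot2 (grad w x) d.
  by rewrite /dot2 /= /GRing.scale /=; ring.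
rewrite -E (le_trans H)//.
rewrite /GRing.scale /= !normrM -mulrDr mulrCA ler_wpM2l// -mulrA.
by rewrite ler_piMr ?(ltW e0)// ler_pdivrMl// mulr1 lerDl.
Unshelve. all: by end_near. Qed.

End plane_topology.

Section continuous_arithmetic.
Context {R : realType} (X : topologicalType).
Implicit Types f g : X -> R.

Lemma continuous_addR f g : continuous f -> continuous g -> continuous (fun x => f x + g x).
Proof. by move=> cf cg x; apply: cvgD; [exact: cf|exact: cg]. Qed.

Lemma continuous_subR f g : continuous f -> continuous g -> continuous (fun x => f x - g x).
Proof. by move=> cf cg x; apply: cvgB; [exact: cf|exact: cg]. Qed.

Lemma continuous_mulR f g : continuous f -> continuous g -> continuous (fun x => f x * g x).
Proof. by move=> cf cg x; apply: cvgM; [exact: cf|exact: cg]. Qed.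

Lemma continuous_cstR (a : R) : continuous (fun _ : X => a).
Proof. by move=> x; exact: cvg_cst. Qed.

End continuous_arithmetic.

Lemma continuous_idR {R : realType} : continuous (fun x : R => x).
Proof. by move=> x; exact: cvg_id. Qed.

Lemma continuous_fstR {R : realType} : continuous (fun x : R * R => x.1).
Proof. by move=> x; exact: cvg_fst. Qed.

Lemma continuous_sndR {R : realType} : continuous (fun x : R * R => x.2).
Proof. by move=> x; exact: cvg_snd. Qed.

Lemma continuous_oppR {R : realType} (X : topologicalType) (f : X -> R) :
  continuous f -> continuous (fun x => - f x).
Proof. by move=> cf x; apply: cvgN; exact: cf. Qed.

(* Syntax-directed, since unifying a product with a sum would unfold the ring
   structure of R. *)
Ltac cont := repeat lazymatch goal with
| |- continuous (fun x : _ => @?f x + - @?g x) => apply: (@continuous_subR _ _ f g)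
| |- continuous (fun x : _ => @?f x + @?g x) => apply: (@continuous_addR _ _ f g)
| |- continuous (fun x : _ => @?f x * @?g x) => apply: (@continuous_mulR _ _ f g)
| |- continuous (fun x : _ => @?f x ^+ 2) => apply: (@continuous_mulR _ _ f f)
| |- continuous (fun x : _ => - @?f x) => apply: (@continuous_oppR _ _ f)
| |- continuous (fun x : _ => x) => exact: continuous_idR
| |- continuous (fun x : _ => x.1) => exact: continuous_fstR
| |- continuous (fun x : _ => x.2) => exact: continuous_sndR
| |- continuous (fun _ : _ => ?c) => exact: continuous_cstR
| |- _ => assumption
end.

Lemma continuous_pair_comp {R : realType} (X : topologicalType) (g h : X -> R)
  (f : R * R -> R) : continuous g -> continuous h -> continuous f ->
  continuous (fun x => f (g x, h x)).
Proof.
move=> cg ch cf x.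
apply: (@cvg_comp _ _ _ (fun x => (g x, h x)) f _ (nbhs (g x, h x))).
  exact: cvg_pair (cg x) (ch x).
exact: cf.
Qed.

Lemma continuous_sectionl {R : realType} (f : R * R -> R) (s : R) :
  continuous f -> continuous (fun t => f (s, t)).
Proof.
apply: (@continuous_pair_comp R R (fun=> s) id); last by move=> x; exact: cvg_id.
by move=> x; exact: cvg_cst.
Qed.

Lemma continuous_sectionr {R : realType} (f : R * R -> R) (s : R) :
  continuous f -> continuous (fun t => f (t, s)).
Proof.
apply: (@continuous_pair_comp R R id (fun=> s)); first by move=> x; exact: cvg_id.
by move=> x; exact: cvg_cst.
Qed.

Lemma continuous_swap {R : realType} (f : R * R -> R) :
  continuous f -> continuous (fun x : R * R => f (x.2, x.1)).
Proof.
by apply: (@continuous_pair_comp R _ snd fst) => x; [exact: cvg_snd|exact: cvg_fst].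
Qed.

(** * The divergence theorem on a triangle *)

Section calculus1.
Context {R : realType}.
Local Notation mu := (@lebesgue_measure R).
Implicit Types (f : R -> R).

Lemma continuous_itv_integrable f (a b : R) : continuous f ->
  mu.-integrable `[a, b] (EFin \o f).
Proof.
move=> cf; apply: continuous_compact_integrable; first exact: segment_compact.
exact: continuous_subspaceT.
Qed.

Lemma Rintegral_FTC f f' (a b : R) : a <= b ->
  (forall t : R, is_derive t 1 f (f' t)) -> continuous f' ->
  \int[mu]_(t in `[a, b]) f' t = f b - f a.
Proof.
move=> ab df cf'; have cf : continuous f.
  by move=> t; apply: differentiable_continuous; apply/derivable1_diffP; case: (df t).
move: ab; rewrite le_eqVlt => /orP[/eqP <-|ab].
  by rewrite set_itv1 Rintegral_set1 subrr.
rewrite /Rintegral (@continuous_FTC2 _ f' f a b ab) -?EFinB//.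
- exact: continuous_subspaceT.
- split.
  + by move=> t _; case: (df t).
  + exact/cvg_at_right_filter/cf.
  + exact/cvg_at_left_filter/cf.
- by move=> t _; rewrite derive1E; case: (df t).
Qed.

Lemma Rintegral_onem f : continuous f ->
  \int[mu]_(s in `[0, 1]) f (1 - s) = \int[mu]_(s in `[0, 1]) f s.
Proof.
move=> cf.
rewrite [RHS](@Rintegration_by_substitution_onem R f 1) ?ler01 ?lexx//.
  by rewrite /unstable.onem subrr.
exact: continuous_subspaceT.
Qed.

End calculus1.

Section plane_integrals.
Context {R : realType}.
Local Notation mu := (@lebesgue_measure R).
Local Notation T := (measurableTypeR R).
Implicit Types (f : R * R -> R).

Lemma continuous_bounded_box f (N : R) : continuous f ->
  exists2 M, 0 <= M & forall x : R * R, `|x.1| <= N -> `|x.2| <= N -> `|f x| <= M.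
Proof.
move=> cf; have cK : compact (`[- N, N] `*` `[- N, N] : set (R * R)).
  by apply: compact_setX; exact: segment_compact.
have := @compact_bounded _ R^o (f @` (`[- N, N] `*` `[- N, N])).
case.
  apply: continuous_compact => //; exact: continuous_subspaceT.
move=> M [_ hM]; exists (`|M| + 1); first by rewrite addr_ge0.
move=> x x1 x2; apply: (hM (`|M| + 1)).
  by rewrite (le_lt_trans (ler_norm M))// ltrDl.
by exists x => //; split; rewrite /= in_itv/= -ler_norml.
Qed.

Lemma area_measure_box (N : R) :
  ((@area_measure R) (`[(- N)%R, N] `*` `[(- N)%R, N]) < +oo)%E.
Proof.
have mI : measurable (`[- N, N] : set T) by [].
have -> : (area_measure (`[(- N)%R, N] `*` `[(- N)%R, N]) =
    mu `[(- N)%R, N] * mu `[(- N)%R, N])%E.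
  exact: (product_measure1E mu mu mI mI).
rewrite lebesgue_measure_itv/=.
by case: ifPn => _; rewrite ?mul0e ?mule0// -EFinB -EFinM ltry.
Qed.

Lemma area_measure_bounded (D : set (T * T)) (N : R) : measurable D ->
  (forall x : T * T, D x -> `|x.1| <= N /\ `|x.2| <= N) -> ((@area_measure R) D < +oo)%E.
Proof.
move=> mD DN; apply: le_lt_trans (area_measure_box N).
apply: le_measure; rewrite ?inE//; first exact: measurableX.
by move=> x /DN [? ?]; split; rewrite /= in_itv/= -ler_norml.
Qed.

Lemma continuous_bounded_sqint f (D : set (T * T)) (N : R) : measurable D ->
  (forall x : T * T, D x -> `|x.1| <= N /\ `|x.2| <= N) -> continuous f ->
  sqint (@area_measure R) D f.
Proof.
move=> mD DN cf; have [M M0 hM] := continuous_bounded_box N cf.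
apply: (@bounded_sqint _ _ _ _ _ mD (area_measure_bounded mD DN) _ M).
  by apply: measurable_funTS; exact: continuous_measurable2.
by move=> x /DN [? ?]; exact: hM.
Qed.

Definition ref_triangle : set (T * T) :=
  [set x | [/\ 0 < x.1, 0 < x.2 & x.1 + x.2 < 1]].

Lemma ref_triangle_measurable : measurable ref_triangle.
Proof.
have -> : ref_triangle = (fst @^-1` `]0, +oo[ `&` snd @^-1` `]0, +oo[) `&`
   (fun x : T * T => 0 + 1 * x.1 + 1 * x.2 : T) @^-1` `]-oo, 1[.
  apply/seteqP; split=> x; rewrite /ref_triangle /= !in_itv/= !andbT add0r !mul1r.
    by case.
  by case=> -[].
apply: measurableI; [apply: measurableI|].
- by rewrite -[X in measurable X]setTI; exact: measurable_fst.
- by rewrite -[X in measurable X]setTI; exact: measurable_snd.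
- by rewrite -[X in measurable X]setTI; exact: measurable_affine2.
Qed.

Lemma ref_triangle_bounded (x : T * T) : ref_triangle x -> `|x.1| <= 1 /\ `|x.2| <= 1.
Proof. by move=> [x1 x2 x12]; rewrite !gtr0_norm//; split; lra. Qed.

Lemma continuous_ref_triangle_integrable f : continuous f ->
  (@area_measure R).-integrable ref_triangle (EFin \o f).
Proof.
move=> cf; apply: sqint_integrable1 ref_triangle_measurable _ _ _.
  exact: area_measure_bounded ref_triangle_measurable ref_triangle_bounded.
exact: continuous_bounded_sqint ref_triangle_measurable ref_triangle_bounded cf.
Qed.

Let fubini_section f (s : R) : continuous f ->
  (\int[mu]_t ((EFin \o f) \_ ref_triangle) (s, t))%E =
  ((fun s => (\int[mu]_(t in `[0%R, (1 - s)%R]) f (s, t))%:E) \_ `]0, 1[) s.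
Proof.
move=> cf; rewrite patchE; case: ifPn => [|s01].
  rewrite inE/= in_itv/= => /andP[s0 s1].
  have cfs : continuous (fun t => f (s, t)).
    exact: continuous_sectionl.
  rewrite fineK; last exact: integrable_fin_num (continuous_itv_integrable _ _ cfs).
  have mfs : measurable_fun `]0, (1 - s)[ (EFin \o (fun t => f (s, t))).
    by apply/measurable_EFinP; apply: measurable_funTS; exact: continuous_measurable_fun.
  rewrite [RHS]integral_itv_bndoo//.
  rewrite [RHS]integral_mkcond; apply: eq_integral => t _.
  rewrite !patchE /=; congr (if _ then _ else _); apply/asboolP/asboolP.
  - by move=> [_ /= t0 st]; rewrite in_itv/= t0 ltrBrDl.
  - by rewrite /= in_itv/= => /andP[t0]; rewrite ltrBrDl.
rewrite integral0_eq// => t _; rewrite patchE ifF//; apply/negbTE.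
move: s01; rewrite !notin_setE => h [/= s0 t0 st]; apply: h.
by rewrite /= in_itv/= s0 /=; lra.
Qed.

Lemma Rintegral_ref_triangle f : continuous f ->
  \int[area_measure]_(x in ref_triangle) f x =
  \int[mu]_(s in `]0, 1[) (\int[mu]_(t in `[0, 1 - s]) f (s, t)).
Proof.
move=> cf; rewrite /Rintegral integral_mkcond.
have iF : (@area_measure R).-integrable setT ((EFin \o f) \_ ref_triangle).
  apply/integrable_restrict => //; first exact: ref_triangle_measurable.
  by rewrite setTI; exact: continuous_ref_triangle_integrable.
rewrite /area_measure -(integral12_prod_meas1 iF) /fubini_F; congr fine.
rewrite [RHS]integral_mkcond; apply: eq_integral => s _.
exact: fubini_section.
Qed.

(** The reference triangle is symmetric in its two coordinates; this lets the divergence identity be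
    proved for one component of the field only. *)
Lemma Rintegral_ref_triangle_swap f : continuous f ->
  \int[area_measure]_(x in ref_triangle) f (x.2, x.1) =
  \int[area_measure]_(x in ref_triangle) f x.
Proof.
move=> cf; pose g (x : R * R) := f (x.2, x.1).
have cg : continuous g.
  exact: continuous_swap.
rewrite [LHS]Rintegral_mkcond [in RHS]Rintegral_mkcond.
have E : (fun x => (f \_ ref_triangle) (0 + 0 * x.1 + 1 * x.2, 0 + 1 * x.1 + 0 * x.2)) =
    (g \_ ref_triangle).
  apply/funext => x; rewrite !mul0r !mul1r !add0r !addr0 !patchE /g.
  by congr (if _ then _ else _); apply/asboolP/asboolP => -[/= ? ? ?]; split; rewrite //= addrC.
have [|||_ ->] := @Rintegral_affine2 R 0 0 1 0 1 0 (f \_ ref_triangle).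
- by rewrite mul0r sub0r mulr1 oppr_eq0 oner_eq0.
- apply/(measurable_restrict _ ref_triangle_measurable measurableT).
  by rewrite setTI; apply: measurable_funTS; exact: continuous_measurable2.
- rewrite E -restrict_EFin; apply/integrable_restrict => //.
    exact: ref_triangle_measurable.
  by rewrite setTI; exact: continuous_ref_triangle_integrable.
by rewrite E mul0r sub0r mulr1 normrN normr1 mul1r.
Qed.

End plane_integrals.

Section ref_triangle_divergence.
Context {R : realType}.
Local Notation mu := (@lebesgue_measure R).
Variables (w g1 g2 : R * R -> R) (b c : R).
Hypothesis cw : continuous w.
Hypothesis cg1 : continuous g1.
Hypothesis cg2 : continuous g2.
Hypothesis dw1 : forall x : R * R, is_derive x.1 1 (fun t => w (t, x.2)) (g1 x).
Hypothesis dw2 : forall x : R * R, is_derive x.2 1 (fun t => w (x.1, t)) (g2 x).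

(** One component of the divergence theorem. The integrand is the derivative in [t] of
    [(t - a) * v (s, t)]; its values at t = 1 - s and t = 0 yield the integrals over the hypotenuse
    and over a leg. *)
Let div_half (v h : R * R -> R) (a : R) : continuous v -> continuous h ->
  (forall s t : R, is_derive t 1 (fun t => v (s, t)) (h (s, t))) ->
  \int[area_measure]_(x in ref_triangle) ((x.2 - a) * h x + v x) =
  \int[mu]_(s in `[0, 1]) ((1 - s - a) * v (s, 1 - s)) + a * \int[mu]_(s in `[0, 1]) v (s, 0).
Proof.
move=> cv ch dv.
have cF : continuous (fun x : R * R => (x.2 - a) * h x + v x).
  move=> x; apply: cvgD (cv x); apply: cvgM (ch x).
  by apply: cvgB; [exact: cvg_snd|exact: cvg_cst].
rewrite Rintegral_ref_triangle//.
have cv1 : continuous (fun s : R => (1 - s - a) * v (s, 1 - s)).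
  move=> s; apply: cvgM.
    by apply: cvgB; [apply: cvgB; [exact: cvg_cst|exact: cvg_id]|exact: cvg_cst].
  apply: (@continuous_pair_comp R R id (fun t : R => 1 - t)) => // t; first exact: cvg_id.
  by apply: cvgB; [exact: cvg_cst|exact: cvg_id].
have cv2 : continuous (fun s : R => v (s, 0)).
  exact: continuous_sectionr.
rewrite -RintegralZl//; last exact: continuous_itv_integrable.
rewrite -RintegralD//; last 2 first.
- exact: continuous_itv_integrable.
- by apply: continuous_itv_integrable => t; apply: cvgM (cv2 t); exact: cvg_cst.
have cs s : continuous (fun t : R => (t - a) * h (s, t) + v (s, t)).
  exact: continuous_sectionl cF.
have ck : continuous (fun s : R => (1 - s - a) * v (s, 1 - s) + a * v (s, 0)).
  by move=> t; apply: cvgD (cv1 t) _; apply: cvgM (cv2 t); exact: cvg_cst.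
have mk : measurable_fun (`]0, 1[ : set R)
    (EFin \o (fun s : R => (1 - s - a) * v (s, 1 - s) + a * v (s, 0))).
  by apply/measurable_EFinP; apply: measurable_funTS; exact: continuous_measurable_fun.
rewrite [RHS]/Rintegral integral_itv_bndoo//.
congr fine; apply: eq_integral => s; rewrite inE/= in_itv/= => /andP[s0 s1].
have dF (t : R) : is_derive t 1 (fun t : R => (t - a) * v (s, t))
    ((t - a) * h (s, t) + v (s, t)).
  have dt : is_derive t 1 (fun t : R => t - a) 1.
    by have := is_deriveB (is_derive_id t (1 : R)) (is_derive_cst a t (1 : R)); rewrite subr0.
  by apply: (is_derive_eq (is_deriveM dt (dv s t))); rewrite [_ *: 1]mulr1.
have s1' : 0 <= 1 - s by rewrite subr_ge0 ltW.
by congr (_%:E); rewrite (Rintegral_FTC s1' dF (cs s)) sub0r mulNr opprK.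
Qed.

(** This is the divergence theorem for the field (x - (b, c)) w. The scalar product of x - (b, c)
    with the normal is constant on each side, and the resulting weights are the barycentric
    coordinates of (b, c). *)
Lemma ref_triangle_divergence :
  \int[area_measure]_(x in ref_triangle)
    ((x.1 - b) * g1 x + (x.2 - c) * g2 x + 2 * w x) =
  (1 - b - c) * \int[mu]_(s in `[0, 1]) w (1 - s, s)
  + b * \int[mu]_(s in `[0, 1]) w (0, 1 - s)
  + c * \int[mu]_(s in `[0, 1]) w (s, 0).
Proof.
have csw := @continuous_swap R.
have csw_w := csw w cw; have csw_g := csw g1 cg1.
have cF : continuous (fun x : R * R => (x.2 - b) * g1 (x.2, x.1) + w (x.2, x.1)).
  by cont.
have cG : continuous (fun x : R * R => (x.2 - c) * g2 x + w x).
  by cont.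
have h2 := div_half c cw cg2 (fun s t => dw2 (s, t)).
have h1 := div_half b (csw _ cw) (csw _ cg1) (fun s t => dw1 (t, s)).
transitivity (\int[area_measure]_(x in ref_triangle)
   ((x.2 - b) * g1 (x.2, x.1) + w (x.2, x.1)) +
   \int[area_measure]_(x in ref_triangle) ((x.2 - c) * g2 x + w x)).
  rewrite -(Rintegral_ref_triangle_swap cF) -RintegralD//=.
  - apply: eq_Rintegral => -[x y] _ /=; ring.
  - exact: ref_triangle_measurable.
  - exact: continuous_ref_triangle_integrable (csw _ cF).
  - exact: continuous_ref_triangle_integrable.
rewrite h1 h2 /= [X in _ = _ + X + _](_ : _ = b * \int[mu]_(s in `[0, 1]) w (0, s)); last first.
  congr (_ * _); exact: (@Rintegral_onem R (fun s => w (0, s)) (continuous_sectionl cw)).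
have c1m : continuous (fun s : R => 1 - s).
  by move=> s; apply: cvgB; [exact: cvg_cst|exact: cvg_id].
have cid : continuous (fun s : R => s) by move=> s; exact: cvg_id.
have cwh : continuous (fun s : R => w (1 - s, s)).
  exact: (@continuous_pair_comp R R (fun s : R => 1 - s) id).
have cwh' : continuous (fun s : R => w (s, 1 - s)).
  exact: (@continuous_pair_comp R R id (fun s : R => 1 - s)).
have ck : continuous (fun s : R => (1 - s - c) * w (s, 1 - s)).
  by move=> s; apply: cvgM (cwh' s); apply: cvgB (c1m s) _; exact: cvg_cst.
have ck' : continuous (fun s : R => (1 - s - b) * w (1 - s, s)).
  by move=> s; apply: cvgM (cwh s); apply: cvgB (c1m s) _; exact: cvg_cst.
have ck'' : continuous (fun s : R => (s - c) * w (1 - s, s)).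
  by move=> s; apply: cvgM (cwh s); apply: cvgB (cid s) _; exact: cvg_cst.
rewrite -(Rintegral_onem ck).
(* On the hypotenuse one half contributes the weight 1 - s - b and the other s - c; their sum does
   not depend on [s]. *)
rewrite (_ : (1 - b - c) * _ = \int[mu]_(s in `[0, 1]) ((1 - s - b) * w (1 - s, s)) +
    \int[mu]_(s in `[0, 1]) ((s - c) * w (1 - s, s))); last first.
  rewrite -RintegralZl//; last exact: continuous_itv_integrable.
  rewrite -RintegralD//; [|exact: continuous_itv_integrable..].
  by apply: eq_Rintegral => s _; ring.
rewrite (@eq_Rintegral _ _ _ mu `[0, 1] (fun s => (s - c) * w (1 - s, s)) (fun s => (1 - (1 - s) - c) * w (1 - s, 1 - (1 - s)))).
  by ring.
by move=> s _; rewrite subKr.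
Qed.

End ref_triangle_divergence.

Lemma sum3_EFin {R : realType} (I : Type) (F : I -> \bar R) (x y z : I) (a b c : R) :
  F x = a%:E -> F y = b%:E -> F z = c%:E ->
  (\sum_(i <- [:: x; y; z]) F i = (a + b + c)%:E)%E.
Proof.
by move=> Fx Fy Fz; rewrite !big_cons big_nil Fx Fy Fz adde0 -!EFinD addrA.
Qed.

Section edge.
Context {R : realType}.
Local Notation mu := (@lebesgue_measure R).
Implicit Types (P Q : R * R) (f : R * R -> R).

Lemma edgeE (P Q : R * R) s : edge P Q s = ((1 - s) * P.1 + s * Q.1, (1 - s) * P.2 + s * Q.2).
Proof. by []. Qed.

Lemma derive1_edge P Q s : derive1 (edge P Q) s = Q - P.
Proof.
rewrite /derive1; apply: cvg_lim; first exact: norm_hausdorff.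
apply: cvg_near_cst; near=> h; have h0 : h != 0 by near: h; exact: nbhs_dnbhs_neq.
rewrite !edgeE; apply/pair_equal_spec; split; rewrite /= /GRing.scale /=; by field.
Unshelve. all: by end_near. Qed.

Lemma edge_continuous P Q f : continuous f -> continuous (fun s => f (edge P Q s)).
Proof.
have h (a b : R) : continuous (fun s : R => (1 - s) * a + s * b) by cont.
exact: (@continuous_pair_comp R R _ _ f (h P.1 Q.1) (h P.2 Q.2)).
Qed.

Lemma edge_integral P Q f :
  mu.-integrable `[0, 1] (EFin \o (fun s => f (edge P Q s))) ->
  (\int[mu]_(s in `[0%R, 1%R]) (f (edge P Q s) * enorm (derive1 (edge P Q) s))%:E =
  (enorm (Q - P) * \int[mu]_(s in `[0%R, 1%R]) f (edge P Q s))%:E)%E.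
Proof.
move=> fi; under eq_integral do rewrite derive1_edge mulrC EFinM.
rewrite integralZl// EFinM /Rintegral fineK//.
exact: integrable_fin_num.
Qed.

End edge.

Section triangle.
Context {R : realType}.
Local Notation mu := (@lebesgue_measure R).
Local Notation T := (measurableTypeR R).
Variables A B C : R * R.

Definition tri_det := (B.1 - A.1) * (C.2 - A.2) - (C.1 - A.1) * (B.2 - A.2).

Definition tri_map (x : R * R) : R * R :=
  (A.1 + (B.1 - A.1) * x.1 + (C.1 - A.1) * x.2,
   A.2 + (B.2 - A.2) * x.1 + (C.2 - A.2) * x.2).

Hypothesis d0 : tri_det != 0.

Definition tri_coord (x : R * R) : R * R :=
  (((C.2 - A.2) * (x.1 - A.1) - (C.1 - A.1) * (x.2 - A.2)) / tri_det,
   ((B.1 - A.1) * (x.2 - A.2) - (B.2 - A.2) * (x.1 - A.1)) / tri_det).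

Lemma tri_mapK : cancel tri_map tri_coord.
Proof.
move=> [x y]; rewrite /tri_coord /tri_map /=; apply/pair_equal_spec; split;
  by move: d0; rewrite /tri_det => ?; field.
Qed.

Lemma tri_coordK : cancel tri_coord tri_map.
Proof.
move=> [x y]; rewrite /tri_coord /tri_map /=; apply/pair_equal_spec; split;
  by move: d0; rewrite /tri_det => ?; field.
Qed.

Lemma open_triangleE : open_triangle A B C = tri_coord @^-1` ref_triangle.
Proof.
apply/seteqP; split=> x.
  move=> [a [b [c [a0 b0 c0 abc ->]]]].
  rewrite (_ : a *: A + _ + _ = tri_map (b, c)) /= ?tri_mapK.
    by split => //=; lra.
  have -> : a = 1 - b - c by lra.
  by apply/pair_equal_spec; split; rewrite /= /GRing.scale /=; ring.
move=> [x1 x2 x12]; exists (1 - (tri_coord x).1 - (tri_coord x).2), (tri_coord x).1, (tri_coord x).2.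
split => //; [lra|lra|].
rewrite -[LHS]tri_coordK; apply/pair_equal_spec; split;
  by rewrite /= /GRing.scale /=; ring.
Qed.

Lemma open_triangle_map x : open_triangle A B C (tri_map x) <-> ref_triangle x.
Proof. by rewrite open_triangleE /= tri_mapK. Qed.

Lemma open_triangle_measurable : measurable (open_triangle A B C : set (T * T)).
Proof.
rewrite open_triangleE -[X in measurable X]setTI.
suff m : measurable_fun setT (tri_coord : T * T -> T * T).
  by apply: m => //; exact: ref_triangle_measurable.
have := @measurable_affine_pair R
  (((C.1 - A.1) * A.2 - (C.2 - A.2) * A.1) / tri_det) ((C.2 - A.2) / tri_det) (- (C.1 - A.1) / tri_det)
  (((B.2 - A.2) * A.1 - (B.1 - A.1) * A.2) / tri_det) (- (B.2 - A.2) / tri_det) ((B.1 - A.1) / tri_det).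
apply: eq_measurable_fun => x _; rewrite /tri_coord; apply/pair_equal_spec; split; by ring.
Qed.

Lemma open_triangle_bounded : exists N, forall x : T * T, open_triangle A B C x ->
  `|x.1| <= N /\ `|x.2| <= N.
Proof.
exists (`|A.1| + `|A.2| + (`|B.1| + `|B.2|) + (`|C.1| + `|C.2|)).
have h a b c x y z : 0 < a -> 0 < b -> 0 < c -> a + b + c = 1 ->
   `|a * x + b * y + c * z| <= `|x| + `|y| + `|z| :> R.
  move=> a0 b0 c0 abc; rewrite (le_trans (ler_normD _ _))//.
  rewrite lerD// ?(le_trans (ler_normD _ _))// ?lerD// normrM gtr0_norm//;
    by rewrite ler_piMl//; lra.
have n (x : R) := normr_ge0 x.
have := n A.1; have := n A.2; have := n B.1; have := n B.2; have := n C.1; have := n C.2.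
move=> ? ? ? ? ? ? x [a [b [c [a0 b0 c0 abc ->]]]]; split.
  by rewrite (le_trans (h a b c A.1 B.1 C.1 _ _ _ _))//; lra.
by rewrite (le_trans (h a b c A.2 B.2 C.2 _ _ _ _))//; lra.
Qed.

Lemma open_triangle_finite : ((@area_measure R) (open_triangle A B C) < +oo)%E.
Proof.
have [N hN] := open_triangle_bounded.
exact: area_measure_bounded open_triangle_measurable hN.
Qed.

Lemma continuous_triangle_sqint f : continuous f ->
  sqint (@area_measure R) (open_triangle A B C) f.
Proof.
have [N hN] := open_triangle_bounded.
exact: continuous_bounded_sqint open_triangle_measurable hN.
Qed.

Lemma continuous_triangle_integrable f : continuous f ->
  (@area_measure R).-integrable (open_triangle A B C) (EFin \o f).
Proof.
move=> cf; apply: (sqint_integrable1 open_triangle_measurable).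
  exact: open_triangle_finite.
exact: continuous_triangle_sqint.
Qed.

Lemma tri_map_continuous : continuous tri_map.
Proof.
have h (a p q : R) : continuous (fun x : R * R => a + p * x.1 + q * x.2) by cont.
by move=> x; exact: (cvg_pair (h _ _ _ x) (h _ _ _ x)).
Qed.

Lemma Rintegral_triangle f : continuous f ->
  \int[area_measure]_(x in open_triangle A B C) f x =
  `|tri_det| * \int[area_measure]_(x in ref_triangle) f (tri_map x).
Proof.
move=> cf; rewrite [LHS]Rintegral_mkcond [in RHS]Rintegral_mkcond.
have cfm : continuous (f \o tri_map).
  by move=> x; apply: continuous_comp; [exact: tri_map_continuous|exact: cf].
have E : (fun x => (f \_ (open_triangle A B C)) (tri_map x)) = ((f \o tri_map) \_ ref_triangle).
  apply/funext => x; rewrite !patchE.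
  by congr (if _ then _ else _); apply/asboolP/asboolP => /open_triangle_map.
have [||_ ->] := @Rintegral_affine2 R A.1 (B.1 - A.1) (C.1 - A.1) A.2 (B.2 - A.2) (C.2 - A.2)
  (f \_ (open_triangle A B C)) d0.
- apply/(measurable_restrict _ open_triangle_measurable measurableT).
  by rewrite setTI; apply: measurable_funTS; exact: continuous_measurable2.
- rewrite [X in EFin \o X]E -restrict_EFin; apply/integrable_restrict => //.
    exact: ref_triangle_measurable.
  by rewrite setTI; exact: continuous_ref_triangle_integrable.
by rewrite [X in Rintegral _ _ X]E.
Qed.

(** Pulling back to the reference triangle turns x - tri_map (b, c) into a combination of B - A and
    C - A with coefficients x.1 - b and x.2 - c. The sides are thus weighted by the barycentric
    coordinates of the opposite vertices, and no normal vector or orientation enters. *)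
Lemma triangle_divergence (w : R * R -> R) (b c : R) : C1 w ->
  \int[area_measure]_(x in open_triangle A B C)
     (dot2 (x - tri_map (b, c)) (grad w x) + 2 * w x) =
  `|tri_det| * ((1 - b - c) * \int[mu]_(s in `[0, 1]) w (edge B C s)
    + b * \int[mu]_(s in `[0, 1]) w (edge C A s)
    + c * \int[mu]_(s in `[0, 1]) w (edge A B s)).
Proof.
move=> cw; have cwc := C1_continuous cw.
have cp i : continuous (partial i w) by have [] := cw i.
have cd (v : R * R -> R * R) : continuous (fun x => (v x).1) -> continuous (fun x => (v x).2) ->
   continuous (fun x => dot2 (v x) (grad w x)).
  by move=> c1 c2; rewrite /dot2; cont; exact: cp.
rewrite Rintegral_triangle; last first.
  by apply: continuous_addR; [apply: cd|]; rewrite /=; cont.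
congr (_ * _).
pose g (D : R * R) x := dot2 D (grad w (tri_map x)).
have cg D : continuous (g D).
  move=> x; apply: (@continuous_comp _ _ _ tri_map (fun y => dot2 D (grad w y))).
    exact: tri_map_continuous.
  by apply: cd; cont.
have ce : continuous (w \o tri_map).
  by move=> x; apply: continuous_comp; [exact: tri_map_continuous|exact: cwc].
have dw1 (x : R * R) : is_derive x.1 1 (fun t => (w \o tri_map) (t, x.2)) (g (B - A) x).
  apply/is_derive_lineP.
  have /is_derive_lineP := is_derive_C1 (tri_map x) (B - A) cw.
  rewrite /g /dot2 mulrC [_ * (B-A).2]mulrC; congr is_derive.
  apply/funext => h; congr w; apply/pair_equal_spec; split;
    by rewrite /= /GRing.scale /=; ring.
have dw2 (x : R * R) : is_derive x.2 1 (fun t => (w \o tri_map) (x.1, t)) (g (C - A) x).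
  apply/is_derive_lineP.
  have /is_derive_lineP := is_derive_C1 (tri_map x) (C - A) cw.
  rewrite /g /dot2 mulrC [_ * (C-A).2]mulrC; congr is_derive.
  apply/funext => h; congr w; apply/pair_equal_spec; split;
    by rewrite /= /GRing.scale /=; ring.
have := ref_triangle_divergence b c ce (cg _) (cg _) dw1 dw2.
rewrite (_ : \int[area_measure]_(x in ref_triangle) _ =
  \int[area_measure]_(x in ref_triangle)
    (dot2 (tri_map x - tri_map (b, c)) (grad w (tri_map x)) + 2 * w (tri_map x))); last first.
  by apply: eq_Rintegral => x _; rewrite /g /dot2 /=; ring.
move=> ->; congr (_ * _ + _ * _ + _ * _); apply: eq_Rintegral => s _ /=; congr w;
  by rewrite edgeE /tri_map /=; apply/pair_equal_spec; split; ring.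
Qed.

Lemma arc_integral_triangle f : continuous f ->
  arc_integral (triangle_boundary A B C) f =
  (enorm (B - A) * \int[mu]_(s in `[0%R, 1%R]) f (edge A B s) +
   enorm (C - B) * \int[mu]_(s in `[0%R, 1%R]) f (edge B C s) +
   enorm (A - C) * \int[mu]_(s in `[0%R, 1%R]) f (edge C A s))%:E.
Proof.
move=> cf; apply: sum3_EFin; apply: edge_integral.
- exact/continuous_itv_integrable/edge_continuous.
- exact/continuous_itv_integrable/edge_continuous.
- exact/continuous_itv_integrable/edge_continuous.
Qed.

End triangle.

(** * Weak gradients and traces *)

Section c1_sobolev.
Context {R : realType}.
Local Notation mu := (@lebesgue_measure R).
Local Notation T := (measurableTypeR R).
Implicit Types (w f : R * R -> R).

Lemma Rintegral_compact_support1 (h h' : R -> R) (N : R) : 0 <= N ->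
  (forall t : R, is_derive t 1 h (h' t)) -> continuous h' ->
  (forall t, N <= `|t| -> h t = 0) -> (forall t, N <= `|t| -> h' t = 0) ->
  (\int[mu]_t (h' t)%:E = 0)%E.
Proof.
move=> N0 dh ch' h0 h'0.
have -> : (\int[mu]_t (h' t)%:E = \int[mu]_(t in `[(- N)%R, N]) (h' t)%:E)%E.
  rewrite [RHS]integral_mkcond; apply: eq_integral => t _; rewrite patchE.
  case: ifPn => //; rewrite notin_setE /= in_itv/= => /negP; rewrite -ler_norml -ltNge.
  by move=> /ltW/h'0 ->.
rewrite -(fineK (integrable_fin_num _ (continuous_itv_integrable (- N) N ch')))//.
rewrite -[fine _]/(\int[mu]_(t in `[- N, N]) h' t) (Rintegral_FTC _ dh ch'); last lra.
by rewrite !h0 ?subrr// ?normrN ger0_norm.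
Qed.

Lemma Rintegral_compact_support (D : set (T * T)) (N : R) (v g : R * R -> R) (i : bool) :
  measurable D -> (forall x : T * T, D x -> `|x.1| <= N /\ `|x.2| <= N) ->
  (forall x, is_derive x (evec i) v (g x)) -> continuous g ->
  (forall x, ~ D x -> v x = 0 /\ g x = 0) ->
  \int[area_measure]_(x in D) g x = 0.
Proof.
move=> mD DN dv cg vg0; pose M := `|N| + 1.
have M0 : 0 <= M by rewrite addr_ge0.
have MN x : M <= `|x.1| \/ M <= `|x.2| -> v x = 0 /\ g x = 0.
  move=> h; apply: vg0 => /DN[x1 x2].
  by have := ler_norm N; move: h x1 x2; rewrite /M; move: (`|x.1|) (`|x.2|) (`|N|) => a b c [] ? ? ? ?; lra.
have iD : (@area_measure R).-integrable D (EFin \o g).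
  apply: (sqint_integrable1 mD (area_measure_bounded mD DN)).
  exact: continuous_bounded_sqint mD DN cg.
have gD : (EFin \o g) \_ D = EFin \o g.
  apply/funext => x; rewrite patchE; case: ifPn => //; rewrite notin_setE => /vg0[_ g0].
  by rewrite /= g0.
have iT : (@area_measure R).-integrable setT (EFin \o g).
  by rewrite -gD; apply/integrable_restrict => //; rewrite setTI.
rewrite /Rintegral integral_mkcond gD /area_measure.
case: i dv => dv.
  rewrite -(integral12_prod_meas1 iT) /fubini_F integral0_eq// => s _ /=.
  apply: (@Rintegral_compact_support1 (fun t => v (s, t)) (fun t => g (s, t)) M) => //.
  - by move=> t; exact: (is_derive_partialT v (s, t) _).1 (dv _).
  - exact: continuous_sectionl.
  - by move=> t tM; apply: (MN (s, t) _).1; right.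
  - by move=> t tM; apply: (MN (s, t) _).2; right.
rewrite -(integral21_prod_meas1 iT) /fubini_G integral0_eq// => s _ /=.
apply: (@Rintegral_compact_support1 (fun t => v (t, s)) (fun t => g (t, s)) M) => //.
- by move=> t; exact: (is_derive_partialF v (t, s) _).1 (dv _).
- exact: continuous_sectionr.
- by move=> t tM; apply: (MN (t, s) _).1; left.
- by move=> t tM; apply: (MN (t, s) _).2; left.
Qed.

Lemma test_function_C1 (D : set (R * R)) f : test_function D f -> C1 f.
Proof. by case=> /(_ [::]). Qed.

Lemma test_function_out (D : set (R * R)) f x i : test_function D f -> ~ D x ->
  f x = 0 /\ partial i f x = 0.
Proof.
move=> [_ _ sD] Dx; have nx : ~ closure [set x | f x != 0] x by move=> /sD.
have f0 : \forall y \near x, f y = 0.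
  have : nbhs x (~` closure [set x | f x != 0]).
    by apply: open_nbhs_nbhs; split => //; exact/closed_openC/closed_closure.
  apply: filterS => y ny; apply/eqP/negPn/negP => fy; apply: ny.
  exact: subset_closure.
split; first exact: nbhs_singleton f0.
rewrite /partial (near_eq_derive (g := cst 0))//; exact: derive_cst.
Qed.

Lemma C1_weak_gradient (D : set (T * T)) (N : R) w f i : measurable D ->
  (forall x : T * T, D x -> `|x.1| <= N /\ `|x.2| <= N) -> C1 w ->
  test_function D f ->
  \int[area_measure]_(x in D) (w x * partial i f x) =
  - \int[area_measure]_(x in D) (partial i w x * f x).
Proof.
move=> mD DN cw tf; have cf := test_function_C1 tf.
have [cwc cfc] := (C1_continuous cw, C1_continuous cf).
have [dw cpw] := cw i; have [df cpf] := cf i.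
have ii (h : R * R -> R) : continuous h -> (@area_measure R).-integrable D (EFin \o h).
  move=> ch; apply: (sqint_integrable1 mD (area_measure_bounded mD DN)).
  exact: continuous_bounded_sqint mD DN ch.
apply/eqP; rewrite -addr_eq0 -RintegralD//; last 2 first.
- by apply: ii; cont.
- by apply: ii; cont.
apply/eqP; apply: (@Rintegral_compact_support D N (fun x => w x * f x) _ i) => //.
- move=> x; have := is_deriveM (derivableP (dw x)) (derivableP (df x)).
  by move=> h; apply: (is_derive_eq h); congr (_ + _); rewrite [LHS]mulrC.
- by cont.
- by move=> x /(test_function_out i tf)[-> ->]; rewrite !mulr0 addr0.
Qed.

Lemma C1_H1 (D : set (T * T)) (N : R) w : measurable D ->
  (forall x : T * T, D x -> `|x.1| <= N /\ `|x.2| <= N) -> C1 w ->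
  H1 D w (grad w).
Proof.
move=> mD DN cw; split.
- exact: continuous_bounded_sqint mD DN (C1_continuous cw).
- by apply: (continuous_bounded_sqint mD DN); have [] := cw false.
- by apply: (continuous_bounded_sqint mD DN); have [] := cw true.
- move=> f i tf; rewrite (C1_weak_gradient i mD DN cw tf); congr (- _).
  by apply: eq_Rintegral => x _; case: i.
Qed.

End c1_sobolev.

Section strong_convergence.
Context d (T : measurableType d) (R : realType).
Variables (mu : {measure set T -> \bar R}) (D : set T) (mD : measurable D).

Lemma cvg_Rintegral_sqint (a_ : nat -> T -> R) (a m : T -> R) :
  sqint mu D m -> (forall n, sqint mu D (a_ n)) -> sqint mu D a ->
  \int[mu]_(x in D) ((a_ n x - a x) ^+ 2) @[n --> \oo] --> (0 : R) ->
  \int[mu]_(x in D) (a_ n x * m x) @[n --> \oo] --> \int[mu]_(x in D) (a x * m x).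
Proof.
move=> sm sa_ sa ca; apply/cvgrPdist_le => e e0.
set S := \int[mu]_(x in D) (m x ^+ 2).
have S0 : 0 <= S by apply: Rintegral_ge0 => x _; exact: sqr_ge0.
pose th := e / 2 / (S + 1).
have th0 : 0 < th by rewrite !divr_gt0// ltr_wpDl.
have c0 : 0 < th * (e / 2) by rewrite mulr_gt0// divr_gt0.
move/cvgrPdist_le : ca => /(_ _ c0); apply: filterS => n; rewrite sub0r normrN => h.
have sd : sqint mu D (fun x => a_ n x - a x) by exact: sqintB.
rewrite distrC -RintegralB//; [|exact: sqintM..].
rewrite (@eq_Rintegral _ _ _ mu D (fun x => (a_ n x - a x) * m x)); last first.
  by move=> x _; rewrite mulrBl.
rewrite (le_trans (young_Rintegral mD th0 sd sm))// -/S.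
have h1 : th^-1 * \int[mu]_(x in D) ((a_ n x - a x) ^+ 2) <= e / 2.
  by rewrite ler_pdivrMl// (le_trans (ler_norm _)).
have h2 : th * S <= e / 2.
  rewrite /th -mulrA ger_pMr ?divr_gt0// ler_pdivrMl ?ltr_wpDl// mulr1.
  by rewrite lerDl.
by move: h1 h2; lra.
Qed.

End strong_convergence.

Section triangle_trace.
Context {R : realType}.
Local Notation mu := (@lebesgue_measure R).
Local Notation T := (measurableTypeR R).
Variables A B C : R * R.
Hypothesis d0 : tri_det A B C != 0.
Local Notation Omega := (open_triangle A B C).
Local Notation Gamma := (triangle_boundary A B C).

Lemma C1_is_trace (w : R * R -> R) : C1 w -> is_trace Omega Gamma w (grad w) w.
Proof.
move=> cw; have cwc := C1_continuous cw; split; first split.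
- have h P Q : measurable_fun (`[0, 1] : set R) (w \o edge P Q).
    by apply: measurable_funTS; apply: continuous_measurable_fun; exact: edge_continuous.
  by move=> [|[|[|]]] //= _; exact: h.
- by rewrite arc_integral_triangle ?ltry//; cont.
exists (fun=> w); split => //.
- apply: (eq_cvg_to _ (cvg_cst _)) => n; rewrite integral0_eq// => x _.
  by rewrite subrr expr0n.
- apply: (eq_cvg_to _ (cvg_cst _)) => n; rewrite integral0_eq// => x _.
  by rewrite subrr /enorm /dot2 /= mulr0 addr0 sqrtr0 expr0n.
- have -> : (fun x => (w x - w x) ^+ 2) = cst 0 :> (R * R -> R).
    by apply/funext => x; rewrite subrr expr0n.
  rewrite arc_integral_triangle; last by move=> x; exact: cvg_cst.
  rewrite !Rintegral_cst//= !mul0r !mulr0 !addr0; exact: cvg_cst.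
Qed.

Lemma tri_det_enorm : [/\ 0 < enorm (B - A), 0 < enorm (C - B) & 0 < enorm (A - C)].
Proof.
have h (x : R * R) : (x.1 != 0) || (x.2 != 0) -> 0 < enorm x.
  move=> /orP h; rewrite /enorm sqrtr_gt0 /dot2 -!expr2.
  case: h => h; first by rewrite ltr_pwDl ?sqr_ge0// exprn_even_gt0.
  by rewrite ltr_wpDl ?sqr_ge0// exprn_even_gt0.
split; apply: h; apply: contra_neqT d0; rewrite negb_or !negbK => /andP[/eqP/= h1 /eqP/= h2];
  rewrite /tri_det.
- by rewrite h1 h2 !(mul0r,mulr0) subrr.
- have -> : C.1 = B.1 by lra. 
  have -> : C.2 = B.2 by lra.
  by ring.
- have -> : C.1 = A.1 by lra. 
  have -> : C.2 = A.2 by lra.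
  by ring.
Qed.

(** The barycentric coordinates of the incenter are proportional to the lengths of the opposite
    sides. With them the three edge integrals of [triangle_divergence] merge into one integral with
    respect to arc length. *)
Definition incenter : R * R :=
  let P := enorm (B - A) + enorm (C - B) + enorm (A - C) in
  tri_map A B C (enorm (A - C) / P, enorm (B - A) / P).

(** The factor |det| / P is the inradius r, since |det| is twice the area. *)
Lemma triangle_green (w : R * R -> R) : C1 w ->
  \int[area_measure]_(x in Omega) (dot2 (x - incenter) (grad w x) + 2 * w x) =
  `|tri_det A B C| / (enorm (B - A) + enorm (C - B) + enorm (A - C)) * fine (arc_integral Gamma w).
Proof.
move=> cw; rewrite triangle_divergence// arc_integral_triangle//=; last exact: C1_continuous.
have [l1 l2 l3] := tri_det_enorm.
have P0 : enorm (B - A) + enorm (C - B) + enorm (A - C) != 0 by rewrite gt_eqF// !addr_gt0.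
move: P0; move: (enorm _) (enorm _) (enorm _) => a b c; move: (Rintegral _ _ _) (Rintegral _ _ _) (Rintegral _ _ _) => x y z P0.
by field.
Qed.

End triangle_trace.

Lemma sum3_lty {R : realType} (I : Type) (F : I -> \bar R) (x y z : I) :
  (forall i, 0 <= F i)%E -> (\sum_(i <- [:: x; y; z]) F i < +oo)%E ->
  [/\ F x < +oo, F y < +oo & F z < +oo]%E.
Proof.
move=> F0; rewrite !big_cons big_nil adde0 => h; split; apply: le_lt_trans h.
- by rewrite leeDl// adde_ge0.
- by rewrite addeCA leeDl// adde_ge0.
- by rewrite addeA leeDr// adde_ge0.
Qed.

Section trace_limit.
Context {R : realType}.
Local Notation mu := (@lebesgue_measure R).
Local Notation T := (measurableTypeR R).
Variables A B C : R * R.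
Hypothesis d0 : tri_det A B C != 0.
Local Notation Omega := (open_triangle A B C).
Local Notation Gamma := (triangle_boundary A B C).
Local Notation I01 := (`[0%R, 1%R]%classic : set R).

Lemma edge_sqint P Q (t : R * R -> R) : 0 < enorm (Q - P) ->
  measurable_fun I01 (t \o edge P Q) ->
  (\int[mu]_(s in `[0%R, 1%R]) (t (edge P Q s) ^+ 2 * enorm (derive1 (edge P Q) s))%:E < +oo)%E ->
  sqint mu I01 (t \o edge P Q).
Proof.
move=> PQ mt; under eq_integral do rewrite derive1_edge mulrC EFinM.
rewrite ge0_integralZl//; last 3 first.
- by apply/measurable_EFinP; exact: measurable_funX mt.
- by move=> s _; rewrite lee_fin sqr_ge0.
- by rewrite lee_fin ltW.
move=> h; split => //.
have : ((enorm (Q - P))^-1%:E * ((enorm (Q - P))%:E *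
    \int[mu]_(s in `[0%R, 1%R]) (t (edge P Q s) ^+ 2)%:E) < +oo)%E.
  by rewrite lte_mul_pinfty// lee_fin invr_ge0 ltW.
by rewrite muleA -EFinM mulVf ?gt_eqF// mul1e.
Qed.

Lemma L2_boundary_sqint (t : R * R -> R) : L2_boundary Gamma t ->
  [/\ sqint mu I01 (t \o edge A B), sqint mu I01 (t \o edge B C) &
      sqint mu I01 (t \o edge C A)].
Proof.
move=> [mt ht]; have F0 (g : R -> R * R) :
    (0 <= \int[mu]_(s in `[0%R, 1%R]) ((t (g s) ^+ 2)%R * enorm (derive1 g s))%:E)%E.
  apply: integral_ge0 => s _; rewrite lee_fin mulr_ge0 ?sqr_ge0//.
  exact: sqrtr_ge0.
have [h1 h2 h3] := sum3_lty F0 ht.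
have [l1 l2 l3] := tri_det_enorm d0.
split.
- exact: (edge_sqint l1 (mt 0%N isT) h1).
- exact: (edge_sqint l2 (mt 1%N isT) h2).
- exact: (edge_sqint l3 (mt 2%N isT) h3).
Qed.

Lemma unit_itv_finite : (mu I01 < +oo)%E.
Proof. by rewrite lebesgue_measure_itv /= lte01 sube0 ltry. Qed.

Lemma arc_integral_sqint (t : R * R -> R) :
  mu.-integrable I01 (EFin \o (t \o edge A B)) ->
  mu.-integrable I01 (EFin \o (t \o edge B C)) ->
  mu.-integrable I01 (EFin \o (t \o edge C A)) ->
  arc_integral Gamma t =
  (enorm (B - A) * \int[mu]_(s in `[0%R, 1%R]) t (edge A B s) +
   enorm (C - B) * \int[mu]_(s in `[0%R, 1%R]) t (edge B C s) +
   enorm (A - C) * \int[mu]_(s in `[0%R, 1%R]) t (edge C A s))%:E.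
Proof. by move=> *; apply: sum3_EFin; exact: edge_integral. Qed.

Lemma squeeze0 (u v : nat -> R) (c : R) : 0 < c -> (forall n, 0 <= u n) ->
  (forall n, c * u n <= v n) -> v n @[n --> \oo] --> (0 : R) ->
  u n @[n --> \oo] --> (0 : R).
Proof.
move=> c0 u0 uv cv; apply: (@squeeze_cvgr _ _ _ _ (cst 0) (fun n => c^-1 * v n)).
- by apply: nearW => n; rewrite u0 /= ler_pdivlMl.
- exact: cvg_cst.
- by rewrite -[X in _ --> X](mulr0 c^-1); apply: cvgM cv; exact: cvg_cst.
Qed.

(** The arc integral is a sum of nonnegative terms with positive length factors, so the squared
    error tends to 0 on each edge; pairing with the constant 1 then gives convergence of the edge
    integrals themselves. *)
Lemma trace_edges_cvg (w : nat -> R * R -> R) (t : R * R -> R) :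
  (forall n, continuous (w n)) -> L2_boundary Gamma t ->
  (arc_integral Gamma (fun x => (w n x - t x) ^+ 2)%R @[n --> \oo] --> 0)%E ->
  fine (arc_integral Gamma (w n)) @[n --> \oo] --> fine (arc_integral Gamma t).
Proof.
move=> cw /L2_boundary_sqint[s1 s2 s3] h.
have [l1 l2 l3] := tri_det_enorm d0.
have mI : measurable (I01 : set (measurableTypeR R)) by [].
have sc (f : R -> R) : continuous f -> sqint mu I01 f.
  move=> cf; apply: integrable_sqint.
    by apply: measurable_funTS; exact: continuous_measurable_fun.
  by apply: continuous_itv_integrable; cont.
have sw n P Q : sqint mu I01 (w n \o edge P Q) by apply: sc; exact: edge_continuous.
have sq n P Q : sqint mu I01 (t \o edge P Q) ->
    mu.-integrable I01 (EFin \o (fun s => (w n (edge P Q s) - t (edge P Q s)) ^+ 2)).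
  by move=> st; apply: sqint_integrable; exact: sqintB (sw n P Q) st.
pose x P Q n := \int[mu]_(s in `[0, 1]) ((w n (edge P Q s) - t (edge P Q s)) ^+ 2).
have x0 P Q n : 0 <= x P Q n by apply: Rintegral_ge0 => s _; exact: sqr_ge0.
have hx : enorm (B - A) * x A B n + enorm (C - B) * x B C n + enorm (A - C) * x C A n
    @[n --> \oo] --> (0 : R).
  apply: (eq_cvg_to _ (fine_cvg h)) => n /=.
  by rewrite arc_integral_sqint//; exact: sq.
have one : sqint mu I01 (fun=> 1) by apply: sc; cont.
have cv P Q : sqint mu I01 (t \o edge P Q) -> x P Q n @[n --> \oo] --> (0 : R) ->
   \int[mu]_(s in `[0, 1]) w n (edge P Q s) @[n --> \oo] --> \int[mu]_(s in `[0, 1]) t (edge P Q s).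
  move=> st cx; have := cvg_Rintegral_sqint mI one (fun n => sw n P Q) st cx.
  have e (f : R -> R) : \int[mu]_(s in `[0, 1]) (f s * 1) = \int[mu]_(s in `[0, 1]) f s.
    by apply: eq_Rintegral => s _; rewrite mulr1.
  by rewrite e => hh; apply: (eq_cvg_to _ hh) => n; exact: e.
have i1 P Q : sqint mu I01 (t \o edge P Q) -> mu.-integrable I01 (EFin \o (t \o edge P Q)).
  by move=> st; exact: (sqint_integrable1 mI unit_itv_finite st).
rewrite arc_integral_sqint; [|exact: i1..]; rewrite /=.
have p n : 0 <= enorm (B - A) * x A B n /\ 0 <= enorm (C - B) * x B C n /\ 0 <= enorm (A - C) * x C A n.
  by rewrite !mulr_ge0// ltW.
have c1 : x A B n @[n --> \oo] --> (0 : R).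
  by apply: (squeeze0 l1 (x0 A B) _ hx) => n; have [? [? ?]] := p n; lra.
have c2 : x B C n @[n --> \oo] --> (0 : R).
  by apply: (squeeze0 l2 (x0 B C) _ hx) => n; have [? [? ?]] := p n; lra.
have c3 : x C A n @[n --> \oo] --> (0 : R).
  by apply: (squeeze0 l3 (x0 C A) _ hx) => n; have [? [? ?]] := p n; lra.
have l (c : R) (u : nat -> R) v : u n @[n --> \oo] --> v -> c * u n @[n --> \oo] --> c * v.
  by move=> uv; apply: cvgM uv; exact: cvg_cst.
apply: (eq_cvg_to _ (cvgD (cvgD (l (enorm (B - A)) _ _ (cv _ _ s1 c1))
   (l (enorm (C - B)) _ _ (cv _ _ s2 c2))) (l (enorm (A - C)) _ _ (cv _ _ s3 c3)))) => n.
by rewrite !fctE arc_integral_triangle.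
Qed.

(** Used with m = [grad sol], to carry the area integrals of the weak formulation from C^1 functions
    to all functions with a trace. *)
Lemma trace_interior_cvg (w : nat -> R * R -> R) v h (m : R * R -> R * R) :
  (forall n, C1 (w n)) -> H1 Omega v h ->
  (\int[area_measure]_(x in Omega) ((w n x - v x) ^+ 2)%:E @[n --> \oo] --> 0)%E ->
  (\int[area_measure]_(x in Omega) (enorm (grad (w n) x - h x) ^+ 2)%:E
     @[n --> \oo] --> 0)%E ->
  sqint area_measure Omega (fun x => (m x).1) ->
  sqint area_measure Omega (fun x => (m x).2) ->
  \int[area_measure]_(x in Omega) w n x @[n --> \oo] --> \int[area_measure]_(x in Omega) v x /\
  \int[area_measure]_(x in Omega) dot2 (m x) (grad (w n) x) @[n --> \oo] -->
  \int[area_measure]_(x in Omega) dot2 (m x) (h x).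
Proof.
move=> cw [sv s1 s2 _] cv ch sm1 sm2.
have mO := open_triangle_measurable d0.
have Ofin := open_triangle_finite d0.
have sc f : continuous f -> sqint (@area_measure R) Omega f := @continuous_triangle_sqint R A B C d0 f.
have sw n : sqint area_measure Omega (w n) by apply: sc; exact: C1_continuous (cw n).
have sg n i : sqint area_measure Omega (partial i (w n)) by apply: sc; have [] := cw n i.
have one : sqint (@area_measure R) Omega (fun=> 1) by apply: sc; cont.
have e (f : R * R -> R) : \int[area_measure]_(s in Omega) (f s * 1) = \int[area_measure]_(s in Omega) f s.
  by apply: eq_Rintegral => s _; rewrite mulr1.
split.
  have cv' : \int[area_measure]_(x in Omega) ((w n x - v x) ^+ 2) @[n --> \oo] --> (0 : R).
    exact: fine_cvg cv.
  have := cvg_Rintegral_sqint mO one sw sv cv'.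
  by rewrite e => hh; apply: (eq_cvg_to _ hh) => n; exact: e.
have en x : enorm x ^+ 2 = x.1 ^+ 2 + x.2 ^+ 2 :> R.
  by rewrite /enorm sqr_sqrtr /dot2 -!expr2 ?addr_ge0 ?sqr_ge0.
have sd1 n := sqintB mO (sg n false) s1; have sd2 n := sqintB mO (sg n true) s2.
have i1 n := sqint_integrable (sd1 n); have i2 n := sqint_integrable (sd2 n).
have E n : \int[area_measure]_(x in Omega) (enorm (grad (w n) x - h x) ^+ 2) =
  \int[area_measure]_(x in Omega) ((partial false (w n) x - (h x).1) ^+ 2) +
  \int[area_measure]_(x in Omega) ((partial true (w n) x - (h x).2) ^+ 2).
  by rewrite -RintegralD//; apply: eq_Rintegral => x _; rewrite en.
have c12 : \int[area_measure]_(x in Omega) ((partial false (w n) x - (h x).1) ^+ 2) +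
  \int[area_measure]_(x in Omega) ((partial true (w n) x - (h x).2) ^+ 2) @[n --> \oo] --> (0 : R).
  by apply: (eq_cvg_to _ (fine_cvg ch)) => n; rewrite -E.
have g0 f : 0 <= \int[area_measure]_(x in Omega) (f x ^+ 2) :> R.
  by apply: Rintegral_ge0 => x _; exact: sqr_ge0.
have z1 : \int[area_measure]_(x in Omega) ((partial false (w n) x - (h x).1) ^+ 2)
    @[n --> \oo] --> (0 : R).
  by apply: (squeeze0 ltr01 (fun n => g0 _) _ c12) => n; rewrite mul1r lerDl.
have z2 : \int[area_measure]_(x in Omega) ((partial true (w n) x - (h x).2) ^+ 2)
    @[n --> \oo] --> (0 : R).
  by apply: (squeeze0 ltr01 (fun n => g0 _) _ c12) => n; rewrite mul1r lerDr.
have c1 := cvg_Rintegral_sqint mO sm1 (fun n => sg n false) s1 z1.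
have c2 := cvg_Rintegral_sqint mO sm2 (fun n => sg n true) s2 z2.
have dE (k : R * R -> R * R) : sqint area_measure Omega (fun x => (k x).1) ->
  sqint area_measure Omega (fun x => (k x).2) ->
  \int[area_measure]_(x in Omega) ((k x).1 * (m x).1) +
  \int[area_measure]_(x in Omega) ((k x).2 * (m x).2) =
  \int[area_measure]_(x in Omega) dot2 (m x) (k x).
  move=> k1 k2; rewrite -RintegralD//; [|exact: sqintM..].
  by apply: eq_Rintegral => x _; rewrite /dot2 mulrC [X in _ + X]mulrC.
rewrite -dE//; apply: (eq_cvg_to _ (cvgD c1 c2)) => n.
by rewrite fctE -dE//; exact: sg.
Qed.

End trace_limit.

(** * The explicit solution *)

Section quadratic.
Context {R : realType}.
Local Notation mu := (@lebesgue_measure R).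
Implicit Types (P Q I : R * R).

Definition quad (k K : R) I (x : R * R) : R := K + k * dot2 (x - I) (x - I).

Lemma is_derive_sqr (k K a b t : R) :
  is_derive t 1 (fun t => K + k * ((t - a) * (t - a) + b)) (2 * k * (t - a)).
Proof.
have dt : is_derive t (1 : R) (fun t : R => t - a) 1.
  by have := is_deriveB (is_derive_id t (1 : R)) (is_derive_cst a t (1 : R)); rewrite subr0.
have dt2 := is_deriveD (is_deriveM dt dt) (is_derive_cst b t (1 : R)).
have := is_deriveD (is_derive_cst K t (1 : R)) (is_deriveZ k dt2).
move=> h; apply: (is_derive_eq h).
by rewrite /GRing.scale /=; ring.
Qed.

Lemma partial_quad k K I x i : is_derive x (evec i) (quad k K I)
  (2 * k * (if i then (x - I).2 else (x - I).1)).
Proof.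
case: i.
  apply/is_derive_partialT.
  have := is_derive_sqr k K I.2 ((x - I).1 * (x - I).1) x.2.
  by congr is_derive; apply/funext => t; rewrite /quad /dot2 /=; ring.
apply/is_derive_partialF.
have := is_derive_sqr k K I.1 ((x - I).2 * (x - I).2) x.1.
by congr is_derive; apply/funext => t; rewrite /quad /dot2 /=; ring.
Qed.

Lemma quad_C1 k K I : C1 (quad k K I).
Proof.
move=> i; split=> [x|]; first by case: (partial_quad k K I x i).
have -> : partial i (quad k K I) = (fun x => 2 * k * (if i then (x - I).2 else (x - I).1)).
  by apply/funext => x; case: (partial_quad k K I x i).
have c1 : continuous (fun x : R * R => 2 * k * (x.1 - I.1)) by cont.
have c2 : continuous (fun x : R * R => 2 * k * (x.2 - I.2)) by cont.
by case: i.
Qed.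

Lemma grad_quad k K I x : grad (quad k K I) x = (2 * k * (x - I).1, 2 * k * (x - I).2).
Proof.
rewrite /grad /partial; apply/pair_equal_spec; split.
  by have [_ ->] := partial_quad k K I x false.
by have [_ ->] := partial_quad k K I x true.
Qed.

Lemma cst_C1 (k : R) : C1 (fun _ : R * R => k).
Proof.
move=> i; split=> [x|]; first exact: derivable_cst.
have -> : partial i (fun _ : R * R => k) = fun=> 0.
  by apply/funext => x; exact: derive_cst.
by cont.
Qed.

Lemma Rintegral_quad_edge P Q I :
  \int[mu]_(s in `[0, 1]) quad 1 0 I (edge P Q s) =
  (dot2 (P - I) (P - I) + dot2 (P - I) (Q - I) + dot2 (Q - I) (Q - I)) / 3.
Proof.
pose a := dot2 (P - I) (P - I); pose b := dot2 (P - I) (Q - P); pose c := dot2 (Q - P) (Q - P).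
(* On the edge the integrand is a + 2 b s + c s^2, of which [F] is a primitive. *)
pose F (s : R) := a * s + b * (s * s) + c / 3 * (s * (s * s)).
have dF (t : R) : is_derive t (1 : R) F (quad 1 0 I (edge P Q t)).
  have d1 := is_derive_id t (1 : R).
  have d2 : is_derive t (1 : R) (fun s : R => s * s) (2 * t).
    by apply: (is_derive_eq (is_deriveM d1 d1)); rewrite /GRing.scale /=; ring.
  have d3 : is_derive t (1 : R) (fun s : R => s * (s * s)) (3 * (t * t)).
    by apply: (is_derive_eq (is_deriveM d1 d2)); rewrite /GRing.scale /=; ring.
  have h := is_deriveD (is_deriveD (is_deriveZ a d1) (is_deriveZ b d2)) (is_deriveZ (c / 3) d3).
  apply: (is_derive_eq h); rewrite /GRing.scale /= edgeE /quad /a /b /c /dot2 /=; by field.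
have cQ : continuous (fun s => quad 1 0 I (edge P Q s)).
  by apply: edge_continuous; exact: C1_continuous (quad_C1 _ _ _).
rewrite (Rintegral_FTC ler01 dF cQ) /F /a /b /c /dot2 /=; by field.
Qed.

End quadratic.

Section explicit_solution.
Context {R : realType}.
Local Notation mu := (@lebesgue_measure R).
Local Notation T := (measurableTypeR R).
Variables A B C : R * R.
Hypothesis d0 : tri_det A B C != 0.
Local Notation Omega := (open_triangle A B C).
Local Notation Gamma := (triangle_boundary A B C).
Local Notation Dt := `|tri_det A B C|.

Definition tri_perimeter := enorm (B - A) + enorm (C - B) + enorm (A - C).
Local Notation P := tri_perimeter.
Local Notation J := (incenter A B C).

Lemma tri_perimeter_gt0 : 0 < P.
Proof. by have [? ? ?] := tri_det_enorm d0; rewrite !addr_gt0. Qed.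

Lemma perimeter_triangle : perimeter Gamma = P.
Proof.
rewrite /perimeter arc_integral_triangle; last by move=> x; exact: cvg_cst.
rewrite /= !Rintegral_cst//= lebesgue_measure_itv/= lte01 sube0 /= !mul1r !mulr1.
by [].
Qed.

(** For the constant function 1, [triangle_green] reads 2 |Omega| = (|det| / P) P. *)
Lemma area_triangle : area Omega = Dt / 2.
Proof.
have := triangle_green d0 (cst_C1 1).
rewrite -[fine (arc_integral _ _)]/(perimeter Gamma) perimeter_triangle.
rewrite -/P divfK ?gt_eqF ?tri_perimeter_gt0// => <-.
rewrite (@eq_Rintegral _ _ _ (@area_measure R) Omega (fun=> 2)) => [|x _].
  rewrite (Rintegral_cst _ (open_triangle_measurable d0)) -[fine _]/(area Omega).
  by move: (area _) => a; field.
have -> : grad (fun _ : R * R => 1) x = (0, 0).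
  by rewrite /grad /partial !derive_cst.
by rewrite /dot2 /= !mulr0 !add0r mulr1.
Qed.

Let D0 : 0 < Dt. Proof. by rewrite normr_gt0. Qed.

Lemma area_triangle_gt0 : 0 < area Omega.
Proof. by rewrite area_triangle divr_gt0. Qed.

(** |Omega|^(-1/2) / r, where r = Dt / P is the inradius; the normal derivative of [sol] is then -
    sol_slope * r = - |Omega|^(-1/2). *)
Definition sol_slope := (Num.sqrt (area Omega))^-1 * (P / Dt).

Lemma sol_slope2 : sol_slope ^+ 2 = 2 * P ^+ 2 / Dt ^+ 3.
Proof.
rewrite /sol_slope exprMn exprVn sqr_sqrtr ?(ltW area_triangle_gt0)// area_triangle.
by field; rewrite gt_eqF.
Qed.

Definition sol_mean := (\int[area_measure]_(x in Omega) quad 1 0 J x) / area Omega.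

Definition sol := quad (- sol_slope / 2) (sol_slope / 2 * sol_mean) J.

Lemma sol_C1 : C1 sol. Proof. exact: quad_C1. Qed.

Lemma grad_sol x : grad sol x = (- sol_slope * (x - J).1, - sol_slope * (x - J).2).
Proof. by rewrite grad_quad; apply/pair_equal_spec; split; field. Qed.

Lemma sol_integral0 : \int[area_measure]_(x in Omega) sol x = 0.
Proof.
have iq : (@area_measure R).-integrable Omega (EFin \o quad 1 0 J).
  by apply: continuous_triangle_integrable => //; exact: C1_continuous (quad_C1 _ _ _).
have i1 : (@area_measure R).-integrable Omega (EFin \o (fun=> sol_slope / 2 * sol_mean)).
  by apply: continuous_triangle_integrable => //; cont.
have mO := open_triangle_measurable d0.
rewrite (@eq_Rintegral _ _ _ (@area_measure R) Omega (fun x => sol_slope / 2 * sol_mean + - sol_slope / 2 * quad 1 0 J x)).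
  rewrite RintegralD//; last exact: integrableRZ.
  rewrite (Rintegral_cst _ mO) RintegralZl// -[fine _]/(area Omega) /sol_mean.
  by field; rewrite gt_eqF// area_triangle_gt0.
by move=> x _; rewrite /sol /quad; ring.
Qed.

(** With r = Dt / P, [triangle_green] expresses the area integral of (x - J).grad w as r times the
    boundary integral of w minus twice its area integral. It remains to multiply by - sol_slope = -
    |Omega|^(-1/2) / r and to use 2 / r = P / |Omega|. *)
Lemma sol_green (w : R * R -> R) : C1 w ->
  \int[area_measure]_(x in Omega) dot2 (grad sol x) (grad w x) =
  (Num.sqrt (area Omega))^-1 *
   (perimeter Gamma / area Omega * \int[area_measure]_(x in Omega) w x
    - fine (arc_integral Gamma w)).
Proof.
move=> cw; have cwc := C1_continuous cw.
have mO := open_triangle_measurable d0.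
have cp i : continuous (partial i w) by have [] := cw i.
have ci f : continuous f -> (@area_measure R).-integrable Omega (EFin \o f).
  exact: continuous_triangle_integrable.
have cd : continuous (fun x : R * R => dot2 (x - J) (grad w x)).
  have cd' : continuous (fun x : R * R =>
    (x.1 - J.1) * partial false w x + (x.2 - J.2) * partial true w x).
    by cont; exact: cp.
  exact: cd'.
have := triangle_green d0 cw; rewrite RintegralD ?RintegralZl//; last 3 first.
- exact: ci.
- exact: ci.
- by apply: ci; cont.
rewrite -/P => E.
rewrite (@eq_Rintegral _ _ _ (@area_measure R) Omega (fun x => - sol_slope * dot2 (x - J) (grad w x))); last first.
  by move=> x _; rewrite grad_sol /dot2 /=; ring.
rewrite RintegralZl//; last exact: ci.
move/(canRL (addrK _)) : E => ->.
rewrite perimeter_triangle /sol_slope area_triangle.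
have := tri_perimeter_gt0 => P0.
by field; rewrite !gt_eqF// sqrtr_gt0 divr_gt0.
Qed.

(** Both sides of [sol_green] converge along the C^1 sequence contained in [is_trace], so the
    identity passes to every admissible triple (v, h, t). *)
Lemma sol_weak : weak_solution Omega Gamma sol (grad sol).
Proof.
have [N hN] := open_triangle_bounded A B C.
have mO := open_triangle_measurable d0.
split; [exact: C1_H1 mO hN sol_C1|exact: sol_integral0|].
move=> v h t Hv [tL [w [cw cv ch ct]]].
have cp i : continuous (partial i sol) by have [] := sol_C1 i.
have s1 : sqint area_measure Omega (fun x => (grad sol x).1).
  exact: (continuous_triangle_sqint d0 (cp false)).
have s2 : sqint area_measure Omega (fun x => (grad sol x).2).
  exact: (continuous_triangle_sqint d0 (cp true)).
have [c1 c2] := trace_interior_cvg d0 cw Hv cv ch s1 s2.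
have cwc n : continuous (w n) by exact: C1_continuous.
have c3 := trace_edges_cvg d0 cwc tL ct.
have c4 : (Num.sqrt (area Omega))^-1 *
   (perimeter Gamma / area Omega * \int[area_measure]_(x in Omega) w n x
    - fine (arc_integral Gamma (w n))) @[n --> \oo] --> (Num.sqrt (area Omega))^-1 *
   (perimeter Gamma / area Omega * \int[area_measure]_(x in Omega) v x
    - fine (arc_integral Gamma t)).
  by apply: cvgM; [exact: cvg_cst|apply: cvgB c3; apply: cvgM c1; exact: cvg_cst].
have c5 := eq_cvg_to (fun n => esym (sol_green (cw n))) c4.
exact: cvg_unique c2 c5.
Qed.

(* |p|^2 + p.q + |q|^2 is 3 times the mean of |x|^2 over the segment [p, q]. *)
Definition tri_energy : R :=
  P / (6 * Dt ^+ 2) *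
  (enorm (B - A) * (dot2 (A - J) (A - J) + dot2 (A - J) (B - J) + dot2 (B - J) (B - J)) +
   enorm (C - B) * (dot2 (B - J) (B - J) + dot2 (B - J) (C - J) + dot2 (C - J) (C - J)) +
   enorm (A - C) * (dot2 (C - J) (C - J) + dot2 (C - J) (A - J) + dot2 (A - J) (A - J))).

(** The energy density is sol_slope^2 q with q = |x - J|^2. Since (x - J).grad q = 2 q,
    [triangle_green] applied to q says that 4 times its area integral is Dt / P times its boundary
    integral. The constant is sol_slope^2 (Dt / P) / 4 / 3 = P / (6 Dt^2). *)
Lemma sol_energy :
  \int[area_measure]_(x in Omega) (enorm (grad sol x) ^+ 2) = tri_energy.
Proof.
have mO := open_triangle_measurable d0.
have cq := C1_continuous (quad_C1 1 0 J).
have iq : (@area_measure R).-integrable Omega (EFin \o quad 1 0 J).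
  exact: continuous_triangle_integrable.
rewrite (@eq_Rintegral _ _ _ (@area_measure R) Omega (fun x => sol_slope ^+ 2 * quad 1 0 J x)); last first.
  move=> x _; rewrite grad_sol /enorm sqr_sqrtr /dot2 /quad /dot2 /=; first by ring.
  by rewrite addr_ge0// -expr2 sqr_ge0.
rewrite RintegralZl//.
have := triangle_green d0 (quad_C1 1 0 J).
rewrite (@eq_Rintegral _ _ _ (@area_measure R) Omega (fun x => 4 * quad 1 0 J x)); last first.
  by move=> x _; rewrite grad_quad /quad /dot2 /=; ring.
rewrite RintegralZl// arc_integral_triangle// !Rintegral_quad_edge /= -/P => E.
have -> : \int[area_measure]_(x in Omega) quad 1 0 J x =
  (4 * \int[area_measure]_(x in Omega) quad 1 0 J x) / 4 by field.
rewrite E sol_slope2 /tri_energy; have := tri_perimeter_gt0 => P0.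
by field; rewrite !gt_eqF.
Qed.

End explicit_solution.

(** * Uniqueness of the gradient *)

Section rays.
Context {R : realType}.
Local Notation T := (measurableTypeR R).

(** Quadrants are stable under intersection, generate the product sigma-algebra, and have their
    boundary in two lines, a null set: exactly what the test of weak convergence requires. *)
Definition quadrants : set (set (T * T)) :=
  [set A | exists a b : R, A = `]-oo, a[ `*` `]-oo, b[].

Lemma quadrants_setI : setI_closed quadrants.
Proof.
move=> _ _ [a [b ->]] [a' [b' ->]]; exists (Num.min a a'), (Num.min b b').
apply/seteqP; split=> x /=; rewrite !in_itv/= !lt_min.
  by move=> [[-> ->] [-> ->]].
by move=> [/andP[-> ->] /andP[-> ->]].
Qed.

Lemma quadrants_measurable : @measurable _ (T * T)%type = <<s quadrants >>.
Proof.
have RG : @measurable _ T = <<s @RGenInftyO.G R >> by exact: RGenInftyO.measurableE.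
have mf : measurable_fun setT (fst : g_sigma_algebraType quadrants -> T).
  apply: (measurability _ RG) => _ [_ [a ->] <-]; rewrite setTI.
  rewrite (_ : _ @^-1` _ = \bigcup_n (`]-oo, a[ `*` `]-oo, (n%:R : R)[)).
    apply: bigcup_measurable => n _; apply: sub_sigma_algebra.
    by exists a, n%:R.
  apply/seteqP; split=> [x /= xa|x [n _ []]//].
  exists (Num.truncn `|x.2|).+1 => //; split => //=.
  by rewrite in_itv/= (le_lt_trans (ler_norm _))// truncnS_gt.
have ms : measurable_fun setT (snd : g_sigma_algebraType quadrants -> T).
  apply: (measurability _ RG) => _ [_ [a ->] <-]; rewrite setTI.
  rewrite (_ : _ @^-1` _ = \bigcup_n (`]-oo, (n%:R : R)[ `*` `]-oo, a[)).
    apply: bigcup_measurable => n _; apply: sub_sigma_algebra.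
    by exists n%:R, a.
  apply/seteqP; split=> [x /= xa|x [n _ []]//].
  exists (Num.truncn `|x.1|).+1 => //; split => //=.
  by rewrite in_itv/= (le_lt_trans (ler_norm _))// truncnS_gt.
rewrite measurable_prod_measurableType eqEsubset; split.
  apply: smallest_sub; first exact: smallest_sigma_algebra.
  move=> _ [A mA [B mB <-]].
  have -> : A `*` B = (fst @^-1` A) `&` (snd @^-1` B) by [].
  have := mf measurableT A mA; have := ms measurableT B mB; rewrite !setTI => h1 h2.
  exact: (@measurableI _ (g_sigma_algebraType quadrants)).
apply: smallest_sub; first exact: smallest_sigma_algebra.
by move=> _ [a [b ->]]; apply: sub_sigma_algebra; exists `]-oo, a[%classic => //; exists `]-oo, b[%classic.
Qed.

End rays.

(** * Fubini's theorem for a bounded kernel *)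

Section integrable_bounded.
Context {R : realType} d (T : measurableType d).
Variables (mu : {measure set T -> \bar R}) (D : set T) (M : R).
Hypothesis mD : measurable D.

Lemma integrable_bounded_mul (f g : T -> R) : mu.-integrable D (EFin \o f) ->
  measurable_fun D g -> (forall x, D x -> `|g x| <= M) ->
  mu.-integrable D (EFin \o (fun x => f x * g x)).
Proof.
move=> fi mg gM.
have mf : measurable_fun D f by apply/measurable_EFinP; case/integrableP : fi.
apply: (le_integrableR mD (g := fun x => M * `|f x|)).
- exact: measurable_funM.
- by move=> x Dx; rewrite normrM mulrC ler_wpM2r// gM.
- by apply: integrableRZ => //; have := integrable_norm fi.
Qed.

End integrable_bounded.

Section kernel_fubini.
Context {R : realType} d (T : measurableType d).
Variables (mu : {sigma_finite_measure set T -> \bar R}) (D : set T).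
Hypothesis mD : measurable D.
Variables (a b : T -> R) (k : T * T -> R) (M : R).
Hypothesis ia : mu.-integrable D (EFin \o a).
Hypothesis ib : mu.-integrable D (EFin \o b).
Hypothesis mk : measurable_fun setT k.
Hypothesis kM : forall z, `|k z| <= M.

Let mk1 x : measurable_fun D (fun y => k (x, y)).
Proof. by apply: measurable_funTS; apply: measurableT_comp => //; exact: pair1_measurable. Qed.

Let mk2 y : measurable_fun D (fun x => k (x, y)).
Proof. by apply: measurable_funTS; apply: measurableT_comp => //; exact: pair2_measurable. Qed.

Lemma kernel_integrable1 x : mu.-integrable D (EFin \o (fun y => b y * k (x, y))).
Proof. exact: (integrable_bounded_mul (M := M)). Qed.

Lemma kernel_integrable2 y : mu.-integrable D (EFin \o (fun x => a x * k (x, y))).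
Proof. exact: (integrable_bounded_mul (M := M)). Qed.

(** [a] and [b] are extended by 0 outside [D], so that Fubini's theorem can be applied on the whole
    product space. *)
Let F (z : T * T) := (a \_ D) z.1 * ((b \_ D) z.2 * k z).

Let restr_int (f : T -> R) : mu.-integrable D (EFin \o f) -> mu.-integrable setT (EFin \o (f \_ D)).
Proof.
by move=> fi; rewrite -restrict_EFin; apply/integrable_restrict => //; rewrite setTI.
Qed.

Let restr_meas (f : T -> R) : mu.-integrable D (EFin \o f) -> measurable_fun setT (f \_ D).
Proof. by move=> /restr_int/integrableP[/measurable_EFinP]. Qed.

Let mF : measurable_fun setT F.
Proof.
apply: measurable_funM.
  by apply: measurableT_comp => //; exact: restr_meas.
by apply: measurable_funM => //; apply: measurableT_comp => //; exact: restr_meas.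
Qed.

(** The integrand is dominated by M |a(x)| |b(y)|, a product of integrable functions of one variable
    each. *)
Let iF : (mu \x mu)%E.-integrable setT (EFin \o F).
Proof.
apply/integrable12ltyP; first exact/measurable_EFinP.
have nb := integrable_norm (restr_int ib); have na := integrable_norm (restr_int ia).
pose c := \int[mu]_y `|(b \_ D) y|.
have iac : mu.-integrable setT (EFin \o (fun x => M * c * `|(a \_ D) x|)).
  by apply: integrableRZ.
have /integrableP[_ h] := iac; apply: le_lt_trans h.
apply: ge0_le_integral => //.
- by move=> x _; exact: integral_ge0.
- have := measurable_fun_fubini_tonelli_F (m2 := mu) (fun z => `|F z|%:E).
  by apply => //; apply/measurable_EFinP; exact: measurableT_comp.
- by apply/measurable_EFinP; apply: measurableT_comp => //; case/integrableP : iac => /measurable_EFinP.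
move=> x _; rewrite (@le_trans _ _ (\int[mu]_y ((M * `|(a \_ D) x|) * `|(b \_ D) y|)%:E)%E)//.
  apply: ge0_le_integral => //.
  - apply/measurable_EFinP; apply: measurableT_comp => //.
    by apply: measurableT_comp => //; exact: pair1_measurable.
  - by apply/measurable_EFinP; apply: measurable_funM => //; case/integrableP : nb => /measurable_EFinP.
  - move=> y _; rewrite lee_fin /F /= !normrM -mulrA [leRHS]mulrCA ler_wpM2l//.
    by rewrite [leRHS]mulrC ler_wpM2l.
under eq_integral do rewrite EFinM.
rewrite integralZl// -[X in (_ * X)%E]fineK; last exact: integrable_fin_num.
by rewrite -EFinM lee_fin -[fine _]/c (le_trans _ (ler_norm _))// mulrAC.
Qed.

Let inner1 x : \int[mu]_(y in D) (b y * k (x, y)) = \int[mu]_y ((b \_ D) y * k (x, y)).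
Proof.
rewrite Rintegral_mkcond; apply: eq_Rintegral => y _; rewrite !patchE.
by case: ifPn => _ //; rewrite mul0r.
Qed.

Let inner2 y : \int[mu]_(x in D) (a x * k (x, y)) = \int[mu]_x ((a \_ D) x * k (x, y)).
Proof.
rewrite Rintegral_mkcond; apply: eq_Rintegral => x _; rewrite !patchE.
by case: ifPn => _ //; rewrite mul0r.
Qed.

Let patch_int (f g : T -> R) : mu.-integrable D (EFin \o (fun x => f x * g x)) ->
  mu.-integrable setT (EFin \o (fun x => (f \_ D) x * g x)).
Proof.
move=> /restr_int; congr (_.-integrable _ _); apply/funext => x /=.
by rewrite !patchE; case: ifPn => _ //; rewrite mul0r.
Qed.

Let FE : fubini_F mu (EFin \o F) =
  EFin \o ((fun x => a x * \int[mu]_(y in D) (b y * k (x, y))) \_ D).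
Proof.
apply/funext => x; rewrite /fubini_F /F /=.
have h := patch_int (kernel_integrable1 x).
under eq_integral do rewrite EFinM.
rewrite integralZl// -[X in (_ * X)%E]fineK; last exact: integrable_fin_num.
rewrite -EFinM -[fine _]/(\int[mu]_y ((b \_ D) y * k (x, y))) -inner1.
by rewrite !patchE; case: ifPn => _ //; rewrite mul0r.
Qed.

Let GE : fubini_G mu (EFin \o F) =
  EFin \o ((fun y => b y * \int[mu]_(x in D) (a x * k (x, y))) \_ D).
Proof.
apply/funext => y; rewrite /fubini_G /F /=.
have h := patch_int (kernel_integrable2 y).
under eq_integral do rewrite mulrCA EFinM.
rewrite integralZl// -[X in (_ * X)%E]fineK; last exact: integrable_fin_num.
rewrite -EFinM -[fine _]/(\int[mu]_x ((a \_ D) x * k (x, y))) -inner2.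
by rewrite !patchE; case: ifPn => _ //; rewrite mul0r.
Qed.

Lemma kernel_fubini_measurable :
  measurable_fun D (fun x => a x * \int[mu]_(y in D) (b y * k (x, y))).
Proof.
have := measurable_fubini_F iF; rewrite FE => /measurable_EFinP h.
by have := (measurable_restrict _ mD measurableT).2 h; rewrite setTI.
Qed.

Lemma kernel_fubini_integrable :
  mu.-integrable D (EFin \o (fun x => a x * \int[mu]_(y in D) (b y * k (x, y)))).
Proof.
apply: (le_integrableR mD (g := fun x => (\int[mu]_(y in D) (M * `|b y|)) * `|a x|)).
- exact: kernel_fubini_measurable.
- move=> x _; rewrite normrM mulrC ler_wpM2r//.
  have ibk := kernel_integrable1 x.
  rewrite (le_trans (le_normr_Rintegral mD ibk))//; apply: le_Rintegral => //.
  + exact: integrable_norm ibk.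
  + by apply: integrableRZ => //; exact: integrable_norm ib.
  + by move=> y _; rewrite normrM mulrC ler_wpM2r.
- by apply: integrableRZ => //; exact: integrable_norm ia.
Qed.

Lemma kernel_fubini :
  \int[mu]_(x in D) (a x * \int[mu]_(y in D) (b y * k (x, y))) =
  \int[mu]_(y in D) (b y * \int[mu]_(x in D) (a x * k (x, y))).
Proof.
rewrite [LHS]Rintegral_mkcond [RHS]Rintegral_mkcond /Rintegral; congr fine.
transitivity (\int[mu]_x fubini_F mu (EFin \o F) x)%E; first by rewrite FE.
transitivity (\int[mu]_x fubini_G mu (EFin \o F) x)%E; last by rewrite GE.
by rewrite (integral12_prod_meas1 iF) (integral21_prod_meas1 iF).
Qed.

End kernel_fubini.

Section area_sigma_finite.
Context {R : realType}.
Local Notation T := (measurableTypeR R).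

Lemma area_measure_sigma_finite : sigma_finite [set: T * T] (@area_measure R).
Proof.
exists (fun n => `[- (n%:R : R), n%:R] `*` `[- (n%:R : R), n%:R]).
  apply/esym/seteqP; split=> // x _.
  have h (t : R) m : (Num.truncn `|t| < m)%N -> t \in `[- m%:R, m%:R].
    move=> tm; rewrite in_itv/= -ler_norml ltW// (lt_le_trans (truncnS_gt _))//.
    by rewrite ler_nat.
  exists (maxn (Num.truncn `|x.1|) (Num.truncn `|x.2|)).+1 => //.
  by split; apply: h; rewrite ltnS ?leq_maxl ?leq_maxr.
move=> n; split; first exact: measurableX.
exact: area_measure_box.
Qed.

(* [area_measure] is declared as a mere measure; Fubini needs the sigma-finite
   structure. *)
Definition area_sigma : {sigma_finite_measure set (T * T)%type -> \bar R} :=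
  HB.pack_for {sigma_finite_measure set (T * T)%type -> \bar R} (Measure.sort (@area_measure R))
  (Measure.class (@area_measure R))
  (Measure_isSigmaFinite.Build _ _ _ (@area_measure R) area_measure_sigma_finite).
End area_sigma_finite.

(** * The mollifier and its integrals *)

Section bump_integral.
Context {R : realType}.
Local Notation mu := (@lebesgue_measure R).
Local Notation T := (measurableTypeR R).

Lemma bump_ge0 (x : R) : 0 <= bump x.
Proof.
by rewrite /bump /expinv !hornerC; case: ifP => _; case: ifP => _;
  rewrite ?mul1r ?mul0r ?mulr0// mulr_ge0// expR_ge0.
Qed.

Lemma bump_out (x : R) : 1 <= `|x| -> bump x = 0.
Proof.
rewrite /bump /expinv ler_normr => /orP[x1|x1].
  by rewrite [X in _ * X]ifF ?mulr0//; apply/negbTE; rewrite -leNgt; lra.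
by rewrite ifF ?mul0r//; apply/negbTE; rewrite -leNgt; lra.
Qed.

Lemma bump_affine_smooth (k a c : R) : smooth_gen (fun s => k * bump (a * s + c)).
Proof.
have -> : (fun s => k * bump (a * s + c)) =
    (fun s => expinv k%:P (a * s + (c + 1)) * expinv 1 (- a * s + (1 - c))).
  apply/funext => s; rewrite /bump mulrA; congr (_ * _).
    rewrite addrA /expinv !hornerC mul1r; case: ifP => _ //; by rewrite ?mulr0.
  by congr (expinv 1 _); ring.
by apply: smooth_mul; exact: smooth_expinv.
Qed.

Lemma bump_smooth : smooth_gen (@bump R).
Proof.
have := bump_affine_smooth 1 1 0; congr smooth_gen.
by apply/funext => s; rewrite !mul1r addr0.
Qed.

Lemma bump_continuous : continuous (@bump R).
Proof. exact: smooth_gen_continuous bump_smooth. Qed.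

Lemma compact_support_bounded (f : R -> R) : continuous f ->
  (forall x, 1 < `|x| -> f x = 0) -> exists2 M, 0 <= M & forall x, `|f x| <= M.
Proof.
move=> cf f0; have [|M M0 hM] := @continuous_bounded_box R (fun x => f x.1) 1.
  by move=> x; apply: continuous_comp; [exact: cvg_fst|exact: cf].
exists M => // x; have [x1|x1] := leP `|x| 1; last by rewrite f0// normr0.
by apply: (hM (x, 0)) => //=; rewrite normr0.
Qed.

Lemma bump_derivative : exists b' : R -> R, [/\ continuous b',
  (forall x : R, is_derive x 1 (@bump R) (b' x)) & (exists2 M, 0 <= M & forall x, `|b' x| <= M)].
Proof.
have [b' sb' db] := smooth_gen_derive bump_smooth.
have cb' := smooth_gen_continuous sb'.
exists b'; split => //; apply: compact_support_bounded => // x x1.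
have [_ <-] := db x; rewrite (near_eq_derive (g := cst 0)); first exact: derive_cst.
have c : {for x, continuous (fun y : R => `|y|)} by exact: norm_continuous.
have : \forall y \near x, 1 < `|y| by exact: (cvgr_gt _ c).
by apply: filterS => y y1; rewrite bump_out// ltW.
Qed.

Lemma bump_bounded : exists2 M : R, 0 <= M & forall x, `|bump x| <= M.
Proof.
by apply: compact_support_bounded => [|x x1]; [exact: bump_continuous|rewrite bump_out// ltW].
Qed.

Definition bump_mass : R := \int[mu]_x bump x.

Lemma bump_integrable : mu.-integrable setT (EFin \o @bump R).
Proof.
have -> : EFin \o @bump R = (EFin \o @bump R) \_ `[- 1, 1].
  apply/funext => x; rewrite patchE; case: ifPn => //.
  rewrite notin_setE /= in_itv/= => /negP; rewrite -ler_norml -ltNge => /ltW x1.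
  by rewrite bump_out.
apply/integrable_restrict => //; rewrite setTI.
by apply: continuous_itv_integrable; exact: bump_continuous.
Qed.

Lemma integral_bump : (\int[mu]_x (bump x)%:E = bump_mass%:E)%E.
Proof. by rewrite /bump_mass /Rintegral fineK//; exact: integrable_fin_num bump_integrable. Qed.

(** For x in [-1/2, 1/2] both 1 + x and 1 - x are at least 1/2, hence each exponential factor is at
    least exp(-2); this is the origin of [expR (- 4)]. *)
Lemma bump_mass_gt0 : 0 < bump_mass.
Proof.
have e0 := expR_gt0 (- 4 : R).
rewrite (@lt_le_trans _ _ (\int[mu]_(x in `[- (1 / 2), 1 / 2]) (expR (- 4 : R))))//.
  have mI : measurable (`[- (1 / 2), 1 / 2] : set T) by [].
  have E : mu `[(- (1 / 2))%R, (1 / 2)%R] = 1%:E.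
    rewrite lebesgue_measure_itv/= lte_fin ifT; last lra.
    by rewrite -EFinB; congr (_%:E); lra.
  rewrite (Rintegral_cst _ mI).
  by rewrite (congr1 fine E : fine (mu _) = 1) mulr1.
have cc : continuous (fun _ : R => expR (-4 : R)) by move=> x; exact: cvg_cst.
rewrite (@le_trans _ _ (\int[mu]_(x in `[- (1 / 2), 1 / 2]) (bump x)))//.
  apply: le_Rintegral => //.
  - exact: continuous_itv_integrable.
  - exact/continuous_itv_integrable/bump_continuous.
  move=> x; rewrite /= in_itv/= => /andP[x1 x2].
  rewrite /bump /expinv !hornerC !mul1r !ifT; [|lra|lra].
  rewrite -expRD ler_expR.
  have h (t : R) : 1 / 2 <= t -> t^-1 <= 2.
    by move=> t1; rewrite -[leRHS]invrK lef_pV2 ?posrE//; lra.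
  have := h (x + 1); have := h (1 - x); move: ((x + 1)^-1) ((1 - x)^-1) => a b; lra.
rewrite /bump_mass [leLHS]Rintegral_mkcond; apply: le_Rintegral => //.
- rewrite -restrict_EFin; apply/integrable_restrict => //; rewrite setTI.
  exact/continuous_itv_integrable/bump_continuous.
- exact: bump_integrable.
- by move=> x _; rewrite patchE; case: ifP => // _; exact: bump_ge0.
Qed.

Lemma integral_bump_affine (p q : R) : p != 0 ->
  (\int[mu]_x (bump (p * x + q))%:E = (`|p|^-1 * bump_mass)%:E)%E.
Proof.
move=> p0; have mb : measurable_fun [set: T] (EFin \o @bump R).
  by apply/measurable_EFinP; apply: continuous_measurable_fun; exact: bump_continuous.
have h := ge0_integral_affine q p0 mb (fun x => bump_ge0 x).
rewrite EFinM -integral_bump h muleA -EFinM mulVf ?normr_eq0// mul1e.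
by [].
Qed.

(* The mollifier is not normalized: its mass is [bump_mass]. *)
Definition mol (e c s : R) := e^-1 * bump (e^-1 * (s - c)).

Lemma mol_ge0 e c s : 0 < e -> 0 <= mol e c s.
Proof. by move=> e0; rewrite mulr_ge0 ?bump_ge0// invr_ge0 ltW. Qed.

Lemma mol_out e c s : 0 < e -> e <= `|s - c| -> mol e c s = 0.
Proof.
move=> e0 h; rewrite /mol bump_out ?mulr0//.
by rewrite normrM gtr0_norm ?invr_gt0// ler_pdivlMl// mulr1.
Qed.

Lemma integral_scaled_bump_affine (k p q : R) : 0 <= k -> p != 0 ->
  (\int[mu]_x (k * bump (p * x + q))%:E = (k * (`|p|^-1 * bump_mass))%:E)%E.
Proof.
move=> k0 p0; under eq_integral do rewrite EFinM.
rewrite ge0_integralZl//.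
- by rewrite integral_bump_affine.
- apply/measurable_EFinP; apply: continuous_measurable_fun.
  have -> : (fun x => bump (p * x + q)) = (fun x => 1 * bump (p * x + q)).
    by apply/funext => x; rewrite mul1r.
  exact: smooth_gen_continuous (bump_affine_smooth 1 p q).
- by move=> x _; rewrite lee_fin bump_ge0.
Qed.

Lemma integral_mol e c : 0 < e -> (\int[mu]_s (mol e c s)%:E = bump_mass%:E)%E.
Proof.
move=> e0; have ei : e^-1 != 0 by rewrite gt_eqF// invr_gt0.
rewrite (eq_integral (fun s : T => (e^-1 * bump (e^-1 * s + - e^-1 * c))%:E)); last first.
  by move=> s _; rewrite /mol; congr (_ * bump _)%:E; ring.
rewrite integral_scaled_bump_affine ?invr_ge0 ?ltW// gtr0_norm ?invr_gt0//.
by rewrite mulrA mulfV// mul1r.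
Qed.

Lemma integral_mol_center e a l s : 0 < e -> 0 < l ->
  (\int[mu]_t (mol e (a + l * t) s)%:E = (bump_mass / l)%:E)%E.
Proof.
move=> e0 l0; have ei : - (e^-1 * l) != 0 by rewrite oppr_eq0 mulf_neq0 ?gt_eqF// invr_gt0.
rewrite (eq_integral (fun t : T => (e^-1 * bump (- (e^-1 * l) * t + e^-1 * (s - a)))%:E)); last first.
  by move=> t _; rewrite /mol; congr (_ * bump _)%:E; ring.
rewrite integral_scaled_bump_affine ?invr_ge0 ?ltW//.
rewrite normrN gtr0_norm ?mulr_gt0 ?invr_gt0//; congr (_%:E).
by field; rewrite !gt_eqF.
Qed.

Lemma mol_smooth e c : smooth_gen (mol e c).
Proof.
have := bump_affine_smooth e^-1 e^-1 (- e^-1 * c); congr smooth_gen.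
by apply/funext => s; rewrite /mol; congr (_ * bump _); ring.
Qed.

Lemma mol_center_smooth e a l s : smooth_gen (fun t => mol e (a + l * t) s).
Proof.
have := bump_affine_smooth e^-1 (- (e^-1 * l)) (e^-1 * (s - a)); congr smooth_gen.
by apply/funext => t; rewrite /mol; congr (_ * bump _); ring.
Qed.

(** [mol e c s] depends on [c] and [s] through s - c only, so differentiating it in the variable of
    a centre a + l t gives - l times its derivative in [s]. This makes the two gradients of the
    kernel proportional. *)
Lemma mol_derivative : exists dmol : R -> R -> R -> R,
 [/\ forall e c s : R, is_derive s 1 (mol e c) (dmol e c s),
     forall e a l s t : R, is_derive t 1 (fun t => mol e (a + l * t) s) (- l * dmol e (a + l * t) s),
     forall e, exists M, forall c s, `|dmol e c s| <= M &
     forall e, continuous (fun z : R * R => dmol e z.1 z.2)].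
Proof.
have [b' [cb' db [M M0 hM]]] := bump_derivative.
exists (fun e c s => e^-1 * (e^-1 * b' (e^-1 * (s - c)))); split.
- move=> e c s; have h := is_derive_affine (db (e^-1 * s + - e^-1 * c)).
  have h2 := is_deriveZ e^-1 h.
  have E : e^-1 \*: (fun t => bump (e^-1 * t + - e^-1 * c)) = mol e c.
    by apply/funext => t; rewrite /mol; congr (_ * bump _); ring.
  rewrite -E; apply: (is_derive_eq h2); rewrite /GRing.scale /=.
  by congr (_ * (_ * b' _)); ring.
- move=> e a l s t; have h := is_derive_affine (db (- (e^-1 * l) * t + e^-1 * (s - a))).
  have h2 := is_deriveZ e^-1 h.
  have E : e^-1 \*: (fun t => bump (- (e^-1 * l) * t + e^-1 * (s - a))) = (fun t => mol e (a + l * t) s).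
    by apply/funext => u; rewrite /mol; congr (_ * bump _); ring.
  rewrite -E; apply: (is_derive_eq h2); rewrite /GRing.scale /=.
  have -> : - (e^-1 * l) * t + e^-1 * (s - a) = e^-1 * (s - (a + l * t)) by ring.
  by ring.
- move=> e; exists (`|e^-1| * (`|e^-1| * M)) => c s.
  by rewrite !normrM !ler_wpM2l.
- move=> e; apply: continuous_mulR; first exact: continuous_cstR.
  apply: continuous_mulR; first exact: continuous_cstR.
  have h : continuous (fun z : R * R => e^-1 * (z.2 - z.1)) by cont.
  by move=> z; apply: (@continuous_comp _ _ _ (fun z : R * R => e^-1 * (z.2 - z.1)) b'); [exact: h|exact: cb'].
Qed.

Lemma mol_bounded e : 0 < e -> exists M, forall c s, `|mol e c s| <= M.
Proof.
move=> e0; have [M M0 hM] := bump_bounded.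
by exists (`|e^-1| * M) => c s; rewrite normrM ler_wpM2l.
Qed.

Lemma mol_continuous2 e : continuous (fun z : R * R => mol e z.1 z.2).
Proof.
apply: continuous_mulR; first exact: continuous_cstR.
have h : continuous (fun z : R * R => e^-1 * (z.2 - z.1)) by cont.
by move=> z; apply: (@continuous_comp _ _ _ (fun z : R * R => e^-1 * (z.2 - z.1)) (@bump R)); [exact: h|exact: bump_continuous].
Qed.

End bump_integral.

Section tensor_integral.
Context {R : realType}.
Local Notation mu := (@lebesgue_measure R).
Local Notation T := (measurableTypeR R).

Lemma ge0_integral_tensor (f g : R -> R) (a b : R) :
  continuous f -> continuous g -> (forall x, 0 <= f x) -> (forall x, 0 <= g x) ->
  (\int[mu]_x (f x)%:E = a%:E)%E -> (\int[mu]_x (g x)%:E = b%:E)%E ->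
  (\int[area_measure]_x (tensor f g x)%:E = (a * b)%:E)%E.
Proof.
move=> cf cg f0 g0 fa gb.
have mf : measurable_fun [set: T] (EFin \o f).
  by apply/measurable_EFinP; exact: continuous_measurable_fun.
have mg : measurable_fun [set: T] (EFin \o g).
  by apply/measurable_EFinP; exact: continuous_measurable_fun.
have mt : measurable_fun [set: T * T] (EFin \o tensor f g).
  by apply/measurable_EFinP; apply: continuous_measurable2; exact: tensor_continuous.
have t0 x : (0 <= (EFin \o tensor f g) x)%E by rewrite lee_fin mulr_ge0.
rewrite /area_measure (fubini_tonelli1 _ mt t0) /fubini_F /tensor /=.
under eq_integral => x _.
  under eq_integral do rewrite EFinM.
  rewrite ge0_integralZl// ?lee_fin//; last by move=> y _; rewrite lee_fin.
  rewrite gb; over.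
rewrite ge0_integralZr//.
- by rewrite fa.
- by move=> x _; rewrite lee_fin.
- by rewrite -gb integral_ge0// => x _; rewrite lee_fin.
Qed.

End tensor_integral.

(** * Averages over shrinking neighbourhoods in a star-shaped domain *)

Section mollification.
Context {R : realType}.
Local Notation mu := (@lebesgue_measure R).
Local Notation T := (measurableTypeR R).
Local Notation nu := (@area_measure R).
Variables (D : set (T * T)) (N : R).
Hypothesis mD : measurable D.
Hypothesis DN : forall x : T * T, D x -> `|x.1| <= N /\ `|x.2| <= N.
Variables (z0 : R * R) (dl : R).
Hypothesis dl0 : 0 < dl.
(** [D] is star-shaped with respect to the closed box of half-width [dl] about [z0]: the
    inequalities say that x = (1 - l) z + l y for some z in that box. *)
Hypothesis shrink : forall (l : R) (x y : R * R), 0 <= l -> l < 1 -> D y ->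
  `|x.1 - ((1 - l) * z0.1 + l * y.1)| <= (1 - l) * dl ->
  `|x.2 - ((1 - l) * z0.2 + l * y.2)| <= (1 - l) * dl -> D x.

Let Doo : (nu D < +oo)%E := area_measure_bounded mD DN.

(** The offset 2 keeps the ratio at least 1/2 for every n, whence lam^-2 <= 4 later. [eps n] is the
    margin (1 - lam n) * dl granted by [shrink]. *)
Definition lam (n : nat) : R := 1 - n.+2%:R^-1.
Definition eps (n : nat) : R := dl / n.+2%:R.

Lemma eps_gt0 n : 0 < eps n. Proof. by rewrite divr_gt0. Qed.

Lemma lam_ge n : 1 / 2 <= lam n.
Proof.
rewrite /lam; have : (n.+2%:R^-1 : R) <= 2^-1.
  by rewrite lef_pV2 ?posrE// ler_nat.
move: (_^-1) => a; lra.
Qed.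

Lemma lam_lt1 n : lam n < 1.
Proof. by rewrite /lam ltrBlDr ltrDl invr_gt0. Qed.

Lemma lam_gt0 n : 0 < lam n.
Proof. have := lam_ge n; lra. Qed.

Lemma epsE n : eps n = (1 - lam n) * dl.
Proof. by rewrite /eps /lam opprB addrC subrK mulrC. Qed.

(* (cen1 n y, cen2 n y) is the image of y under the homothety of center z0 and
   ratio lam n; by [shrink], the box of radius eps n around it lies in D. *)
Definition cen1 n (y : R * R) := (1 - lam n) * z0.1 + lam n * y.1.
Definition cen2 n (y : R * R) := (1 - lam n) * z0.2 + lam n * y.2.

Definition rho n (x y : R * R) :=
  mol (eps n) (cen1 n y) x.1 * mol (eps n) (cen2 n y) x.2.

Lemma rho_ge0 n x y : 0 <= rho n x y.
Proof. by rewrite mulr_ge0 ?mol_ge0 ?eps_gt0. Qed.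

Lemma rho_out n x y :
  eps n <= `|x.1 - cen1 n y| \/ eps n <= `|x.2 - cen2 n y| -> rho n x y = 0.
Proof.
by rewrite /rho => -[h|h]; rewrite (mol_out (eps_gt0 n) h) ?mul0r ?mulr0.
Qed.

Lemma rho_supp n x y : D y -> rho n x y != 0 -> D x.
Proof.
move=> Dy r0; have [h1|h1] := leP (eps n) `|x.1 - cen1 n y|.
  by rewrite rho_out ?eqxx// in r0; left.
have [h2|h2] := leP (eps n) `|x.2 - cen2 n y|.
  by rewrite rho_out ?eqxx// in r0; right.
have l1 := lam_lt1 n; have l0 := ltW (lam_gt0 n).
by apply: (shrink l0 l1 Dy); rewrite -epsE ltW.
Qed.

Lemma rho_measurable n :
  measurable_fun [set: (T * T) * (T * T)] (fun z => rho n z.1 z.2).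
Proof.
have mm := continuous_measurable2 (@mol_continuous2 R (eps n)).
apply: measurable_funM.
  apply: (@measurableT_comp _ _ _ _ _ _ _ _ (fun z : (T * T) * (T * T) => (cen1 n z.2, z.1.1) : T * T) mm).
  apply/measurable_fun_pair => /=; last exact: measurableT_comp.
  by apply: measurable_funD => //; apply: measurable_funM => //; exact: measurableT_comp.
apply: (@measurableT_comp _ _ _ _ _ _ _ _ (fun z : (T * T) * (T * T) => (cen2 n z.2, z.1.2) : T * T) mm).
apply/measurable_fun_pair => /=; last exact: measurableT_comp.
by apply: measurable_funD => //; apply: measurable_funM => //; exact: measurableT_comp.
Qed.

Lemma rho_bounded n : exists M, forall x y, `|rho n x y| <= M.
Proof.
have [M hM] := mol_bounded (eps_gt0 n).
by exists (M * M) => x y; rewrite normrM ler_pM.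
Qed.

Local Notation kap := (@bump_mass R * bump_mass).

Lemma integral_rho_x n y : (\int[nu]_x (rho n x y)%:E = kap%:E)%E.
Proof.
apply: (@ge0_integral_tensor R (mol (eps n) (cen1 n y)) (mol (eps n) (cen2 n y))).
- exact: smooth_gen_continuous (mol_smooth _ _).
- exact: smooth_gen_continuous (mol_smooth _ _).
- by move=> x; rewrite mol_ge0 ?eps_gt0.
- by move=> x; rewrite mol_ge0 ?eps_gt0.
- exact: integral_mol (eps_gt0 n).
- exact: integral_mol (eps_gt0 n).
Qed.

Lemma integral_rho_y n x :
  (\int[nu]_y (rho n x y)%:E = ((bump_mass / lam n) * (bump_mass / lam n))%:E)%E.
Proof.
apply: (@ge0_integral_tensor R
  (fun t => mol (eps n) ((1 - lam n) * z0.1 + lam n * t) x.1)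
  (fun t => mol (eps n) ((1 - lam n) * z0.2 + lam n * t) x.2)).
- exact: smooth_gen_continuous (mol_center_smooth _ _ _ _).
- exact: smooth_gen_continuous (mol_center_smooth _ _ _ _).
- by move=> t; rewrite mol_ge0 ?eps_gt0.
- by move=> t; rewrite mol_ge0 ?eps_gt0.
- exact: integral_mol_center (eps_gt0 n) (lam_gt0 n).
- exact: integral_mol_center (eps_gt0 n) (lam_gt0 n).
Qed.

Lemma rho_sectionx n y : measurable_fun [set: T * T] (fun x => rho n x y).
Proof. exact: (measurableT_comp (rho_measurable n) (pair2_measurable y)). Qed.

Lemma rho_sectiony n x : measurable_fun [set: T * T] (fun y => rho n x y).
Proof. exact: (measurableT_comp (rho_measurable n) (pair1_measurable x)). Qed.

Let one_int : nu.-integrable D (EFin \o (fun=> 1)).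
Proof. exact: integrable_cstR. Qed.

Let rho_mul_int n (f : R * R -> R) : nu.-integrable D (EFin \o f) ->
  (forall x, nu.-integrable D (EFin \o (fun y => f y * rho n x y))) /\
  (forall y, nu.-integrable D (EFin \o (fun x => f x * rho n x y))).
Proof.
move=> fi; have [M hM] := rho_bounded n.
split=> u; apply: (@integrable_bounded_mul _ _ _ nu D M mD) => //.
  by apply: measurable_funTS; exact: rho_sectiony.
by apply: measurable_funTS; exact: rho_sectionx.
Qed.

(** The total mass in [y] is kap / lam^2, whence the factor 4. This bound and the bound kap on the
    mass in [x] are the two halves of a Schur test for the kernel, which gives [reg_energy]. *)
Lemma Rintegral_rho_y n x : \int[nu]_(y in D) rho n x y <= 4 * kap.
Proof.
have ir : nu.-integrable D (EFin \o (fun y => rho n x y)).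
  by have [+ _] := rho_mul_int n one_int => /(_ x); under eq_fun do rewrite mul1r.
rewrite -lee_fin /Rintegral fineK; last exact: integrable_fin_num.
apply: (@le_trans _ _ (\int[nu]_y (rho n x y)%:E)%E).
  apply: ge0_subset_integral => //.
  - by apply/measurable_EFinP; exact: rho_sectiony.
  - by move=> y _; rewrite lee_fin rho_ge0.
rewrite integral_rho_y lee_fin mulrACA [4 * _]mulrC ler_wpM2l//.
  by rewrite -expr2 sqr_ge0.
have h : (lam n)^-1 <= 2.
  by rewrite -[leRHS]invrK lef_pV2 ?posrE ?lam_gt0//; have := lam_ge n; lra.
have -> : (4 : R) = 2 * 2 by ring.
by rewrite ler_pM// invr_ge0 ltW// lam_gt0.
Qed.

Lemma Rintegral_rho_x n y (A : set (T * T)) : measurable A ->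
  0 <= \int[nu]_(x in D) (\1_A x * rho n x y) <= kap.
Proof.
move=> mA; have iA : nu.-integrable D (EFin \o \1_A).
  apply: (sqint_integrable1 mD Doo); apply: (bounded_sqint mD Doo (M := 1)).
    exact: measurable_indic.
  by move=> x _; rewrite indicE ger0_norm// lern1; case: (_ \in _).
have [_ /(_ y) ir] := rho_mul_int n iA.
apply/andP; split; first by apply: Rintegral_ge0 => x _; rewrite mulr_ge0 ?rho_ge0// indicE.
rewrite -lee_fin /Rintegral fineK; last exact: integrable_fin_num.
rewrite -(integral_rho_x n y).
apply: (@le_trans _ _ (\int[nu]_(x in D) (rho n x y)%:E)%E).
  apply: ge0_le_integral => //.
  - by move=> x _; rewrite lee_fin mulr_ge0 ?rho_ge0// indicE.
  - by case/integrableP : ir.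
  - by apply/measurable_EFinP; apply: measurable_funTS; exact: rho_sectionx.
  - move=> x _; rewrite lee_fin; apply: ler_piMl; first exact: rho_ge0.
    by rewrite indicE lern1; case: (x \in A).
apply: ge0_subset_integral => //.
- by apply/measurable_EFinP; exact: rho_sectionx.
- by move=> x _; rewrite lee_fin rho_ge0.
Qed.

Let k n (z : (T * T) * (T * T)) := rho n z.1 z.2.
Let k' n (z : (T * T) * (T * T)) := rho n z.2 z.1.

Let mk' n : measurable_fun setT (k' n).
Proof.
apply: (@measurableT_comp _ _ _ _ _ _ _ _ (fun z : (T * T) * (T * T) => (z.2, z.1)) (rho_measurable n)).
by apply/measurable_fun_pair.
Qed.

Lemma rho_fubini n (a b : R * R -> R) :
  nu.-integrable D (EFin \o a) -> nu.-integrable D (EFin \o b) ->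
  \int[nu]_(x in D) (a x * \int[nu]_(y in D) (b y * rho n x y)) =
  \int[nu]_(y in D) (b y * \int[nu]_(x in D) (a x * rho n x y)).
Proof.
move=> ia ib; have [M hM] := rho_bounded n.
exact: (@kernel_fubini R _ _ (@area_sigma R) D mD a b (k n) M ia ib (rho_measurable n) (fun z => hM _ _)).
Qed.

Lemma rho_measurable_x n (b : R * R -> R) : nu.-integrable D (EFin \o b) ->
  measurable_fun D (fun x => \int[nu]_(y in D) (b y * rho n x y)).
Proof.
move=> ib; have [M hM] := rho_bounded n.
have := @kernel_fubini_measurable R _ _ (@area_sigma R) D mD (fun=> 1) b (k n) M one_int ib (rho_measurable n) (fun z => hM _ _).
by under eq_fun do rewrite mul1r.
Qed.

Lemma rho_measurable_y n (a : R * R -> R) : nu.-integrable D (EFin \o a) ->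
  measurable_fun D (fun y => \int[nu]_(x in D) (a x * rho n x y)).
Proof.
move=> ia; have [M hM] := rho_bounded n.
have := @kernel_fubini_measurable R _ _ (@area_sigma R) D mD (fun=> 1) a (k' n) M one_int ia (mk' n) (fun z => hM _ _).
by under eq_fun do rewrite mul1r.
Qed.

Definition box_nbhs (A : set (R * R)) (y : R * R) :=
  exists2 e, 0 < e & forall x, `|x.1 - y.1| < e -> `|x.2 - y.2| < e -> A x.

(** Where the kernel is nonzero, each coordinate of x - y is less in absolute value than eps n + (1
    - lam n) |z0 - y| = (dl + |z0 - y|) / (n + 2), taken coordinatewise, and this tends to 0. *)
Lemma rho_supp_near (A : set (R * R)) y : box_nbhs A y ->
  \forall n \near \oo, forall x, rho n x y != 0 -> A x.
Proof.
move=> [e e0 yA]; pose C := dl + `|z0.1 - y.1| + `|z0.2 - y.2|.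
exists (Num.truncn (C / e)) => // n /= nC x r0.
have Ce : C < n.+2%:R * e.
  by rewrite -ltr_pdivrMr// (lt_le_trans (truncnS_gt _))// ler_nat; exact: leqW.
have n0 : 0 < (n.+2%:R : R) by [].
have E t : n.+2%:R * (eps n + (1 - lam n) * t) = dl + t.
  by rewrite /eps /lam; field; rewrite gt_eqF.
have H (u v w : R) : `|u - ((1 - lam n) * v + lam n * w)| < eps n ->
    dl + `|v - w| <= C -> `|u - w| < e.
  move=> h1 h2; rewrite -(ltr_pM2l n0); apply: le_lt_trans Ce; apply: le_trans h2.
  rewrite -E ler_pM2l//.
  have -> : u - w = (u - ((1 - lam n) * v + lam n * w)) + (1 - lam n) * (v - w) by ring.
  rewrite (le_trans (ler_normD _ _))// lerD ?(ltW h1)// normrM ger0_norm//.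
  by rewrite subr_ge0 ltW// lam_lt1.
apply: yA.
- apply: (H _ z0.1); last by rewrite /C lerDl.
  by rewrite ltNge; apply: contra r0 => h; rewrite rho_out//; left.
- apply: (H _ z0.2); last by rewrite /C addrAC lerDl.
  by rewrite ltNge; apply: contra r0 => h; rewrite rho_out//; right.
Qed.

(** The sequence is eventually constant: the support in [x] always lies in [D], and for large n also
    in [A], so the integral is the full mass of the kernel. *)
Lemma rho_indic_cvg1 (A : set (R * R)) y : D y -> box_nbhs A y ->
  \int[nu]_(x in D) (\1_A x * rho n x y) @[n --> \oo] --> kap.
Proof.
move=> Dy /rho_supp_near h; apply: cvg_near_cst; apply: filterS h => n nA.
rewrite Rintegral_mkcond -[RHS]/(fine kap%:E) -(integral_rho_x n y).
congr fine; apply: eq_integral => x _; rewrite patchE.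
have [r0|r0] := eqVneq (rho n x y) 0.
  by rewrite r0 mulr0; case: ifP.
by rewrite (mem_set (rho_supp Dy r0)) indicE (mem_set (nA x r0)) mul1r.
Qed.

Lemma rho_indic_cvg0 (A : set (R * R)) y : D y -> box_nbhs (~` A) y ->
  \int[nu]_(x in D) (\1_A x * rho n x y) @[n --> \oo] --> (0 : R).
Proof.
move=> Dy /rho_supp_near h; apply: cvg_near_cst; apply: filterS h => n nA.
rewrite /Rintegral integral0_eq// => x _.
have [->|r0] := eqVneq (rho n x y) 0; first by rewrite mulr0.
by rewrite indicE (memNset (nA x r0)) mul0r.
Qed.

Section regularization.
Variable h : R * R -> R.
Hypothesis sh : sqint nu D h.
Let ih := sqint_integrable1 mD Doo sh.
Let ih2 := sqint_integrable sh.

(** The average is over [y], whereas concentration of the kernel was established for integration in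
    [x]. The convergence of [reg] is therefore obtained weakly, moving the kernel to the test
    function by Fubini. *)
Definition reg n (x : R * R) := \int[nu]_(y in D) (h y * rho n x y).

Let kap0 : 0 < 4 * kap.
Proof. by rewrite mulr_gt0// mulr_gt0// bump_mass_gt0. Qed.

(** Cauchy-Schwarz for the measure [rho n x y] dy, of mass at most S = 4 kap, obtained by expanding
    the nonnegative integral of (h - t)^2 against it. *)
Lemma reg_sqr_le n x :
  reg n x ^+ 2 <= 4 * kap * \int[nu]_(y in D) (h y ^+ 2 * rho n x y).
Proof.
have [i1 _] := rho_mul_int n one_int; have [i2 _] := rho_mul_int n ih.
have [i3 _] := rho_mul_int n ih2.
have mle : \int[nu]_(y in D) (1 * rho n x y) <= 4 * kap.
  by under eq_Rintegral do rewrite mul1r; exact: Rintegral_rho_y.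
have S0 := kap0; set S := 4 * kap in S0 mle *; set H := reg n x.
set Q := \int[nu]_(y in D) (h y ^+ 2 * rho n x y).
set m := \int[nu]_(y in D) (1 * rho n x y) in mle.
(* Dividing by the upper bound [S] avoids the mass [m], which vanishes for [x] far from [D]; m <= S
   is enough for the estimate. *)
pose t := H / S.
have : 0 <= \int[nu]_(y in D) ((h y - t) ^+ 2 * rho n x y).
  by apply: Rintegral_ge0 => y _; rewrite mulr_ge0 ?sqr_ge0 ?rho_ge0.
have -> : \int[nu]_(y in D) ((h y - t) ^+ 2 * rho n x y) = Q - 2 * t * H + t ^+ 2 * m.
  rewrite /Q /H /reg /m -!RintegralZl// -RintegralB//; last exact: integrableRZ.
  rewrite -RintegralD//; [|exact/integrableRB/integrableRZ|exact: integrableRZ].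
  by apply: eq_Rintegral => y _; ring.
have tm : t ^+ 2 * m <= t ^+ 2 * S by rewrite ler_wpM2l// sqr_ge0.
have -> : H ^+ 2 = S * (2 * t * H - t ^+ 2 * S) by rewrite /t; field; rewrite gt_eqF.
by move=> h0; rewrite ler_pM2l//; lra.
Qed.

Let int_bound_n n : exists M, forall x, `|reg n x| <= M.
Proof.
have [M hM] := rho_bounded n; have [i2 _] := rho_mul_int n ih.
exists (\int[nu]_(y in D) (M * `|h y|)) => x.
have inh : nu.-integrable D (EFin \o (fun y => `|h y|)) := integrable_norm ih.
rewrite (le_trans (le_normr_Rintegral mD (i2 x)))//; apply: le_Rintegral => //.
- exact: integrable_norm (i2 x).
- exact: integrableRZ.
- by move=> y _; rewrite normrM mulrC ler_wpM2r.
Qed.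

Lemma reg_sqint n : sqint nu D (reg n).
Proof.
have [M hM] := int_bound_n n.
by apply: (bounded_sqint mD Doo (M := M)) => //; exact: rho_measurable_x.
Qed.

(** Integrate [reg_sqr_le] in [x] and exchange the integrals; the mass of the kernel in [x] is at
    most kap. *)
Lemma reg_energy n :
  \int[nu]_(x in D) (reg n x ^+ 2) <= 4 * kap * (kap * \int[nu]_(y in D) (h y ^+ 2)).
Proof.
have [M hM] := rho_bounded n.
have [_ i1] := rho_mul_int n one_int; have [i3 _] := rho_mul_int n ih2.
pose Q x := \int[nu]_(y in D) (h y ^+ 2 * rho n x y).
have Q0 x : 0 <= Q x by apply: Rintegral_ge0 => y _; rewrite mulr_ge0 ?sqr_ge0 ?rho_ge0.
have iQ : nu.-integrable D (EFin \o Q).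
  apply: (sqint_integrable1 mD Doo).
  apply: (bounded_sqint mD Doo (M := \int[nu]_(y in D) (M * h y ^+ 2))).
    exact: rho_measurable_x.
  move=> x _; rewrite ger0_norm//; apply: le_Rintegral => //; first exact: integrableRZ.
  by move=> y _; rewrite mulrC ler_wpM2r ?sqr_ge0// (le_trans (ler_norm _)).
rewrite (@le_trans _ _ (\int[nu]_(x in D) (4 * kap * Q x)))//.
  apply: le_Rintegral => //.
  - exact: sqint_integrable (reg_sqint n).
  - exact: integrableRZ.
  - by move=> x _; exact: reg_sqr_le.
rewrite RintegralZl// ler_pM2l// (_ : \int[nu]_(x in D) Q x = \int[nu]_(x in D) (1 * Q x)); last first.
  by apply: eq_Rintegral => x _; rewrite mul1r.
rewrite rho_fubini// -RintegralZl//; apply: le_Rintegral => //.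
- apply: (@integrable_bounded_mul _ _ _ nu D kap mD) => //; first exact: rho_measurable_y.
  move=> y _; have := Rintegral_rho_x n y measurableT.
  under eq_Rintegral do rewrite indicT.
  by move=> /andP[a b]; rewrite ger0_norm.
- exact: integrableRZ.
- move=> y _; rewrite mulrC ler_wpM2r ?sqr_ge0//.
  have := Rintegral_rho_x n y measurableT.
  under eq_Rintegral do rewrite indicT.
  by move=> /andP[a b].
Qed.

(** After Fubini the kernel acts on the indicator: its average in [x] tends to kap times the
    indicator at every [y] off the boundary of [A], and kap |h| dominates. *)
Lemma reg_indic_cvg (A : set (T * T)) : measurable A ->
  {ae nu, forall y, D y -> box_nbhs A y \/ box_nbhs (~` A) y} ->
  \int[nu]_(x in D) (\1_A x * reg n x) @[n --> \oo] -->
  kap * \int[nu]_(x in D) (\1_A x * h x).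
Proof.
move=> mA aeA; have sA : sqint nu D \1_A.
  apply: (bounded_sqint mD Doo (M := 1)); first exact: measurable_indic.
  by move=> x _; rewrite indicE ger0_norm// lern1; case: (_ \in _).
have iA := sqint_integrable1 mD Doo sA.
have iAh := sqintM mD sA sh.
rewrite -RintegralZl//.
apply: (eq_cvg_to (fun n => esym (rho_fubini n iA ih))).
have mh : measurable_fun D h by case: sh.
apply: (@dominated_convergenceR _ _ _ _ _ mD _ _ (fun y => kap * `|h y|)).
- by move=> n; apply: measurable_funM => //; exact: rho_measurable_y.
- by apply: measurable_funM => //; apply: measurable_funM => //; exact: measurable_indic.
- apply: filterS aeA => y yA Dy.
  have -> : kap * (\1_A y * h y) = h y * (\1_A y * kap) by ring.
  apply: cvgM; first exact: cvg_cst.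
  have [Ay|Ay] := yA Dy; have [e e0 ye] := Ay.
    have -> : \1_A y = 1 :> R.
      by rewrite indicE mem_set//; apply: ye; rewrite subrr normr0.
    by rewrite mul1r; exact: rho_indic_cvg1.
  have -> : \1_A y = 0 :> R.
    by rewrite indicE memNset//; apply: ye; rewrite subrr normr0.
  by rewrite mul0r; exact: rho_indic_cvg0.
- by apply: integrableRZ => //; exact: integrable_norm ih.
- move=> n y _; rewrite normrM mulrC ler_wpM2r//.
  by have /andP[a b] := Rintegral_rho_x n y mA; rewrite ger0_norm.
Qed.

Lemma quadrant_boundary (a b : R) :
  {ae nu, forall y, D y ->
    box_nbhs (`]-oo, a[ `*` `]-oo, b[) y \/ box_nbhs (~` (`]-oo, a[ `*` `]-oo, b[)) y}.
Proof.
pose L1 : set (T * T) := [set a] `*` setT; pose L2 : set (T * T) := setT `*` [set b].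
have m1 : measurable L1 by exact: measurableX.
have m2 : measurable L2 by exact: measurableX.
exists (L1 `|` L2); split; first exact: measurableU.
- rewrite null_set_setU//.
  + have -> : nu L1 = (mu [set a] * mu setT)%E by exact: product_measure1E.
    by rewrite lebesgue_measure_set1 mul0e.
  + have -> : nu L2 = (mu setT * mu [set b])%E by exact: product_measure1E.
    by rewrite lebesgue_measure_set1 mule0.
move=> y /=; apply: contra_notP => /not_orP[n1 n2] _.
have ya : y.1 != a by apply/eqP => ya; apply: n1; split.
have yb : y.2 != b by apply/eqP => yb; apply: n2; split.
move: ya; rewrite neq_lt => /orP[ya|ya]; last first.
  right; exists (y.1 - a); first by rewrite subr_gt0.
  by move=> x x1 x2 [/=]; rewrite in_itv/= => xa _; move: x1; rewrite ltr_norml => /andP[]; lra.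
move: yb; rewrite neq_lt => /orP[yb|yb]; last first.
  right; exists (y.2 - b); first by rewrite subr_gt0.
  by move=> x x1 x2 [/= _]; rewrite in_itv/= => xa; move: x2; rewrite ltr_norml => /andP[]; lra.
left; exists (Num.min (a - y.1) (b - y.2)); first by rewrite lt_min !subr_gt0 ya.
move=> x; rewrite !lt_min !ltr_norml => /andP[/andP[_ h1] _] /andP[_ /andP[_ h2]].
by split; rewrite /= in_itv/=; lra.
Qed.

(** [weak_convergence_sqint] is applied to reg n - kap h, bounded in L^2 by (u - v)^2 <= 2 u^2 + 2
    v^2 and [reg_energy]. *)
Lemma reg_weak_cvg g : sqint nu D g ->
  \int[nu]_(x in D) (g x * reg n x) @[n --> \oo] --> kap * \int[nu]_(x in D) (g x * h x).
Proof.
move=> sg; pose K n x := reg n x - kap * h x.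
have skh : sqint nu D (fun x => kap * h x) by exact: sqintZ.
have sK n : sqint nu D (K n) by apply: sqintB => //; exact: reg_sqint.
pose I := \int[nu]_(y in D) (h y ^+ 2).
have split_int f n : sqint nu D f -> \int[nu]_(x in D) (f x * K n x) =
    \int[nu]_(x in D) (f x * reg n x) - kap * \int[nu]_(x in D) (f x * h x).
  move=> sf; have i1 := sqintM mD sf (reg_sqint n); have i2 := sqintM mD sf sh.
  rewrite -RintegralZl// -RintegralB//; last exact: integrableRZ.
  by apply: eq_Rintegral => x _; rewrite /K; ring.
have KM n : \int[nu]_(x in D) (K n x ^+ 2) <=
    2 * (4 * kap * (kap * I)) + 2 * (kap ^+ 2 * I).
  have i1 := sqint_integrable (reg_sqint n).
  apply: (@le_trans _ _ (2 * \int[nu]_(x in D) (reg n x ^+ 2) + 2 * (kap ^+ 2 * I))).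
    have i2 := integrableRZ mD (kap ^+ 2) ih2.
    have i3 := integrableRZ mD 2 i1; have i4 := integrableRZ mD 2 i2.
    rewrite /I -(RintegralZl _ mD ih2) -(RintegralZl _ mD i1) -(RintegralZl _ mD i2).
    rewrite -(RintegralD mD i3 i4).
    apply: le_Rintegral => //.
    - exact: sqint_integrable (sK n).
    - exact: integrableRD.
    - move=> x _; rewrite /K -subr_ge0.
      rewrite (_ : _ - _ = (reg n x + kap * h x) ^+ 2); first exact: sqr_ge0.
      by ring.
  by rewrite lerD2r ler_pM2l// reg_energy.
have ind_cvg A : measurable A ->
    {ae nu, forall y, D y -> box_nbhs A y \/ box_nbhs (~` A) y} ->
    \int[nu]_(x in D) (\1_A x * K n x) @[n --> \oo] --> (0 : R).
  move=> mA aeA; have sA : sqint nu D \1_A.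
    apply: (bounded_sqint mD Doo (M := 1)); first exact: measurable_indic.
    by move=> x _; rewrite indicE ger0_norm// lern1; case: (_ \in _).
  have c := reg_indic_cvg mA aeA.
  rewrite -[X in _ --> X](subrr (kap * \int[nu]_(x in D) (\1_A x * h x))).
  by apply: (eq_cvg_to (fun n => esym (split_int _ n sA))); apply: cvgB => //; exact: cvg_cst.
have := @weak_convergence_sqint _ _ _ nu D mD Doo K _ sK KM quadrants
  (@quadrants_measurable R) (@quadrants_setI R) _ _ g sg.
move=> H; have {}H : \int[nu]_(x in D) (g x * K n x) @[n --> \oo] --> (0 : R).
  apply: H.
    by move=> _ [a [b ->]]; apply: ind_cvg; [exact: measurableX|exact: quadrant_boundary].
  have aeT : {ae nu, forall y : T * T, D y -> box_nbhs setT y \/ box_nbhs (~` setT) y}.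
    by apply: aeW => y _; left; exists 1.
  apply: (eq_cvg_to _ (ind_cvg setT measurableT aeT)) => n.
  by apply: eq_Rintegral => x _; rewrite indicT mul1r.
have -> : kap * \int[nu]_(x in D) (g x * h x) = 0 + kap * \int[nu]_(x in D) (g x * h x).
  by rewrite add0r.
apply: (eq_cvg_to _ (cvgD H (cvg_cst (kap * \int[nu]_(x in D) (g x * h x))))) => n.
by rewrite fctE split_int// subrK.
Qed.

End regularization.

End mollification.

(** * Weak gradients orthogonal to all C^1 gradients *)

Section gradient_uniqueness.
Context {R : realType}.
Local Notation mu := (@lebesgue_measure R).
Local Notation T := (measurableTypeR R).
Local Notation nu := (@area_measure R).
Variables (D : set (T * T)) (N : R).
Hypothesis mD : measurable D.
Hypothesis DN : forall x : T * T, D x -> `|x.1| <= N /\ `|x.2| <= N.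
Variables (z0 : R * R) (dl : R).
Hypothesis dl0 : 0 < dl.
Hypothesis shrink : forall (l : R) (x y : R * R), 0 <= l -> l < 1 -> D y ->
  `|x.1 - ((1 - l) * z0.1 + l * y.1)| <= (1 - l) * dl ->
  `|x.2 - ((1 - l) * z0.2 + l * y.2)| <= (1 - l) * dl -> D x.
Local Notation rho := (rho z0 dl).
Local Notation eps := (eps dl).
Local Notation cen1 := (cen1 z0).
Local Notation cen2 := (cen2 z0).

(** The closure of the support lies in the closed box of half-width [eps n]. The non-strict
    inequalities in [shrink] put this closed box inside [D]. *)
Lemma rho_test n y : D y -> test_function D (fun x => rho n x y).
Proof.
move=> Dy; have e0 := eps_gt0 dl0 n.
set f := fun x => rho n x y.
pose B : set (R * R) := `[cen1 n y - eps n, cen1 n y + eps n] `*`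
  `[cen2 n y - eps n, cen2 n y + eps n].
have cB : compact B by apply: compact_setX; exact: segment_compact.
have clB : closed B by apply: compact_closed cB; exact: norm_hausdorff.
have itvE (c t : R) : (c - eps n <= t <= c + eps n) = (`|t - c| <= eps n).
  by rewrite ler_distl.
have fB : [set x | f x != 0] `<=` B.
  move=> x fx; split; rewrite /= in_itv/= itvE leNgt; apply: contra fx => /ltW h.
    by rewrite /f rho_out//; left.
  by rewrite /f rho_out//; right.
have sB : closure [set x | f x != 0] `<=` B.
  by rewrite ((closure_id B).1 clB); exact: closure_subset.
split.
- exact: (tensor_smooth (mol_smooth (eps n) (cen1 n y)) (mol_smooth (eps n) (cen2 n y))).
- exact: (subclosed_compact (closed_closure (A:=_)) cB sB).
- move=> x /sB[/=]; rewrite !in_itv/= !itvE (epsE dl n) => h1 h2.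
  exact: (shrink (ltW (lam_gt0 n)) (lam_lt1 n) Dy h1 h2).
Qed.

Variables (dmol : R -> R -> R -> R).
Hypothesis dmolP : forall e c s : R, is_derive s 1 (mol e c) (dmol e c s).
Hypothesis dmol_cen : forall e a l s t : R,
  is_derive t 1 (fun t => mol e (a + l * t) s) (- l * dmol e (a + l * t) s).
Hypothesis dmol_bounded : forall e, exists M, forall c s, `|dmol e c s| <= M.
Hypothesis dmol_cont : forall e, continuous (fun z : R * R => dmol e z.1 z.2).

Let krho (i : bool) n (x y : R * R) :=
  if i then mol (eps n) (cen1 n y) x.1 * dmol (eps n) (cen2 n y) x.2
  else dmol (eps n) (cen1 n y) x.1 * mol (eps n) (cen2 n y) x.2.

Let partial_rho n i x y : partial i (fun x => rho n x y) x = krho i n x y.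
Proof.
case: i; rewrite /partial.
  have h := @is_derive_tensorT R (mol (eps n) (cen1 n y)) (mol (eps n) (cen2 n y))
    (dmol (eps n) (cen2 n y)) x (dmolP _ _ _).
  by have [_ E] := h; exact: E.
have h := @is_derive_tensorF R (mol (eps n) (cen1 n y)) (mol (eps n) (cen2 n y))
    (dmol (eps n) (cen1 n y)) x (dmolP _ _ _).
by have [_ E] := h; exact: E.
Qed.

Let partial_rho_center n i x y :
  partial i (fun y => rho n x y) y = - @lam R n * krho i n x y.
Proof.
case: i; rewrite /partial.
  have h := @is_derive_tensorT R
    (fun t => mol (eps n) ((1 - (@lam R n)) * z0.1 + @lam R n * t) x.1)
    (fun t => mol (eps n) ((1 - (@lam R n)) * z0.2 + @lam R n * t) x.2)
    (fun t => - @lam R n * dmol (eps n) ((1 - (@lam R n)) * z0.2 + @lam R n * t) x.2) y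
    (dmol_cen _ _ _ _ _).
  have [_ E] := h; rewrite [LHS]E /tensor /krho /cen1 /cen2; ring.
have h := @is_derive_tensorF R
    (fun t => mol (eps n) ((1 - (@lam R n)) * z0.1 + @lam R n * t) x.1)
    (fun t => mol (eps n) ((1 - (@lam R n)) * z0.2 + @lam R n * t) x.2)
    (fun t => - @lam R n * dmol (eps n) ((1 - (@lam R n)) * z0.1 + @lam R n * t) x.1) y
    (dmol_cen _ _ _ _ _).
have [_ E] := h; rewrite [LHS]E /tensor /krho /cen1 /cen2; ring.
Qed.

Let rho_center_C1 n x : C1 (fun y => rho n x y).
Proof.
exact: (tensor_smooth (mol_center_smooth (eps n) ((1 - (@lam R n)) * z0.1) (@lam R n) x.1)
  (mol_center_smooth (eps n) ((1 - (@lam R n)) * z0.2) (@lam R n) x.2) [::]).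
Qed.

Let krho_measurable i n :
  measurable_fun [set: (T * T) * (T * T)] (fun z => krho i n z.1 z.2).
Proof.
have mm := continuous_measurable2 (@mol_continuous2 R (eps n)).
have md := continuous_measurable2 (@dmol_cont (eps n)).
have m1 : measurable_fun setT (fun z : (T * T) * (T * T) => (cen1 n z.2, z.1.1) : T * T).
  apply/measurable_fun_pair => /=; last exact: measurableT_comp.
  by apply: measurable_funD => //; apply: measurable_funM => //; exact: measurableT_comp.
have m2 : measurable_fun setT (fun z : (T * T) * (T * T) => (cen2 n z.2, z.1.2) : T * T).
  apply/measurable_fun_pair => /=; last exact: measurableT_comp.
  by apply: measurable_funD => //; apply: measurable_funM => //; exact: measurableT_comp.
case: i; apply: measurable_funM.
- exact: (measurableT_comp mm m1).
- exact: (measurableT_comp md m2).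
- exact: (measurableT_comp md m1).
- exact: (measurableT_comp mm m2).
Qed.

Let krho_bounded i n : exists M, forall x y, `|krho i n x y| <= M.
Proof.
have [M hM] := mol_bounded (eps_gt0 dl0 n); have [M' hM'] := dmol_bounded (eps n).
case: i.
  by exists (M * M') => x y; rewrite normrM ler_pM.
by exists (M' * M) => x y; rewrite normrM ler_pM.
Qed.

Variables (U : R * R -> R) (G : R * R -> R * R).
Hypothesis HU : H1 D U G.
Hypothesis GC1 : forall w, C1 w -> \int[nu]_(x in D) dot2 (G x) (grad w x) = 0.

Let Doo : (nu D < +oo)%E := area_measure_bounded mD DN.
Let sU : sqint nu D U. Proof. by case: HU. Qed.
Let iU := sqint_integrable1 mD Doo sU.
Let Gi (i : bool) x := if i then (G x).2 else (G x).1.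
Let sG i : sqint nu D (Gi i). Proof. by case: HU; case: i. Qed.
Let iG i := sqint_integrable1 mD Doo (sG i).

Let krho_fubini i n :
  \int[nu]_(x in D) (U x * \int[nu]_(y in D) (Gi i y * krho i n x y)) =
  \int[nu]_(y in D) (Gi i y * \int[nu]_(x in D) (U x * krho i n x y)).
Proof.
have [M hM] := krho_bounded i n.
exact: (@kernel_fubini R _ _ (@area_sigma R) D mD U (Gi i) (fun z => krho i n z.1 z.2) M
  iU (iG i) (krho_measurable i n) (fun z => hM _ _)).
Qed.

(** At fixed [y] in [D], the weak gradient of U is tested with the kernel as a function of [x]; the
    two uses of Fubini bring [x] inside for this step and back outside afterwards. *)
Let reg_energyE i n :
  \int[nu]_(x in D) (Gi i x * reg D z0 dl (Gi i) n x) =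
  - \int[nu]_(x in D) (U x * \int[nu]_(y in D) (Gi i y * krho i n x y)).
Proof.
rewrite (rho_fubini mD z0 dl0 n (iG i) (iG i)) krho_fubini.
rewrite -mulN1r -RintegralZl//; last first.
  have [M hM] := krho_bounded i n.
  pose k' (z : (T * T) * (T * T)) := krho i n z.2 z.1.
  have mk' : measurable_fun setT k'.
    have msw : measurable_fun setT (fun z : (T * T) * (T * T) => (z.2, z.1)).
      exact/measurable_fun_pair.
    exact: (measurableT_comp (krho_measurable i n) msw).
  exact: (@kernel_fubini_integrable R _ _ (@area_sigma R) D mD (Gi i) U k' M (iG i) iU mk' (fun z => hM _ _)).
apply: eq_Rintegral => y; rewrite inE => Dy; rewrite mulN1r -mulrN; congr (_ * _).
have [_ _ _ /(_ _ i (rho_test n Dy))] := HU.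
rewrite (_ : \int[nu]_(x in D) (U x * partial i (fun x => rho n x y) x) =
  \int[nu]_(x in D) (U x * krho i n x y)); last by apply: eq_Rintegral => x _; rewrite partial_rho.
by move=> ->; rewrite opprK.
Qed.

Let sum_energy0 n : \int[nu]_(x in D) (Gi false x * reg D z0 dl (Gi false) n x) +
  \int[nu]_(x in D) (Gi true x * reg D z0 dl (Gi true) n x) = 0.
Proof.
have ik i x : nu.-integrable D (EFin \o (fun y => Gi i y * krho i n x y)).
  have [M hM] := krho_bounded i n.
  have mk : measurable_fun D (fun y => krho i n x y).
    apply: measurable_funTS.
    exact: (measurableT_comp (krho_measurable i n) (pair1_measurable x)).
  exact: (@integrable_bounded_mul _ _ _ nu D M mD (Gi i) _ (iG i) mk (fun y _ => hM x y)).
(* G is orthogonal to grad_y rho = - lam * grad_x rho. *)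
have E x : \int[nu]_(y in D) (Gi false y * krho false n x y) =
    - \int[nu]_(y in D) (Gi true y * krho true n x y).
  apply/eqP; rewrite -addr_eq0 -RintegralD//; apply/eqP.
  have := GC1 (rho_center_C1 n x).
  rewrite (@eq_Rintegral _ _ _ nu D (fun y => - @lam R n * (Gi false y * krho false n x y + Gi true y * krho true n x y))).
    rewrite RintegralZl//; last exact: integrableRD.
    move=> /eqP; rewrite mulf_eq0 oppr_eq0 gt_eqF ?lam_gt0//= => /eqP.
    by [].
  move=> y _; rewrite /dot2 /grad /= !partial_rho_center /Gi /krho; ring.
rewrite !reg_energyE -opprD (@eq_Rintegral _ _ _ nu D (fun x =>
    -1 * (U x * \int[nu]_(y in D) (Gi true y * krho true n x y)))).
  rewrite RintegralZl// ?mulN1r ?addNr ?oppr0//.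
  have [M hM] := krho_bounded true n.
  exact: (@kernel_fubini_integrable R _ _ (@area_sigma R) D mD U (Gi true)
    (fun z => krho true n z.1 z.2) M iU (iG true) (krho_measurable true n) (fun z => hM _ _)).
by move=> x _; rewrite E; ring.
Qed.

Lemma weak_gradient_orthogonal_eq0 : \int[nu]_(x in D) (enorm (G x) ^+ 2) = 0.
Proof.
have c i := reg_weak_cvg mD DN dl0 shrink (sG i) (sG i).
have s0 : 0 = bump_mass * bump_mass * \int[nu]_(x in D) (Gi false x * Gi false x) +
    bump_mass * bump_mass * \int[nu]_(x in D) (Gi true x * Gi true x) :> R.
  have c2 : (fun _ : nat => 0 : R) n @[n --> \oo] -->
    bump_mass * bump_mass * \int[nu]_(x in D) (Gi false x * Gi false x) +
    bump_mass * bump_mass * \int[nu]_(x in D) (Gi true x * Gi true x).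
    exact: eq_cvg_to sum_energy0 (cvgD (c false) (c true)).
  have c3 : (fun _ : nat => 0 : R) n @[n --> \oo] --> (0 : R) by exact: cvg_cst.
  exact: cvg_unique c3 c2.
move: s0; rewrite -mulrDr -RintegralD//; [|exact: sqintM..].
move=> /esym/eqP; rewrite mulf_eq0 mulf_eq0 gt_eqF ?bump_mass_gt0//= => /eqP <-.
apply: eq_Rintegral => x _.
by rewrite /enorm sqr_sqrtr // /dot2 -!expr2 addr_ge0 ?sqr_ge0.
Qed.

End gradient_uniqueness.

(** * The value of [phi] on a triangle *)

Section phi_value.
Context {R : realType}.
Local Notation T := (measurableTypeR R).
Local Notation nu := (@area_measure R).
Variables A B C : R * R.
Hypothesis d0 : tri_det A B C != 0.
Local Notation Omega := (open_triangle A B C).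
Local Notation Gamma := (triangle_boundary A B C).

(** [z0] is the centroid, whose barycentric coordinates are all 1/3. [dl] is small enough for the
    first two to move by at most (1 - l) / 7 each, hence the third by at most 2 (1 - l) / 7, which
    is less than (1 - l) / 3. *)
Lemma triangle_shrink : exists z0 dl, 0 < dl /\
  forall (l : R) (x y : R * R), 0 <= l -> l < 1 -> Omega y ->
  `|x.1 - ((1 - l) * z0.1 + l * y.1)| <= (1 - l) * dl ->
  `|x.2 - ((1 - l) * z0.2 + l * y.2)| <= (1 - l) * dl -> Omega x.
Proof.
pose z0 := tri_map A B C (1 / 3, 1 / 3); pose D := tri_det A B C.
pose p := B.1 - A.1; pose q := C.1 - A.1; pose r := B.2 - A.2; pose s := C.2 - A.2.
(* [S] bounds the coefficient sums of both rows of the inverse matrix, up to the factor 1 / det; the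
   added 1 makes it positive. *)
pose S := `|p| + `|q| + (`|r| + `|s|) + 1.
have S0 : 0 < S by rewrite ltr_wpDl// !addr_ge0.
have D0 : 0 < `|D| by rewrite normr_gt0.
exists z0, (`|D| / S / 7); split; first by rewrite !divr_gt0.
move=> l x y l0 l1; rewrite !open_triangleE// => -[y1 y2 y12] h1 h2.
set e1 := x.1 - _ in h1; set e2 := x.2 - _ in h2.
have bnd (a b : R) : `|a| + `|b| <= S -> `|(a * e1 - b * e2) / D| <= (1 - l) / 7.
  move=> ab; rewrite normrM normfV ler_pdivrMr//.
  rewrite (le_trans (ler_normB _ _))// !normrM.
  have l1' : 0 <= (1 - l) * (`|D| / S / 7).
    by rewrite mulr_ge0 ?subr_ge0 ?(ltW l1)// !divr_ge0// ltW.
  rewrite (@le_trans _ _ ((`|a| + `|b|) * ((1 - l) * (`|D| / S / 7))))//.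
    by rewrite mulrDl lerD// ler_wpM2l.
  rewrite (le_trans (ler_wpM2r l1' ab))// le_eqVlt; apply/orP; left; apply/eqP.
  by field; rewrite gt_eqF.
have ge (a : R) := normr_ge0 a.
have m1 : `|(s * e1 - q * e2) / D| <= (1 - l) / 7.
  by apply: bnd; rewrite /S; have := ge p; have := ge r; lra.
have m2 : `|((- r) * e1 - (- p) * e2) / D| <= (1 - l) / 7.
  by apply: bnd; rewrite /S !normrN; have := ge q; have := ge s; lra.
have c1 : (tri_coord A B C x).1 = (1 - l) / 3 + l * (tri_coord A B C y).1 + (s * e1 - q * e2) / D.
  rewrite /tri_coord /= /s /q /e1 /e2 /z0 /tri_map /D /=.
  by move: d0; rewrite /tri_det => ?; field.
have c2 : (tri_coord A B C x).2 = (1 - l) / 3 + l * (tri_coord A B C y).2 + ((- r) * e1 - (- p) * e2) / D.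
  rewrite /tri_coord /= /r /p /e1 /e2 /z0 /tri_map /D /=.
  by move: d0; rewrite /tri_det => ?; field.
suff : [/\ 0 < (tri_coord A B C x).1, 0 < (tri_coord A B C x).2 &
    (tri_coord A B C x).1 + (tri_coord A B C x).2 < 1] by [].
rewrite c1 c2; move: m1 m2; rewrite !ler_norml => /andP[? ?] /andP[? ?].
have := mulr_ge0 l0 (ltW y1); have := mulr_ge0 l0 (ltW y2).
have : 0 <= l * (1 - ((tri_coord A B C y).1 + (tri_coord A B C y).2)).
  by rewrite mulr_ge0// subr_ge0 ltW.
by move=> *; split; lra.
Qed.

(** With g = G + grad s, the square of G integrates to 0 by the uniqueness argument, and the cross
    term vanishes because s is C^1 and G is orthogonal to C^1 gradients. *)
Lemma weak_solution_energy psi g : weak_solution Omega Gamma psi g ->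
  \int[nu]_(x in Omega) (enorm (g x) ^+ 2) = tri_energy A B C.
Proof.
move=> [Hpsi _ Epsi]; have [Hsol _ Esol] := sol_weak d0.
have mO := open_triangle_measurable d0.
set s := sol A B C in Hsol Esol *.
pose G x := g x - grad s x; pose U x := psi x - s x.
have [sp sg1 sg2 wp] := Hpsi; have [ss ss1 ss2 ws] := Hsol.
have sG1 : sqint nu Omega (fun x => (G x).1) := sqintB mO sg1 ss1.
have sG2 : sqint nu Omega (fun x => (G x).2) := sqintB mO sg2 ss2.
have HG : H1 Omega U G.
  split; [exact: (sqintB mO sp ss)|exact: sG1|exact: sG2|].
  move=> f i tf; have cf := test_function_C1 tf.
  have sf : sqint nu Omega f.
    by apply: (continuous_triangle_sqint d0); exact: C1_continuous.
  have sfi : sqint nu Omega (partial i f).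
    by apply: (continuous_triangle_sqint d0); have [] := cf i.
  rewrite (@eq_Rintegral _ _ _ nu Omega (fun x => psi x * partial i f x - s x * partial i f x)); last first.
    by move=> x _; rewrite mulrBl.
  have sgi : sqint nu Omega (fun x => if i then (g x).2 else (g x).1) by case: (i); [exact: sg2|exact: sg1].
  have ssi : sqint nu Omega (fun x => if i then (grad s x).2 else (grad s x).1) by case: (i); [exact: ss2|exact: ss1].
  rewrite (RintegralB mO (sqintM mO sp sfi) (sqintM mO ss sfi)).
  rewrite (wp _ _ tf) (ws _ _ tf) opprK addrC -opprB; congr (- _).
  rewrite -(RintegralB mO (sqintM mO sgi sf) (sqintM mO ssi sf)).
  by apply: eq_Rintegral => x _; case: (i); rewrite /= mulrBl.
have dotB (m : R * R -> R * R) : sqint nu Omega (fun x => (m x).1) ->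
    sqint nu Omega (fun x => (m x).2) ->
    \int[nu]_(x in Omega) dot2 (G x) (m x) =
    \int[nu]_(x in Omega) dot2 (g x) (m x) - \int[nu]_(x in Omega) dot2 (grad s x) (m x).
  move=> s1 s2.
  have i1 : nu.-integrable Omega (EFin \o (fun x => dot2 (g x) (m x))) :=
    integrableRD mO (sqintM mO sg1 s1) (sqintM mO sg2 s2).
  have i2 : nu.-integrable Omega (EFin \o (fun x => dot2 (grad s x) (m x))) :=
    integrableRD mO (sqintM mO ss1 s1) (sqintM mO ss2 s2).
  rewrite -(RintegralB mO i1 i2).
  by apply: eq_Rintegral => x _; rewrite /G; move: (g x) (grad s x) => u v; rewrite /dot2 /=; ring.
have GC1 w : C1 w -> \int[nu]_(x in Omega) dot2 (G x) (grad w x) = 0.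
  move=> cw; have [N hN] := open_triangle_bounded A B C.
  have Hw := C1_H1 mO hN cw; have tw := C1_is_trace A B C cw.
  have [_ w1 w2 _] := Hw.
  by rewrite (dotB (grad w) w1 w2) (Epsi _ _ _ Hw tw) (Esol _ _ _ Hw tw) subrr.
have G0 : \int[nu]_(x in Omega) (enorm (G x) ^+ 2) = 0.
  have [z0 [dl [dl0 shrink]]] := triangle_shrink.
  have [N hN] := open_triangle_bounded A B C.
  have [dm [h1 h2 h3 h4]] := @mol_derivative R.
  exact: (weak_gradient_orthogonal_eq0 mO hN dl0 shrink h1 h2 h3 h4 HG GC1).
rewrite -(sol_energy d0) -/s.
have en x : enorm x ^+ 2 = dot2 x x :> R.
  by rewrite /enorm sqr_sqrtr // /dot2 -!expr2 addr_ge0 ?sqr_ge0.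
have iG : nu.-integrable Omega (EFin \o (fun x => enorm (G x) ^+ 2)).
  rewrite (_ : (fun x => _) = (fun x => (G x).1 * (G x).1 + (G x).2 * (G x).2)).
    exact: (integrableRD mO (sqintM mO sG1 sG1) (sqintM mO sG2 sG2)).
  by apply/funext => x; rewrite en.
have iS : nu.-integrable Omega (EFin \o (fun x => enorm (grad s x) ^+ 2)).
  rewrite (_ : (fun x => _) =
      (fun x => (grad s x).1 * (grad s x).1 + (grad s x).2 * (grad s x).2)).
    exact: (integrableRD mO (sqintM mO ss1 ss1) (sqintM mO ss2 ss2)).
  by apply/funext => x; rewrite en.
have iD : nu.-integrable Omega (EFin \o (fun x => dot2 (G x) (grad s x))) :=
  integrableRD mO (sqintM mO sG1 ss1) (sqintM mO sG2 ss2).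
have iGs : nu.-integrable Omega (EFin \o (fun x => 2 * dot2 (G x) (grad s x))).
  exact: (integrableRZ mO 2 iD).
have iSum := integrableRD mO iG iGs.
transitivity (\int[nu]_(x in Omega) (enorm (G x) ^+ 2 + 2 * dot2 (G x) (grad s x) + enorm (grad s x) ^+ 2)).
  by apply: eq_Rintegral => x _; rewrite !en /G; move: (g x) (grad s x) => u v; rewrite /dot2 /=; ring.
rewrite (RintegralD mO iSum iS) (RintegralD mO iG iGs) G0 add0r.
rewrite (RintegralZl _ mO iD).
by rewrite (GC1 _ (sol_C1 A B C)) mulr0 add0r.
Qed.

Lemma phi_triangleE : phi_triangle A B C = tri_energy A B C.
Proof.
rewrite /phi_triangle /phi; apply: get_unique.
  exists (sol A B C), (grad (sol A B C)); split; first exact: sol_weak.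
  by rewrite sol_energy.
by move=> e [psi [g [ws ->]]]; exact: (weak_solution_energy ws).
Qed.

End phi_value.

(** * Right and equilateral triangles *)

Section special_triangles.
Context {R : realType}.
Implicit Types (A B C : R * R) (W h : R).

(** This is W^2 times [phi]. Here [h] is the hypotenuse, [r] the inradius, and [p], [q], [s] are the
    vertices seen from the incenter (r, r). Written without division by a function of W, it is
    visibly continuous, so that its value at 0 gives the asymptotics. *)
Definition right_triangle_profile (W : R) : R :=
  let h := Num.sqrt (W ^+ 2 + 1) in
  let r := (W + 1 - h) / 2 in
  let p := (- r, - r) in let q := (W - r, - r) in let s := (- r, 1 - r) in
  (W + h + 1) / 6 *
  (W * (dot2 p p + dot2 p q + dot2 q q) + h * (dot2 q q + dot2 q s + dot2 s s)
   + (dot2 s s + dot2 s p + dot2 p p)).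

Lemma phi_right_triangle W : 0 < W ->
  phi_triangle (0, 0) (W, 0) (0, 1) = right_triangle_profile W / W ^+ 2.
Proof.
move=> W0.
have dW : tri_det (0, 0) (W, 0) (0, 1) = W by rewrite /tri_det /=; ring.
rewrite phi_triangleE ?dW ?gt_eqF// /tri_energy /tri_perimeter /incenter dW.
have -> : enorm ((W, 0) - (0, 0)) = W.
  by rewrite /enorm /dot2 /= !subr0 mulr0 addr0 -expr2 sqrtr_sqr gtr0_norm.
have -> : enorm ((0, 1) - (W, 0)) = Num.sqrt (W ^+ 2 + 1).
  by rewrite /enorm /dot2 /= subr0 sub0r mulrNN mulr1 -expr2.
have -> : enorm ((0, 0) - (0, 1)) = 1 :> R.
  by rewrite /enorm /dot2 /= !subr0 sub0r mulrNN mulr1 mul0r add0r sqrtr1.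
have h0 : 0 <= Num.sqrt (W ^+ 2 + 1) := sqrtr_ge0 _.
have h2 : Num.sqrt (W ^+ 2 + 1) ^+ 2 = W ^+ 2 + 1.
  by rewrite sqr_sqrtr// addr_ge0// sqr_ge0.
rewrite /right_triangle_profile; move: (Num.sqrt _ : R) h0 h2 => h h0 h2.
have P0 : W + h + 1 != 0 by rewrite gt_eqF//; lra.
(* The two expressions of the inradius agree because (W + 1)^2 - h^2 = 2 W. *)
have r1 : W / (W + h + 1) = (W + 1 - h) / 2.
  by apply/eqP; rewrite eqr_div//; apply/eqP; ring: h2.
have -> : tri_map (0, 0) (W, 0) (0, 1) (1 / (W + h + 1), W / (W + h + 1)) =
    ((W + 1 - h) / 2, (W + 1 - h) / 2).
  by rewrite /tri_map /= -{}r1 !subr0 !mul0r !add0r addr0 !mul1r.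
rewrite real_normK ?num_real//; move: ((W + 1 - h) / 2 : R) => r.
have -> : ((0, 0) - (r, r) : R * R) = (- r, - r).
  by apply: injective_projections; rewrite /= sub0r.
have -> : ((W, 0) - (r, r) : R * R) = (W - r, - r).
  by apply: injective_projections; rewrite /= ?sub0r.
have -> : ((0, 1) - (r, r) : R * R) = (- r, 1 - r).
  by apply: injective_projections; rewrite /= ?sub0r.
by rewrite mul1r invfM [RHS]mulrAC !mulrA.
Qed.

Lemma continuous_right_triangle_profile : continuous right_triangle_profile.
Proof.
have ch : continuous (fun W : R => Num.sqrt (W ^+ 2 + 1)).
  move=> W; apply: continuous_comp; last exact: sqrt_continuous.
  by apply: cvgD; [exact: exprn_continuous|exact: cvg_cst].
by rewrite /right_triangle_profile /dot2 /=; cont.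
Qed.

Lemma right_triangle_profile0 : right_triangle_profile 0 = 2 / 3.
Proof.
rewrite /right_triangle_profile; have -> : 0 ^+ 2 + 1 = 1 :> R by ring.
by rewrite sqrtr1 /dot2 /=; field.
Qed.

Lemma right_triangle_profile1 : right_triangle_profile 1 = 4 / 3.
Proof.
rewrite /right_triangle_profile expr1n.
have : Num.sqrt (1 + 1 : R) ^+ 2 = 1 + 1 by rewrite sqr_sqrtr.
move: (Num.sqrt _ : R) => h h2; by rewrite /dot2 /=; field: h2.
Qed.

Lemma phi_equilateral A B C : equilateral A B C -> phi_triangle A B C = 1.
Proof.
move=> [l0 eC eA].
have sq (x : R * R) : enorm x ^+ 2 = x.1 ^+ 2 + x.2 ^+ 2.
  by rewrite /enorm sqr_sqrtr /dot2 -?expr2// addr_ge0 ?sqr_ge0.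
have := sq (A - C); have := sq (C - B); have := sq (B - A); rewrite eC eA /=.
set l := enorm (B - A) in l0 eC eA * => h1 h2 h3.
(* Lagrange's identity: the squared determinant is |u|^2 |v|^2 - (u.v)^2 for two sides u and v, with
   the scalar product given by the law of cosines. *)
have D2 : tri_det A B C ^+ 2 = 3 / 4 * l ^+ 4.
  have -> : l ^+ 4 = l ^+ 2 * l ^+ 2 by ring.
  transitivity (((B.1 - A.1) ^+ 2 + (B.2 - A.2) ^+ 2) * ((A.1 - C.1) ^+ 2 + (A.2 - C.2) ^+ 2)
    - (((B.1 - A.1) ^+ 2 + (B.2 - A.2) ^+ 2 + ((A.1 - C.1) ^+ 2 + (A.2 - C.2) ^+ 2)
       - ((C.1 - B.1) ^+ 2 + (C.2 - B.2) ^+ 2)) / 2) ^+ 2).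
    by rewrite /tri_det; field.
  by rewrite -h1 -h2 -h3; field.
have D0 : tri_det A B C != 0.
  by rewrite -(sqrf_eq0 (tri_det A B C)) D2 gt_eqF// mulr_gt0// exprn_gt0.
rewrite phi_triangleE// /tri_energy /incenter /tri_perimeter eC eA real_normK ?num_real// D2.
rewrite -/l; have -> : l / (l + l + l) = 1 / 3 by field; rewrite gt_eqF// !addr_gt0.
set J := tri_map _ _ _ _.
rewrite -!mulrDr; set S := (X in _ * (l * X)).
(* For an equilateral triangle [J] is the centroid, so the vectors from [J] to the vertices sum to
   zero and [S] is half the sum of the squared side lengths. *)
have -> : S = 3 / 2 * l ^+ 2.
  transitivity ((((B.1 - A.1) ^+ 2 + (B.2 - A.2) ^+ 2) + ((A.1 - C.1) ^+ 2 + (A.2 - C.2) ^+ 2)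
       + ((C.1 - B.1) ^+ 2 + (C.2 - B.2) ^+ 2)) / 2); last by rewrite -h1 -h2 -h3; field.
  by rewrite /S /J /tri_map /dot2 /=; field.
by field; rewrite gt_eqF.
Qed.

End special_triangles.

Theorem proposition5p6 (R : realType) :
  [/\ phi_triangle (0, 0) (W, 0) (0, 1) / (2 / 3 * W ^- 2)
        @[W --> (0 : R)^'+] --> (1 : R),
      phi_triangle (0, 0) (1, 0) (0, 1) = 4 / 3 :> R &
      forall A B C : R * R, equilateral A B C -> phi_triangle A B C = 1].
Proof.
split; last exact: phi_equilateral.
- have c : right_triangle_profile W / (2 / 3) @[W --> (0 : R)^'+] --> (1 : R).
    rewrite -[1 in X in _ --> X](@divff _ (2 / 3 : R))// -right_triangle_profile0.
    apply: cvg_at_right_filter; apply: cvgM; last exact: cvg_cst.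
    exact: continuous_right_triangle_profile.
  apply: cvg_trans c; apply: near_eq_cvg; near=> W.
  have W0 : 0 < W by near: W; exact: nbhs_right_gt.
  by rewrite phi_right_triangle//; field; rewrite gt_eqF.
- by rewrite phi_right_triangle// right_triangle_profile1 expr1n divr1.
Unshelve. all: by end_near.
Qed.
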